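(* Let $\Omega\subset\mathbb{R}^n$ be a bounded open set, let $X=(X_1,\dots,X_m)$ be a family of vector fields with Lipschitz coefficients on $\Omega$ satisfying the linear independence condition (LIC) on $\Omega$, and let $1<p<\infty$. Let $\mathcal{A}$ be the class of all open subsets of $\Omega$ and let $F:L^p(\Omega)\times\mathcal{A}\to[0,\infty]$ be an increasing functional such that: (a) $F$ is local; (b) $F$ is a measure; (c) $F$ is lower semicontinuous; (d) $F(u+c,A)=F(u,A)$ for each $u\in L^p(\Omega)$, $A\in\mathcal{A}$ and $c\in\mathbb{R}$; (e) there exist a nonnegative function $a\in L^1_{\rm loc}(\Omega)$ and a constant $b>0$ such that $$0\le F(u,A)\le\int_A\left(a(x)+b\,|Xu(x)|^p\right)dx$$ for each $A\in\mathcal{A}$ and each $u\in L^p(\Omega)$ with $u|_A\in C^1(A)$. Then there exists a Borel function $f:\Omega\times\mathbb{R}^m\to[0,\infty]$ such that: (i) for each $u\in L^p(\Omega)$ and each $A\in\mathcal{A}$ with $u|_A\in W^{1,p}_{X;\rm loc}(A)$, $$F(u,A)=\int_A f(x,Xu(x))\,dx;$$ (ii) for a.e. $x\in\Omega$, $f(x,\cdot):\mathbb{R}^m\to[0,\infty)$ is convex; (iii) for a.e. $x\in\Omega$, $0\le f(x,\eta)\le a(x)+b\,|\eta|^p$ for all $\eta\in\mathbb{R}^m$.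
   Context: Vector fields: $X_j(x)=\sum_{i=1}^n c_{ji}(x)\partial_i$, $j=1,\dots,m$, with $c_{ji}$ Lipschitz on $\Omega$; $X_j(x)$ is identified with the vector $(c_{j1}(x),\dots,c_{jn}(x))\in\mathbb{R}^n$. $Xu=(X_1u,\dots,X_mu)$ (the $X$-gradient) is taken in the distributional sense: $X_ju=g$ on an open set $A$ means $\int_A g\varphi\,dx=-\int_A u\sum_{i=1}^n\partial_i(c_{ji}\varphi)\,dx$ for all $\varphi\in C_c^\infty(A)$. (LIC): there is a (relatively) closed set $\mathcal{N}_X\subset\Omega$ of Lebesgue measure zero such that for each $x\in\Omega\setminus\mathcal{N}_X$ the vectors $X_1(x),\dots,X_m(x)$ are linearly independent in $\mathbb{R}^n$. Spaces: for $A$ open, $W^{1,p}_X(A)=\{u\in L^p(A): X_ju\in L^p(A),\ j=1,\dots,m\}$; $W^{1,p}_{X;\rm loc}(A)$ is the set of $u$ with $u|_{A'}\in W^{1,p}_X(A')$ for every open $A'\Subset A$ (compactly contained). Functionals $F:L^p(\Omega)\times\mathcal{A}\to[0,\infty]$: $F$ is increasing if $F(u,A)\le F(u,B)$ for all $u$ and all $A\subseteq B$ in $\mathcal{A}$; $F$ is a measure if for every $u\in L^p(\Omega)$ there is a Borel measure $\mu_u$ on $\Omega$ with values in $[0,\infty]$ such that $F(u,A)=\mu_u(A)$ for all $A\in\mathcal{A}$; $F$ is local if $F(u,A)=F(v,A)$ whenever $A\in\mathcal{A}$ and $u=v$ a.e. on $A$; $F$ is lower semicontinuous if for every $A\in\mathcal{A}$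 the map $F(\cdot,A)$ is lower semicontinuous on $L^p(\Omega)$ with its norm topology. *)

(* Defs.v *)
From HB Require Import structures.
From mathcomp Require Import all_boot all_order all_algebra.
From mathcomp Require Import all_classical all_reals all_analysis.
From mathcomp Require Import measurable_realfun.
Set Implicit Arguments.
Unset Strict Implicit.
Unset Printing Implicit Defensive.
Import Order.TTheory GRing.Theory Num.Theory numFieldNormedType.Exports.
Local Open Scope classical_set_scope.
Local Open Scope ring_scope.

(* the Borel sigma-algebra of 'M[R]_(m, n), in particular of R^n := 'rV[R]_n *)
HB.instance Definition _ (R : realType) (m n : nat) :=
  Measurable.copy 'M[R]_(m, n) (g_sigma_algebraType (@open 'M[R]_(m, n))).

Section rV_measure.
Context (R : realType).

Lemma measurable_rV_open (n : nat) (U : set 'rV[R]_n) : open U -> measurable U.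
Proof. by move=> oU; exact: sub_sigma_algebra. Qed.

Lemma measurable_rV_coord (n : nat) (i : 'I_n) :
  measurable_fun setT (fun x : 'rV[R]_n => x 0 i).
Proof.
apply: (measurability (@RGenOpens.G R)).
  exact: RGenOpens.measurableE.
move=> _ [_ [a [b ->]] <-]; rewrite setTI.
apply: measurable_rV_open.
apply: open_comp; last exact: interval_open.
by move=> x _; exact: coord_continuous.
Qed.

Lemma measurable_fun_rV d (T : measurableType d) (n : nat) (f : T -> 'rV[R]_n) :
  (forall i, measurable_fun setT (fun t => f t 0 i)) -> measurable_fun setT f.
Proof.
move=> mf; apply: (measurability (@open 'rV[R]_n)) => //.
move=> _ [U oU <-]; rewrite setTI.
pose cb (qk : 'rV[rat]_n * nat) : set 'rV[R]_n :=
  [set y | forall i, ball (ratr (qk.1 0 i) : R) qk.2.+1%:R^-1 (y 0 i)].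
have -> : f @^-1` U = \bigcup_qk
    (if `[< cb qk `<=` U >] then f @^-1` cb qk else set0).
  apply/seteqP; split => [t /= Uft|t [qk _]]; last first.
    by case: ifPn => // /asboolP cbU cbt; exact: cbU.
  have : nbhs (f t) U by exact: open_nbhs_nbhs.
  move=> /nbhs_ballP[e /= e0 eU].
  pose k := Num.truncn (2 * e^-1).
  have k0 : 0 < k.+1%:R^-1 :> R by rewrite invr_gt0 ltr0n.
  have ke : k.+1%:R^-1 + k.+1%:R^-1 <= e.
    rewrite -mulr2n -[X in X <= _]mulr_natl ler_pdivrMr ?ltr0n//.
    by rewrite mulrC -ler_pdivrMr// ltW// /k truncnS_gt.
  have q_ i : {q : rat | ball (ratr q : R) k.+1%:R^-1 (f t 0 i)}.
    apply/cid.
    have [q] := @rat_in_itvoo R (f t 0 i) (f t 0 i + k.+1%:R^-1) ltac:(by rewrite ltrDl).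
    rewrite in_itv/= => /andP[tq qt]; exists q.
    by rewrite /ball/= gtr0_norm ?subr_gt0// ltrBlDl.
  exists (\row_i sval (q_ i), k) => //.
  case: ifPn => [_ i|/asboolP]; first by rewrite /= mxE; exact: (svalP (q_ i)).
  case=> y cby; apply: eU; split => // a i.
  rewrite ord1; apply: le_ball ke _ _; apply: ball_triangle (cby i).
  by rewrite /= mxE; apply: ball_sym; exact: (svalP (q_ i)).
apply: countable_bigcupT_measurable; first exact: countableP.
move=> qk; case: ifPn => // _.
have -> : f @^-1` cb qk = \bigcap_(i in [set: 'I_n])
   (fun t => f t 0 i) @^-1` ball (ratr (qk.1 0 i) : R) qk.2.+1%:R^-1.
  by apply/seteqP; split => [t cbt i _|t cbt i]; [exact: cbt|exact: cbt].
apply: fin_bigcap_measurable => // i _.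
rewrite -[X in measurable X]setTI; apply: mf => //.
by apply: open_measurable; apply: ball_open; rewrite invr_gt0 ltr0n.
Qed.

Definition rV_cons n (z : measurableTypeR R * 'rV[R]_n) : 'rV[R]_n.+1 :=
  \row_i oapp (z.2 0) z.1 (unlift ord0 i).

Lemma rV_cons0 n z : @rV_cons n z 0 ord0 = z.1.
Proof. by rewrite mxE unlift_none. Qed.

Lemma rV_consS n z i : @rV_cons n z 0 (lift ord0 i) = z.2 0 i.
Proof. by rewrite mxE liftK. Qed.

Lemma measurable_rV_cons n : measurable_fun setT (@rV_cons n).
Proof.
apply: measurable_fun_rV => i; case: (unliftP ord0 i) => [j|] ->.
  under eq_fun do rewrite rV_consS.
  exact: measurableT_comp (measurable_rV_coord j) measurable_snd.
by under eq_fun do rewrite rV_cons0; exact: measurable_fst.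
Qed.

Definition rV_tail n (x : 'rV[R]_n.+1) : 'rV[R]_n :=
  \row_i x 0 (lift ord0 i).

Lemma measurable_rV_tail n : measurable_fun setT (@rV_tail n).
Proof.
apply: measurable_fun_rV => i; under eq_fun do rewrite mxE.
exact: measurable_rV_coord.
Qed.

Lemma rV_consK n z : @rV_tail n (rV_cons z) = z.2.
Proof. by apply/rowP => i; rewrite mxE rV_consS. Qed.

Section lebesgue_rV_step.
Context (n : nat) (mu : {sigma_finite_measure set 'rV[R]_n -> \bar R}).
Local Open Scope ereal_scope.

Definition lebesgue_rV_step : set 'rV[R]_n.+1 -> \bar R :=
  pushforward (lebesgue_measure \x mu) (@rV_cons n).

Let step0 : lebesgue_rV_step set0 = 0.
Proof. by rewrite /lebesgue_rV_step /pushforward preimage_set0 measure0. Qed.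

Let step_ge0 A : 0 <= lebesgue_rV_step A.
Proof. by rewrite /lebesgue_rV_step /pushforward; exact: measure_ge0. Qed.

Let step_sigma_additive : semi_sigma_additive lebesgue_rV_step.
Proof.
have mc A : measurable A -> measurable (@rV_cons n @^-1` A).
  by move=> mA; rewrite -[X in measurable X]setTI; exact: measurable_rV_cons.
move=> F mF tF mUF; rewrite /lebesgue_rV_step /pushforward preimage_bigcup.
apply: measure_semi_sigma_additive.
- by move=> k; exact: mc.
- apply/trivIsetP => /= i j _ _ ij; rewrite -preimage_setI.
  by move/trivIsetP : tF => /(_ _ _ _ _ ij) ->//; rewrite preimage_set0.
- by rewrite -preimage_bigcup; exact: mc.
Qed.

HB.instance Definition _ := isMeasure.Build _ _ _ lebesgue_rV_step
  step0 step_ge0 step_sigma_additive.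

Lemma lebesgue_rV_stepE (A : set R) (B : set 'rV[R]_n) :
  measurable (A : set (measurableTypeR R)) -> measurable B ->
  lebesgue_rV_step [set x : 'rV[R]_n.+1 | A (x 0%R ord0) /\ B (rV_tail x)] =
  lebesgue_measure A * mu B.
Proof.
move=> mA mB; rewrite -product_measure1E// /lebesgue_rV_step /pushforward.
congr (_ _); apply/seteqP; split=> z /=; rewrite rV_cons0 rV_consK.
  by case.
by case.
Qed.

Let step_sigma_finite : sigma_finite setT lebesgue_rV_step.
Proof.
have [F TF Foo] := sigma_finiteT mu.
have [G TG Goo] := sigma_finiteT (@lebesgue_measure R).
pose H (ij : nat * nat) : set 'rV[R]_n.+1 :=
  [set x : 'rV[R]_n.+1 | G ij.1 (x 0%R ord0) /\ F ij.2 (rV_tail x)].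
have [f _ fs] : {f : nat -> nat * nat & True & forall ij, exists k, f k = ij}.
  exists (odflt (0, 0)%N \o unpickle) => // ij.
  by exists (pickle ij); rewrite /= pickleK.
exists (H \o f).
  apply/seteqP; split => // x _.
  have : [set: R] (x 0%R ord0) by [].
  rewrite TG => -[i _ Gi].
  have : [set: 'rV[R]_n] (rV_tail x) by [].
  rewrite TF => -[j _ Fj].
  by have [k fk] := fs (i, j); exists k => //=; rewrite fk.
move=> k /=; have [mG Gk] := Goo (f k).1; have [mF Fk] := Foo (f k).2.
split.
  apply: measurableI.
    rewrite -[X in measurable X]setTI.
    by apply: measurable_rV_coord.
  by rewrite -[X in measurable X]setTI; exact: measurable_rV_tail.
by rewrite lebesgue_rV_stepE// lte_mul_pinfty// ge0_fin_numE.
Qed.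

HB.instance Definition _ := Measure_isSigmaFinite.Build _ _ _ lebesgue_rV_step
  step_sigma_finite.

End lebesgue_rV_step.

(* R^n.+1 is identified with R * R^n by rV_cons; see lebesgue_rV_box *)
Fixpoint lebesgue_rV (n : nat) : {sigma_finite_measure set 'rV[R]_n -> \bar R} :=
  match n with
  | 0 => @dirac _ 'rV[R]_0 0 R
  | n'.+1 => lebesgue_rV_step (lebesgue_rV n')
  end.

Lemma lebesgue_rVS n (A : set 'rV[R]_n.+1) :
  lebesgue_rV n.+1 A =
  ((lebesgue_measure \x lebesgue_rV n) (@rV_cons n @^-1` A))%E.
Proof. by []. Qed.

Lemma lebesgue_rV_box n (a b : 'rV[R]_n) : (forall i, a 0 i <= b 0 i) ->
  lebesgue_rV n [set x : 'rV[R]_n | forall i, a 0 i < x 0 i <= b 0 i] =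
  (\prod_(i < n) (b 0 i - a 0 i))%:E.
Proof.
elim: n => [|n IHn] in a b * => ab.
  rewrite big_ord0 -(@diracT _ 'rV[R]_0 R 0); congr (_ _).
  by apply/seteqP; split => // x _ [].
rewrite big_ord_recl EFinM.
pose J : set R := `]a 0 ord0, b 0 ord0]%classic.
pose B := [set y : 'rV[R]_n | forall i, rV_tail a 0 i < y 0 i <= rV_tail b 0 i].
have -> : [set x : 'rV[R]_n.+1 | forall i, a 0 i < x 0 i <= b 0 i] =
    [set x : 'rV[R]_n.+1 | J (x 0 ord0) /\ B (rV_tail x)].
  apply/seteqP; split => [x abx|x [xJ xB] i].
    by split; [rewrite /J/= in_itv/=; exact: abx|move=> i; rewrite !mxE].
  case: (unliftP ord0 i) => [j|] ->; last by move: xJ; rewrite /J/= in_itv.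
  by have := xB j; rewrite !mxE.
rewrite lebesgue_rVS -[LHS]/(lebesgue_rV_step (lebesgue_rV n) _).
rewrite lebesgue_rV_stepE//; [|exact: measurable_itv|]; last first.
  rewrite (_ : B = \bigcap_(i in [set: 'I_n])
    (fun y => y 0 i) @^-1` `]rV_tail a 0 i, rV_tail b 0 i]%classic).
    apply: fin_bigcap_measurable => // i _.
    by rewrite -[X in measurable X]setTI; exact: measurable_rV_coord.
  apply/seteqP; split => y yB i => [_|]; first by rewrite /= in_itv/=.
  by have := yB i Logic.I; rewrite /= in_itv.
congr (_ * _)%E; last first.
  rewrite [LHS]IHn; last by move=> i; rewrite !mxE.
  by congr EFin; apply: eq_bigr => i _; rewrite !mxE.
rewrite lebesgue_measure_itv/= lte_fin; case: ltP => //.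
by move=> ba; rewrite (@le_anti _ _ (b 0 ord0) (a 0 ord0)) ?subrr// ba ab.
Qed.

End rV_measure.

Section function_spaces.
Context {R : realType} {n : nat}.
Implicit Types (A K : set 'rV[R]_n) (u v g phi : 'rV[R]_n -> R) (p : R).
Local Notation leb := (@lebesgue_rV R n).

(* `|_| on 'rV[R]_k is the sup norm *)
Definition eucl_norm k (v : 'rV[R]_k) : R := Num.sqrt (\sum_i v 0 i ^+ 2).

Definition partial (i : 'I_n) (f : 'rV[R]_n -> R) : 'rV[R]_n -> R :=
  fun x => 'D_(delta_mx 0 i) f x.

(* only meant for A open *)
Fixpoint Ck (k : nat) A (f : 'rV[R]_n -> R) : Prop :=
  (forall x, A x -> {for x, continuous f}) /\
  match k with
  | 0 => True
  | k'.+1 => forall i, (forall x, A x -> derivable f x (delta_mx 0 i)) /\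
                       Ck k' A (partial i f)
  end.

Definition test_function A phi :=
  [/\ forall k, Ck k setT phi,
      compact (closure [set x | phi x != 0]) &
      closure [set x | phi x != 0] `<=` A].

Definition compactly_contained A' A :=
  compact (closure A') /\ closure A' `<=` A.

(* u restricted to A is in L^p(A). Elements of L^p(A) are represented by Borel
   functions, of which only the values on A are relevant; they are not
   quotiented by equality a.e. *)
Definition Lp A p : set ('rV[R]_n -> R) :=
  [set u : 'rV[R]_n -> R | u \_ A \in Lfun leb p%:E].

Definition Lp_dist A p u v : \bar R :=
  'N[leb]_p%:E[EFin \o ((u \- v) \_ A)].

Definition L1loc A : set ('rV[R]_n -> R) :=
  [set u : 'rV[R]_n -> R | measurable_fun A u /\
    forall K, compact K -> K `<=` A -> (\int[leb]_(x in K) `|u x|%:E < +oo)%E].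

Definition ae_equal A u v := u = v %[ae leb in A].

End function_spaces.

Section X_gradient.
Context {R : realType} {n m : nat}.
Variable c : 'I_m -> 'I_n -> 'rV[R]_n -> R.
Implicit Types (A : set 'rV[R]_n) (u g phi : 'rV[R]_n -> R) (p : R).
Local Notation leb := (@lebesgue_rV R n).

Definition vfield (j : 'I_m) (x : 'rV[R]_n) : 'rV[R]_n := \row_i c j i x.

Definition LIC (Omega : set 'rV[R]_n) :=
  exists N : set 'rV[R]_n,
    [/\ N `<=` Omega, (exists2 C, closed C & N = Omega `&` C), leb N = 0%E &
        forall x, (Omega `\` N) x -> free [seq vfield j x | j <- enum 'I_m]].

(* X_j u = g on A. Since c j i is only Lipschitz, the partial derivatives of
   c j i * phi exist almost everywhere. *)
Definition weak_X A (j : 'I_m) u g :=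
  L1loc A g /\
  forall phi, test_function A phi ->
    (\int[leb]_(x in A) (g x * phi x)%:E =
     - \int[leb]_(x in A)
         (u x * \sum_(i < n) partial i (fun y => c j i y * phi y)%R x)%:E)%E.

Definition is_Xgrad A u (G : 'rV[R]_n -> 'rV[R]_m) :=
  forall j, weak_X A j u (fun x => G x 0 j).

(* a representative of the X-gradient of u on A, which is unique a.e. on A;
   arbitrary if u has no locally integrable X-gradient on A *)
Definition Xgrad A u : 'rV[R]_n -> 'rV[R]_m := get (is_Xgrad A u).

Definition W1pX A p u :=
  Lp A p u /\ forall j, exists2 g, Lp A p g & weak_X A j u g.

Definition W1pX_loc A p u :=
  forall A', open A' -> compactly_contained A' A -> W1pX A' p u.

End X_gradient.

Section functionals.
Context {R : realType} {n : nat}.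
Variables (Omega : set 'rV[R]_n) (p : R).
Variable F : ('rV[R]_n -> R) -> set 'rV[R]_n -> \bar R.
Local Notation leb := (@lebesgue_rV R n).
Local Open Scope ereal_scope.

Definition open_subsets : set (set 'rV[R]_n) :=
  [set A | open A /\ A `<=` Omega].

(* F : L^p(Omega) * open_subsets -> [0, +oo]; the values of F outside of this
   domain are irrelevant *)
Definition nonneg_functional := forall u A,
  Lp Omega p u -> open_subsets A -> 0 <= F u A.

Definition increasing_functional := forall u A B,
  Lp Omega p u -> open_subsets A -> open_subsets B -> A `<=` B ->
  F u A <= F u B.

(* in particular, F only depends on the classes of its first argument in the
   quotient of L^p(Omega) by equality a.e. *)
Definition local_functional := forall u v A,
  Lp Omega p u -> Lp Omega p v -> open_subsets A -> ae_equal A u v ->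
  F u A = F v A.

(* a Borel measure on Omega is represented by a Borel measure on R^n, of which
   only the values on subsets of Omega are relevant *)
Definition measure_functional := forall u, Lp Omega p u ->
  exists mu : {measure set 'rV[R]_n -> \bar R},
    forall A, open_subsets A -> F u A = mu A.

Definition lsc_functional := forall A, open_subsets A ->
  forall u, Lp Omega p u -> forall t : R, t%:E < F u A ->
  exists2 d : R, (0 < d)%R &
    forall v, Lp Omega p v -> Lp_dist Omega p v u < d%:E -> t%:E < F v A.

End functionals.

(* Main.v *)
(** Mollification (Friedrichs' commutator lemma) and lower semicontinuity carry
    the growth bound (e) from C^1 functions to every u with an X-gradient G that
    is locally in L^p: F(u, U) <= int_U (a + b |G|^p) for U compactly contained
    in A. Hence the measure F(u, .) has a density g_u on A.

    If v is C^1 and 0 < t < 1, compose v with a C^1 staircase of small steps whose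
    slope is 1 on a fraction t of each period and 0 elsewhere, up to short
    transitions. The composition h(v) is uniformly close to t v, and u + h(v) is,
    up to an additive constant, u + v where the slope is 1 and u where it is 0. By
    locality and invariance under constants F(u + h(v), .) is F(u + v, .) or
    F(u, .) there; the transitions are controlled by the growth bound, and their
    contribution becomes small on averaging over the phase of the staircase.
    Lower semicontinuity gives
      F(u + t v, U) <= t F(u + v, U) + (1 - t) F(u, U).
    With v approximating (w - u) / t this becomes, for densities,
      g_w <= g_u + t (a + b |Xu + (Xw - Xu) / t|^p),
    and letting t tend to 0 shows that g_u(x) only depends on Xu(x).

    Let u range over the linear functions with rational slopes q. By (LIC) their
    X-gradients C(x) q are dense in R^m for a.e. x, and f(x, eta) is the infimum
    over q and t of the right-hand side with Xu = C(x) q and Xw = eta. *)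

From HB Require Import structures.
From mathcomp Require Import all_boot all_order all_algebra.
From mathcomp Require Import all_classical all_reals all_analysis.
From mathcomp Require Import measurable_realfun.
From mathcomp Require Import ring lra zify.
Require Import Defs.
Set Implicit Arguments.
Unset Strict Implicit.
Unset Printing Implicit Defensive.
Import Order.TTheory GRing.Theory Num.Theory numFieldNormedType.Exports.
Local Open Scope classical_set_scope.
Local Open Scope ring_scope.

(** * Regularity of Borel measures *)

(** The X-gradient [C(x) q] of a linear function varies with [x], and in general no function has a
    given constant X-gradient, so the gradient cannot be frozen as in the Euclidean case. The
    inequality with parameter [t] replaces that argument: it compares two densities at almost every
    point, at a cost [O(t)] where the X-gradients differ by at most [t].

    Lipschitz coefficients leave only almost everywhere derivatives of [c_ji phi], obtained by
    Radon-Nikodym in one variable and Fubini along lines. Nor does mollification commute with [X_j];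
    the commutator is dominated by averages of [|u(x+z) - u(x)|], which are small in L^p by
    continuity of translations.

    A single staircase may place its transitions where the energy concentrates. Over [N] integer
    phases a point meets a bounded number of transition strips, so the best phase pays [O(1/N)].

    [F] is given on open sets only, whence the regularity of measures; [a] is only locally
    integrable, so energies are finite only away from the boundary, whence the exhaustions by inner
    sets. *)

Lemma ae_mono d (T : measurableType d) (R : realType) (mu : {measure set T -> \bar R})
    (P Q : T -> Prop) : (forall x, P x -> Q x) ->
  {ae mu, forall x, P x} -> {ae mu, forall x, Q x}.
Proof.
by move=> PQ; apply: filterS => //; exact: (ae_filter_ringOfSetsType mu).
Qed.

Section cts.
Context {R : realType} {n : nat}.
Implicit Types (x : 'rV[R]_n) (f g : 'rV[R]_n -> R).

Lemma ctsD f g x : {for x, continuous f} -> {for x, continuous g} ->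
  {for x, continuous (fun y => f y + g y)}.
Proof. exact: (@cvgD _ _ _ (nbhs x) (nbhs_filter x)). Qed.

Lemma ctsB f g x : {for x, continuous f} -> {for x, continuous g} ->
  {for x, continuous (fun y => f y - g y)}.
Proof. exact: (@cvgB _ _ _ (nbhs x) (nbhs_filter x)). Qed.

Lemma ctsM f g x : {for x, continuous f} -> {for x, continuous g} ->
  {for x, continuous (fun y => f y * g y)}.
Proof. exact: (@cvgM _ _ (nbhs x) (nbhs_filter x)). Qed.

Lemma cts_norm f x : {for x, continuous f} -> {for x, continuous (fun y => `|f y|)}.
Proof. exact: (@cvg_norm _ _ _ (nbhs x) (nbhs_filter x)). Qed.

Lemma cts_cst (k : R) x : {for x, continuous (fun=> k)}.
Proof. exact: (@cst_continuous _ _ k x). Qed.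

Lemma cts_comp (phi : R -> R) f x : {for x, continuous f} -> {for f x, continuous phi} ->
  {for x, continuous (fun y => phi (f y))}.
Proof. by move=> cf cp; apply: (cvg_comp _ _ cf cp). Qed.

Lemma cts_translation f x h : {for x + h, continuous f} -> {for x, continuous (fun y => f (y + h))}.
Proof.
move=> cf.
have hc : (fun y : 'rV[R]_n => y + h) @ x --> x + h.
  apply: (@cvgD _ _ _ (nbhs x) (nbhs_filter x)); [exact: cvg_id|exact: cvg_cst].
exact: (cvg_comp _ _ hc cf).
Qed.

Lemma cts_coord (i : 'I_n) x : {for x, continuous (fun y : 'rV[R]_n => y 0 i)}.
Proof. exact: coord_continuous. Qed.

Lemma cts_ext f g x : f =1 g -> {for x, continuous f} -> {for x, continuous g}.
Proof. by move=> /funext ->. Qed.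

Lemma cts_sum (I : Type) (s : seq I) (F : I -> 'rV[R]_n -> R) x :
  (forall i, {for x, continuous (F i)}) -> {for x, continuous (fun y => \sum_(i <- s) F i y)}.
Proof.
move=> cF; elim: s => [|i s IHs].
  by apply: (@cts_ext (fun=> 0)) => [y|]; [rewrite big_nil|exact: cts_cst].
by apply: (cts_ext _ (ctsD (cF i) IHs)) => y; rewrite big_cons.
Qed.

Lemma cts_prod (I : Type) (s : seq I) (F : I -> 'rV[R]_n -> R) x :
  (forall i, {for x, continuous (F i)}) -> {for x, continuous (fun y => \prod_(i <- s) F i y)}.
Proof.
move=> cF; elim: s => [|i s IHs].
  by apply: (@cts_ext (fun=> 1)) => [y|]; [rewrite big_nil|exact: cts_cst].
by apply: (cts_ext _ (ctsM (cF i) IHs)) => y; rewrite big_cons.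
Qed.

Lemma cts_filter f x (P : R -> Prop) : {for x, continuous f} -> nbhs (f x) P -> nbhs x (fun y => P (f y)).
Proof. by move=> cf Pf; exact: cf. Qed.

End cts.

(** * Lebesgue measure on row vectors: translations and balls *)

Section rV_basics.
Context {R : realType}.
Local Notation leb n := (@lebesgue_rV R n).

Lemma nbhs_open (T : topologicalType) (A : set T) :
  (forall x, A x -> nbhs x A) -> open A.
Proof. by rewrite openE. Qed.

Lemma open_continuous_measurable_fun n (A : set 'rV[R]_n) (f : 'rV[R]_n -> R) :
  open A -> (forall x, A x -> {for x, continuous f}) -> measurable_fun A f.
Proof.
move=> oA cf; apply: (measurability (@RGenOpens.G R)).
  exact: RGenOpens.measurableE.
move=> _ [_ [a [b ->]] <-]; apply: measurable_rV_open.
apply: nbhs_open => x [Ax fx]; apply: filterI.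
  exact: open_nbhs_nbhs.
by apply: cf => //; apply: open_nbhs_nbhs; split => //; exact: interval_open.
Qed.

Lemma continuous_rV_measurable_fun n (f : 'rV[R]_n -> R) :
  continuous f -> measurable_fun setT f.
Proof. by move=> cf; apply: open_continuous_measurable_fun => [|x _]; [exact: openT|exact: cf]. Qed.

Lemma lebesgue_measure_translation (t : R) (A : set R) : measurable A ->
  pushforward lebesgue_measure (fun x : measurableTypeR R => (x + t : measurableTypeR R)) A = lebesgue_measure A.
Proof.
move=> mA; apply/esym/lebesgue_measure_unique => //=.
  exact: measurable_funD.
move=> _ _ [[a b] _ <-]; rewrite /pushforward.
have -> : (fun x : R => x + t) @^-1` `]a, b]%classic = `]a - t, b - t]%classic.
  by apply/seteqP; split => x; rewrite /= !in_itv/= ltrBlDr lerBrDr.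
rewrite !lebesgue_measure_itv/= !lte_fin ltrD2r.
by case: ifPn => // _; rewrite -!EFinD; congr EFin; ring.
Qed.

Local Open Scope ereal_scope.

Lemma ge0_integral_translation (t : R) (f : R -> \bar R) :
  measurable_fun setT f -> (forall x, 0 <= f x) ->
  \int[lebesgue_measure]_x f (x + t)%R = \int[lebesgue_measure]_x f x.
Proof.
move=> mf f0.
have mt : measurable_fun setT (fun x : measurableTypeR R => (x + t)%R : measurableTypeR R).
  exact: measurable_funD.
transitivity (\int[pushforward lebesgue_measure
  (fun x : measurableTypeR R => (x + t)%R : measurableTypeR R)]_x f x).
  by rewrite ge0_integral_pushforward// => y _.
by apply: eq_measure_integral => A mA _; exact: lebesgue_measure_translation.
Qed.

Lemma measurable_rV_translation n (h : 'rV[R]_n) :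
  measurable_fun setT (fun x : 'rV[R]_n => (x + h)%R).
Proof.
apply: measurable_fun_rV => i; under eq_fun do rewrite mxE.
by apply: measurable_funD => //; exact: measurable_rV_coord.
Qed.

Lemma measurable_preimageT d d' (T1 : measurableType d) (T2 : measurableType d')
    (f : T1 -> T2) (A : set T2) :
  measurable_fun setT f -> measurable A -> measurable (f @^-1` A).
Proof. by move=> mf mA; rewrite -[X in measurable X]setTI; exact: mf. Qed.

(** Induction on the dimension: a translation acts separately on the first coordinate and on the
    tail, so sections of the translated set are translated sections. *)
Lemma lebesgue_rV_translation n (h : 'rV[R]_n) (A : set 'rV[R]_n) :
  measurable A -> leb n ((fun x => x + h)%R @^-1` A) = leb n A.
Proof.
elim: n h A => [|n IHn] h A mA.
  congr (leb 0 _); apply/seteqP; split => x /=.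
    by rewrite (_ : x + h = x)%R//; apply/rowP => -[].
  by rewrite (_ : x + h = x)%R//; apply/rowP => -[].
have mA' : measurable (@rV_cons R n @^-1` A).
  exact: measurable_preimageT (@measurable_rV_cons R n) mA.
rewrite !lebesgue_rVS /product_measure1/=.
rewrite -(@ge0_integral_translation (h 0%R ord0) (fun x => leb n (xsection (@rV_cons R n @^-1` A) x)))//; last first.
  exact: measurable_fun_xsection.
apply: eq_integral => t _; rewrite /=.
rewrite -(IHn (rV_tail h) (xsection (@rV_cons R n @^-1` A) (t + h 0 ord0)%R)); last first.
  exact: (measurable_xsection (t + h 0 ord0)%R mA').
congr (leb n _); apply/seteqP.
have E y : (rV_cons (t, y) + h = rV_cons ((t + h 0 ord0)%R, (y + rV_tail h)%R))%R.
  by apply/rowP => i; rewrite !mxE; case: unliftP => [j|] ->//=; rewrite !mxE.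
split => y; rewrite /xsection/= !inE/=.
  by move=> ?; rewrite -E.
by rewrite E.
Qed.

Lemma ge0_integral_rV_translation n (h : 'rV[R]_n) (f : 'rV[R]_n -> \bar R) :
  measurable_fun setT f -> (forall x, 0 <= f x) ->
  \int[leb n]_x f (x + h)%R = \int[leb n]_x f x.
Proof.
move=> mf f0.
transitivity (\int[pushforward (leb n) (fun x => x + h)%R]_x f x).
  by rewrite ge0_integral_pushforward//; exact: measurable_rV_translation.
have mt := @measurable_rV_translation n h.
by apply: eq_measure_integral => // A mA _; exact: lebesgue_rV_translation.
Qed.

Lemma integral_rV_translation n (h : 'rV[R]_n) (f : 'rV[R]_n -> \bar R) :
  measurable_fun setT f ->
  \int[leb n]_x f (x + h)%R = \int[leb n]_x f x.
Proof.
move=> mf; rewrite integralE [RHS]integralE.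
have Ep : \int[leb n]_x f^\+ (x + h)%R = \int[leb n]_x f^\+ x.
  by apply: ge0_integral_rV_translation => //; exact: measurable_funepos.
have En : \int[leb n]_x f^\- (x + h)%R = \int[leb n]_x f^\- x.
  by apply: ge0_integral_rV_translation => //; exact: measurable_funeneg.
rewrite -[X in _ = X - _]Ep -[X in _ = _ - X]En.
by rewrite -[in LHS]/(f \o (fun x => x + h)%R) (funepos_comp f) (funeneg_comp f).
Qed.

(** Balls of the sup norm are cubes. Half-open boxes of half-sides [r] and [r / 2] enclose the ball
    from outside and inside; the lower bound is not sharp, but has the right scaling. *)
Lemma lebesgue_rV_ball n (x : 'rV[R]_n) (r : R) : (0 < r)%R ->
  leb n (ball x r) <= ((2 * r) ^+ n)%:E /\ ((r ^+ n)%:E <= leb n (ball x r)).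
Proof.
move=> r0.
have B (s : R) : (0 < s)%R -> leb n [set y : 'rV[R]_n | forall i, (x 0 i - s < y 0 i <= x 0 i + s)%R]
    = ((2 * s) ^+ n)%:E.
  move=> s0; have := @lebesgue_rV_box R n (\row_i (x 0 i - s))%R (\row_i (x 0 i + s))%R.
  under [X in leb n X]eq_set do under eq_forall do rewrite !mxE.
  move=> ->; last by move=> i; rewrite !mxE lerD2l ge0_cp// ltW.
  congr EFin; rewrite (eq_bigr (fun=> 2 * s)%R) ?prodr_const ?card_ord//.
  by move=> i _; rewrite !mxE; ring.
have mB (s : R) : measurable [set y : 'rV[R]_n | forall i, (x 0 i - s < y 0 i <= x 0 i + s)%R].
  rewrite (_ : [set _ | _] = \bigcap_(i in [set: 'I_n])
    (fun y : 'rV[R]_n => y 0%R i) @^-1` `](x 0 i - s)%R, (x 0 i + s)%R]%classic).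
    apply: fin_bigcap_measurable => // i _.
    exact: measurable_preimageT (@measurable_rV_coord R n i) _.
  apply/seteqP; split => y yB i => [_|]; first by rewrite /= in_itv/=.
  by have := yB i Logic.I; rewrite /= in_itv.
have mb : measurable (ball x r) by apply: measurable_rV_open; exact: ball_open.
split.
  rewrite -B//; apply: le_measure; rewrite ?inE// => y xy i.
  by have := xy.2 0%R i; rewrite /ball/= ltr_distl => /andP[h1 h2]; apply/andP; split; lra.
rewrite [X in (X ^+ n)%R%:E](_ : r = 2 * (r / 2))%R; last by field.
rewrite -B ?divr_gt0//; apply: le_measure; rewrite ?inE// => y xy; split => // a i.
rewrite ord1 /ball/= ltr_distl; have /andP[h1 h2] := xy i.
by apply/andP; split; lra.
Qed.

End rV_basics.

Section regularity.
Context {R : realType} {n : nat}.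
Implicit Types A B : set 'rV[R]_n.

(** The inner parallel set at distance [r]. It is closed whatever [A] is, and exhausts an open [A]
    as [r] decreases to 0. *)
Definition inset A (r : R) := [set x | ball x r `<=` A].

Lemma inset_sub A r : 0 < r -> inset A r `<=` A.
Proof. by move=> r0 x; apply; exact: ballxx. Qed.

Lemma closed_inset A r : closed (inset A r).
Proof.
move=> x cx z xz.
have : nbhs x (ball z r) by apply: open_nbhs_nbhs; split; [apply: ball_open; exact: xz.1|exact: ball_sym].
by move=> /cx[y [yA zy]]; apply: yA; exact: ball_sym.
Qed.

Lemma inset_bigcup A : open A -> \bigcup_k inset A k.+1%:R^-1 = A.
Proof.
move=> oA; apply/seteqP; split => [x [k _]|x Ax].
  by apply: inset_sub; rewrite invr_gt0.
have : nbhs x A by exact: open_nbhs_nbhs.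
move=> /nbhs_ballP[e /= e0 eA].
exists (Num.truncn e^-1) => // z xz; apply: eA.
apply: le_ball xz; rewrite invf_ple ?posrE ?ltr0n//.
by rewrite ltW// truncnS_gt.
Qed.

Lemma le_inset A r s : r <= s -> inset A s `<=` inset A r.
Proof. by move=> rs x sA z xz; apply: sA; exact: le_ball xz. Qed.

Lemma closed_rV_measurable A : closed A -> measurable A.
Proof.
by move=> cA; rewrite -[A]setCK; apply: measurableC; apply: measurable_rV_open; exact: closed_openC.
Qed.

(** The sets with this approximation property form a sigma-algebra containing the open sets.
    Complements swap the roles of [C] and [U]; a countable union keeps all the [U k] but only
    finitely many [C k], so that the inner set stays closed; an open set is the increasing union of
    its insets. *)
Lemma finite_measure_regular (mu : {finite_measure set 'rV[R]_n -> \bar R}) A (e : R) :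
  measurable A -> 0 < e ->
  exists C U, [/\ closed C, open U, C `<=` A, A `<=` U & (mu (U `\` C) < e%:E)%E].
Proof.
pose P := [set A | forall e : R, 0 < e ->
  exists C U, [/\ closed C, open U, C `<=` A, A `<=` U & (mu (U `\` C) < e%:E)%E]].
suff mP : measurable `<=` P by move=> mA; exact: mP.
have fin B : measurable B -> (mu B < +oo)%E.
  by move=> mB; rewrite ltey_eq fin_num_measure.
apply: smallest_sub; last first.
  move=> U oU {}e e0.
  have : mu (U `\` inset U k.+1%:R^-1) @[k --> \oo] --> mu (\bigcap_k (U `\` inset U k.+1%:R^-1)).
    apply: nonincreasing_cvg_mu.
    - by apply: fin; apply: measurableD; [exact: measurable_rV_open|apply: closed_rV_measurable; exact: closed_inset].
    - by move=> k; apply: measurableD; [exact: measurable_rV_open|apply: closed_rV_measurable; exact: closed_inset].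
    - by apply: bigcap_measurable => // k _; apply: measurableD; [exact: measurable_rV_open|apply: closed_rV_measurable; exact: closed_inset].
    - move=> i j ij; apply/subsetPset; apply: setDS; apply: le_inset.
      by rewrite lef_pV2 ?posrE ?ltr0n// ler_nat.
  have -> : \bigcap_k (U `\` inset U k.+1%:R^-1) = U `\` \bigcup_k inset U k.+1%:R^-1.
    apply/seteqP; split => [x h|x [Ux nx] k _]; last by split => // ?; apply: nx; exists k.
    by split=> [|[k _]]; [exact: (h 0%N Logic.I).1|exact: (h k Logic.I).2].
  rewrite inset_bigcup// setDv measure0.
  move=> /fine_cvgP[fi] /cvgrPdist_lt /(_ _ e0) [N _ /(_ N (leqnn _))].
  rewrite sub0r normrN => h.
  exists (inset U N.+1%:R^-1), U; split => //; first exact: closed_inset.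
    by apply: inset_sub; rewrite invr_gt0.
  have m1 : measurable (U `\` inset U N.+1%:R^-1).
    by apply: measurableD; [exact: measurable_rV_open|apply: closed_rV_measurable; exact: closed_inset].
  rewrite -[ltLHS]fineK ?fin_num_measure// lte_fin.
  exact: le_lt_trans (ler_norm _) h.
split.
- by move=> {}e e0; exists set0, set0; rewrite setDv measure0; split => //; exact: closed0.
- move=> B PB {}e e0; have [C [U [cC oU CB BU mUC]]] := PB _ e0.
  exists (setT `\` U), (setT `\` C); rewrite !setTD; split => //.
  + exact: open_closedC.
  + exact: closed_openC.
  + by apply: subsetC.
  + by apply: subsetC.
  + by rewrite setDE setCK setIC -setDE.
- move=> B PB {}e e0.
  (* These errors add up to [e / 2]; the remaining half leaves room to replace the union of all
     [C k] by a finite one. *)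
  pose d k : R := (e / 2) / (2 ^ k.+1)%:R.
  have d0 k : 0 < d k by rewrite !divr_gt0// ltr0n expn_gt0.
  have /choice[C /choice[U CU]] := fun k => PB k _ (d0 k).
  pose V := \bigcup_k U k; pose D := \bigcup_k C k.
  have oV : open V by apply: bigcup_open => k _; have [] := CU k.
  have mC k : measurable (C k) by apply: closed_rV_measurable; have [] := CU k.
  have mU k : measurable (U k) by apply: measurable_rV_open; have [] := CU k.
  have mD : measurable D by apply: bigcupT_measurable.
  have mV : measurable V by apply: bigcupT_measurable.
  have VD : (mu (V `\` D) <= (e / 2)%:E)%E.
    apply: (@le_trans _ _ (\sum_(k <oo) mu (U k `\` C k))%E).
      apply: measure_sigma_subadditive => //.
      - by move=> k; exact: measurableD.
      - exact: measurableD.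
      - by move=> x [[k _ Ux] nD]; exists k => //; split => // Cx; apply: nD; exists k.
    apply: le_trans (epsilon_trick0 xpredT (ltW (divr_gt0 e0 (ltr0n _ 2)))).
    have UCd k : (mu (U k `\` C k) <= (d k)%:E)%E by have [_ _ _ _ /ltW] := CU k.
    by apply: lee_nneseries => // k _ _; exact: UCd.
  have : mu (V `\` \big[setU/set0]_(i < k) C i) @[k --> \oo] -->
      mu (\bigcap_k (V `\` \big[setU/set0]_(i < k) C i)).
    have mk k : measurable (V `\` \big[setU/set0]_(i < k) C i).
      by apply: measurableD => //; apply: bigsetU_measurable.
    apply: nonincreasing_cvg_mu => //.
    - exact: fin.
    - exact: bigcap_measurable.
    - by move=> i j ij; apply/subsetPset; apply: setDS; exact: subset_bigsetU.
  have -> : \bigcap_k (V `\` \big[setU/set0]_(i < k) C i) = V `\` D.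
    apply/seteqP; split => [x h|x [Vx nx] k _]; last first.
      by split => //; rewrite -bigcup_mkord => -[i _ Ci]; apply: nx; exists i.
    split=> [|[k _ Ck]]; first exact: (h 0%N Logic.I).1.
    by apply: (h k.+1 Logic.I).2; rewrite -bigcup_mkord; exists k => /=.
  move=> h.
  have ee : (mu (V `\` D) < e%:E)%E.
    by apply: le_lt_trans VD _; rewrite lte_fin ltr_pdivrMr//; lra.
  have mW k : measurable (V `\` \big[setU/set0]_(i < k) C i).
    by apply: measurableD => //; apply: bigsetU_measurable.
  have [N hN] : exists N, (mu (V `\` \big[setU/set0]_(i < N) C i) < e%:E)%E.
    have mVD : measurable (V `\` D) by exact: measurableD.
    move: h; rewrite -[X in _ --> X]fineK ?fin_num_measure//.
    move=> /fine_cvgP[_] /cvgr_lt /(_ e) h.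
    have [|N _ /(_ N (leqnn _))/= hN] := h; first by rewrite -lte_fin fineK ?fin_num_measure.
    by exists N; rewrite -[ltLHS](fineK (fin_num_measure mu _ (mW N))) lte_fin.
  exists (\big[setU/set0]_(i < N) C i), V; split => //.
  + apply: closed_bigsetU => i _; by have [] := CU i.
  + by move=> x; rewrite -bigcup_mkord => -[i /= iN Cx]; exists i => //; have [_ _ + _ _] := CU i; apply.
  + by move=> x [k _ Bx]; exists k => //; have [_ _ _ + _] := CU k; apply.
Qed.

(** Outer regularity of [nu] suffices: an open set between [A] and [O] that exceeds [A] by at most
    [e] in [nu]-measure also bounds [mu A]. *)
Lemma le_measure_openP (mu nu : {finite_measure set 'rV[R]_n -> \bar R}) (O A : set 'rV[R]_n) :
  open O -> (forall U, open U -> U `<=` O -> (mu U <= nu U)%E) ->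
  measurable A -> A `<=` O -> (mu A <= nu A)%E.
Proof.
move=> oO muO mA AO; apply/lee_addgt0Pr => e e0.
have [C [U [cC oU CA AU h]]] := finite_measure_regular nu mA e0.
have oUO : open (U `&` O) by exact: openI.
have mUO : measurable (U `&` O) by exact: measurable_rV_open.
apply: (@le_trans _ _ (mu (U `&` O))).
  by apply: le_measure; rewrite ?inE// => x Ax; split; [exact: AU|exact: AO].
apply: le_trans (muO _ oUO _) _; first by move=> x [].
have mC : measurable C by exact: closed_rV_measurable.
have mU : measurable U by exact: measurable_rV_open.
apply: (@le_trans _ _ (nu (A `|` (U `\` C)))).
  apply: le_measure; rewrite ?inE//; first by apply: measurableU => //; exact: measurableD.
  move=> x [Ux _]; have [Cx|nCx] := pselect (C x); first by left; exact: CA.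
  by right.
apply: (@le_trans _ _ (nu A + nu (U `\` C))%E).
  by apply: measureU2 => //; exact: measurableD.
by rewrite leeD2l// ltW.
Qed.

End regularity.

(** * Translations and the L^p modulus of continuity *)

Section Lp_translation.
Context {R : realType}.

(** Convexity of the power [p] at the points [x / (1 - s)] and [y / s] with weights [1 - s] and [s].
    A small [s] puts a coefficient close to 1 on [x], as perturbing an energy requires; [s = 1/2]
    gives the symmetric bound. *)
Lemma powRD_le (p s x y : R) : 1 <= p -> 0 < s -> s < 1 -> 0 <= x -> 0 <= y ->
  (x + y) `^ p <= (1 - s) `^ (1 - p) * x `^ p + s `^ (1 - p) * y `^ p.
Proof.
move=> p1 s0 s1 x0 y0.
have s'0 : 0 < 1 - s by rewrite subr_gt0.
have E t z : 0 < t -> 0 <= z -> t `^ (1 - p) * z `^ p = t * (z / t) `^ p.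
  move=> t0 z0; rewrite powRM// ?invr_ge0 1?ltW//.
  rewrite -powR_inv1 1?ltW// -powRrM mulN1r mulrC [RHS]mulrCA; congr (_ * _).
  rewrite -[X in _ = X * _](powRr1 (ltW t0)) -powRD//; by apply/implyP => _; rewrite gt_eqF.
rewrite !E//.
have s01 : 0 <= 1 - s <= 1 by apply/andP; split; lra.
have := convex_powR p1 (Itv01 (andP s01).1 (andP s01).2) (x := x / (1 - s)) (y := y / s).
have xin : x / (1 - s) \in (`[0, +oo[%classic : set R).
  by rewrite inE/= in_itv/= andbT divr_ge0// ltW.
have yin : y / s \in (`[0, +oo[%classic : set R).
  by rewrite inE/= in_itv/= andbT divr_ge0// ltW.
move=> /(_ xin yin).
set c := conv _ _ _; set c' := conv _ _ _.
have -> : c = x + y.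
  transitivity ((1 - s) * (x / (1 - s)) + (1 - (1 - s)) * (y / s)); first by [].
  by field; rewrite !gt_eqF//; lra.
have -> // : c' = (1 - s) * (x / (1 - s)) `^ p + s * (y / s) `^ p.
transitivity ((1 - s) * (x / (1 - s)) `^ p + (1 - (1 - s)) * (y / s) `^ p); first by [].
by rewrite subKr.
Qed.

End Lp_translation.
Section compact_open.
Context {R : realType} {n : nat}.
Implicit Types A K : set 'rV[R]_n.

Lemma compact_inset K A : compact K -> open A -> K `<=` A ->
  exists2 r : R, 0 < r & K `<=` inset A r.
Proof.
move=> /compact_near_coveringP cK oA KA.
have : \forall r \near (0 : R)^'+, K `<=` inset A r.
  apply: cK => x Kx.
  have /nbhs_ballP[e /= e0 eA] : nbhs x A by apply: open_nbhs_nbhs; split => //; exact: KA.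
  exists (ball x (e / 2), [set r | r < e / 2]).
    split; first by apply: nbhsx_ballx; rewrite divr_gt0.
    by apply: nbhs_right_lt; rewrite divr_gt0.
  move=> [y r] [/= xy re] z yz; apply: eA; rewrite [e]splitr.
  by apply: ball_triangle xy _; exact: le_ball (ltW re) _ yz.
move=> h.
have /filter_ex[r [r0 rK]] : \forall r \near (0 : R)^'+, 0 < r /\ K `<=` inset A r.
  by apply: filterI => //; exact: nbhs_right_gt.
by exists r.
Qed.

Lemma ball_openT (x : 'rV[R]_n) r : open (ball x r).
Proof.
have [r0|r0] := ltP 0 r; first exact: ball_open.
rewrite (_ : ball x r = set0); first exact: open0.
by apply/seteqP; split => // y [/(le_lt_trans r0)]; rewrite ltxx.
Qed.

Lemma closed_ball_bounded_compact K (M : R) : closed K -> K `<=` ball 0 M -> compact K.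
Proof.
move=> cK KM; apply: bounded_closed_compact => //.
exists M; split; first exact: num_real.
move=> N MN x /KM; rewrite -ball_normE /= sub0r normrN => /ltW/le_trans; apply; exact: ltW.
Qed.

Lemma compact_sub_ball K : compact K -> exists2 M : R, 0 < M & K `<=` ball 0 M.
Proof.
move=> /compact_bounded[M [_ /(_ (`|M| + 1))]].
have -> : M < `|M| + 1 by rewrite (le_lt_trans (ler_norm _))// ltrDl.
move=> /(_ isT) h; exists (`|M| + 2); first by rewrite ltr_pwDr.
move=> x /h xM; rewrite -ball_normE /= sub0r normrN (le_lt_trans xM)//.
by rewrite ltrD2l ltr1n.
Qed.

End compact_open.
Lemma cvge0_le (R : realType) (a : (\bar R)^nat) (e : R) : 0 < e ->
  a @ \oo --> 0%E -> exists N, forall k, (N <= k)%N -> (a k <= e%:E)%E.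
Proof.
move=> e0 /fine_cvgP[[N1 _ afin] /cvgrPdist_le /(_ _ e0)[N2 _ aN]].
exists (maxn N1 N2) => k; rewrite geq_max => /andP[k1 k2].
have /= := aN k k2; rewrite sub0r normrN => h.
rewrite -[leLHS]fineK ?lee_fin; last exact: afin.
exact: le_trans (ler_norm _) h.
Qed.

(** The [p]-th power of the L^p norm over the whole space. Using it avoids roots, at the price of
    the factor [2 ^ p] in the triangle inequality. *)
HB.lock Definition pint (R : realType) n (p : R) (u : 'rV[R]_n -> R) : \bar R :=
  (\int[@lebesgue_rV R n]_x ((`|u x| `^ p)%R)%:E)%E.
Canonical pint_unlockable := Unlockable pint.unlock.

Section pint.
Context {R : realType} {n : nat} (p : R) (p1 : 1 <= p).
Local Notation leb := (@lebesgue_rV R n).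
Implicit Types u v : 'rV[R]_n -> R.
Local Open Scope ereal_scope.

Local Notation pint := (pint p).

Lemma measurable_normp D u : measurable_fun D u ->
  measurable_fun D (fun x => ((`|u x| `^ p)%R)%:E).
Proof.
move=> mu; apply/measurable_EFinP.
apply: (measurableT_comp (@measurable_powR R p)).
exact: measurableT_comp mu.
Qed.

Lemma pint_ge0 u : 0 <= pint u.
Proof. by rewrite unlock; apply: integral_ge0 => x _; rewrite lee_fin powR_ge0. Qed.

Lemma le_pint u v : measurable_fun setT u -> measurable_fun setT v ->
  (forall x, `|u x| <= `|v x|)%R -> pint u <= pint v.
Proof.
move=> mu mv uv; rewrite unlock; apply: ge0_le_integral => //.
- exact: measurable_normp.
- exact: measurable_normp.
- by move=> x _; rewrite lee_fin ge0_ler_powR// ?nnegrE// (le_trans ler01).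
Qed.

Lemma pint_translation u h : measurable_fun setT u ->
  pint (fun x => u (x + h)%R) = pint u.
Proof.
move=> mu; rewrite unlock; apply: (@ge0_integral_rV_translation _ _ h (fun x => (`|u x| `^ p)%:E)%R).
  exact: measurable_normp.
by move=> x; rewrite lee_fin powR_ge0.
Qed.

Lemma pintZ k u : measurable_fun setT u ->
  pint (fun x => k * u x)%R = (`|k| `^ p)%:E * pint u.
Proof.
move=> mu; rewrite unlock -ge0_integralZl_EFin//.
- by apply: eq_integral => x _; rewrite normrM powRM.
- exact: measurable_normp.
Qed.

Lemma pintD u v : measurable_fun setT u -> measurable_fun setT v ->
  pint (fun x => u x + v x)%R <= (2 `^ p)%:E * (pint u + pint v).
Proof.
move=> mu mv; rewrite unlock -ge0_integralD//; try exact: measurable_normp.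
rewrite -ge0_integralZl_EFin//; [|by move=> x _; rewrite adde_ge0// lee_fin powR_ge0|by apply: emeasurable_funD; exact: measurable_normp].
apply: ge0_le_integral => //.
- by apply: measurable_normp; exact: measurable_funD.
- apply: measurable_funeM; apply: emeasurable_funD; exact: measurable_normp.
move=> x _; rewrite -EFinD -EFinM lee_fin.
have p0 : (0 <= p)%R by rewrite (le_trans ler01).
apply: (@le_trans _ _ ((2 * Num.max `|u x| `|v x|) `^ p)%R).
  rewrite ge0_ler_powR// ?nnegrE ?mulr_ge0// ?le_max ?normr_ge0//.
  apply: le_trans (ler_normD _ _) _.
  by rewrite mulr_natl mulr2n lerD// le_max lexx ?orbT.
rewrite powRM// ?le_max ?normr_ge0// ler_wpM2l ?powR_ge0//.
by rewrite /Num.max /Order.max; case: ifP => _; rewrite ?lerDl ?lerDr powR_ge0.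
Qed.

(** Continuity at 0 of translations of [u] in L^p. *)
Definition osc_small u := forall e : R, (0 < e)%R -> exists2 d : R, (0 < d)%R &
  forall z, (`|z| < d)%R -> pint (fun x => u (x + z) - u x)%R <= e%:E.

Lemma pintD_ex : exists2 k : R, (0 < k)%R & forall u v,
  measurable_fun setT u -> measurable_fun setT v ->
  forall a b, pint u <= a%:E -> pint v <= b%:E ->
  pint (fun x => u x + v x)%R <= (k * (a + b))%:E.
Proof.
exists (2 `^ p)%R => [|u v mu mv a b ua vb]; first by rewrite powR_gt0.
apply: le_trans (pintD mu mv) _.
rewrite EFinM; apply: lee_wpmul2l; first by rewrite lee_fin powR_ge0.
by rewrite EFinD; apply: leeD.
Qed.

Lemma measurable_translate (w : 'rV[R]_n -> R) z : measurable_fun setT w ->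
  measurable_fun setT (fun x : 'rV[R]_n => w (x + z)%R).
Proof.
by move=> mw; apply: measurableT_comp => //; exact: measurable_rV_translation.
Qed.

(** The increment of [u] is that of [v] plus [u - v] at [x + z] minus [u - v] at [x]; the last two
    have the same L^p size by translation invariance, whatever [z] is. *)
Lemma osc_small_lim u : measurable_fun setT u ->
  (forall e : R, (0 < e)%R -> exists v, [/\ measurable_fun setT v, osc_small v &
     pint (fun x => u x - v x)%R <= e%:E]) ->
  osc_small u.
Proof.
move=> mu h e e0.
have [k k0 pD] := pintD_ex.
have D0 : (0 < 1 + k + k * k)%R by rewrite addr_gt0 ?mulr_gt0// addr_gt0.
(* The triangle inequality with constant [k] is applied twice to three terms of size [d], which
   gives the nested expression. *)
have [d [d0 dE]] : exists d : R, (0 < d /\ k * (d + k * (d + d)) <= e)%R.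
  exists (e / (4 * (1 + k + k * k)))%R; split; first by rewrite divr_gt0// mulr_gt0.
  rewrite (_ : (k * _)%R = e * ((k + 2 * k * k) / (4 * (1 + k + k * k))))%R; last by field; rewrite gt_eqF.
  rewrite -[leRHS]mulr1 ler_wpM2l ?(ltW e0)// ler_pdivrMr ?mulr_gt0//.
  have kk : (0 < k * k)%R by rewrite mulr_gt0.
  by rewrite mul1r -mulrA; lra.
have [v [mv ov uv]] := h _ d0.
have [r r0 vr] := ov _ d0.
exists r; first exact: r0.
move=> z /vr vz.
rewrite (_ : (fun x => _) = fun x : 'rV[R]_n =>
    ((u (x + z) - v (x + z)) + ((v (x + z) - v x) + (-1) * (u x - v x)))%R); last first.
  by apply/funext => x; ring.
have m1 : measurable_fun setT (fun x : 'rV[R]_n => u x - v x)%R by exact: measurable_funB.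
have m2 : measurable_fun setT (fun x : 'rV[R]_n => v (x + z) - v x)%R.
  by apply: measurable_funB => //; exact: measurable_translate.
have m3 : measurable_fun setT (fun x : 'rV[R]_n => -1 * (u x - v x))%R by exact: measurable_funM.
apply: (@le_trans _ _ (k * (d + k * (d + d)))%:E); last by rewrite lee_fin.
apply: (pD).
- exact: (measurable_translate z m1).
- exact: measurable_funD.
- by have /= := pint_translation z m1 => ->; exact: uv.
- apply: (pD) => //.
  by rewrite pintZ// normrN normr1 powR1 mul1e.
Qed.

Lemma osc_smallD u v : measurable_fun setT u -> measurable_fun setT v ->
  osc_small u -> osc_small v -> osc_small (fun x => u x + v x)%R.
Proof.
move=> mu mv ou ov e e0.
have [k k0 pD] := pintD_ex.
have d0 : (0 < e / (2 * k))%R by rewrite divr_gt0// mulr_gt0.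
have [r r0 ur] := ou _ d0; have [s s0 vs] := ov _ d0.
exists (Num.min r s); first by rewrite lt_min r0.
move=> z; rewrite lt_min => /andP[zr zs].
rewrite (_ : (fun x => _) = fun x : 'rV[R]_n => ((u (x + z) - u x) + (v (x + z) - v x))%R); last first.
  by apply/funext => x; ring.
have -> : e = (k * (e / (2 * k) + e / (2 * k)))%R by field; rewrite gt_eqF.
apply: (pD); [| |exact: ur|exact: vs].
- by apply: measurable_funB => //; exact: measurable_translate.
- by apply: measurable_funB => //; exact: measurable_translate.
Qed.

Lemma osc_smallZ k u : measurable_fun setT u -> osc_small u ->
  osc_small (fun x => k * u x)%R.
Proof.
move=> mu ou e e0.
have k0 : (0 < `|k| `^ p + 1)%R by rewrite ltr_wpDl ?powR_ge0.
have d0 : (0 < e / (`|k| `^ p + 1))%R by rewrite divr_gt0.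
have [r r0 ur] := ou _ d0; exists r => // z zr.
rewrite (_ : (fun x => _) = fun x => (k * (u (x + z) - u x))%R); last first.
  by apply/funext => x; ring.
rewrite pintZ//; last first.
  apply: measurable_funB => //; exact: measurable_translate.
apply: (@le_trans _ _ ((`|k| `^ p)%:E * (e / (`|k| `^ p + 1))%:E)).
  by apply: lee_wpmul2l; [rewrite lee_fin powR_ge0|exact: ur].
rewrite -EFinM lee_fin mulrCA -[leRHS]mulr1 ler_wpM2l ?(ltW e0)//.
by rewrite ler_pdivrMr// mul1r lerDl.
Qed.

Lemma osc_small0 : osc_small (cst 0%R).
Proof.
move=> e e0; exists 1%R => // z _; rewrite unlock.
under eq_integral do rewrite subrr normr0 powR0 ?gt_eqF ?(lt_le_trans ltr01)//.
by rewrite integral0 lee_fin ltW.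
Qed.

Lemma osc_small_sum (I : Type) (s : seq I) (u_ : I -> 'rV[R]_n -> R) :
  (forall i, measurable_fun setT (u_ i)) -> (forall i, osc_small (u_ i)) ->
  osc_small (fun x => \sum_(i <- s) u_ i x)%R.
Proof.
move=> mu ou; elim: s => [|i s IHs].
  by under eq_fun do rewrite big_nil; exact: osc_small0.
under eq_fun do rewrite big_cons.
by apply: osc_smallD; [exact: mu|exact: measurable_sum|exact: ou|exact: IHs].
Qed.

(** Take [C] compact and [V] open with [V \ C] small and [B] in between. A shift shorter than the
    distance from [C] to the complement of [V] cannot carry a point of [C] out of [V], so the
    indicator changes only at points [x] where [x] or [x + z] lies in [V \ C]. *)
Lemma osc_small_indic (B : set 'rV[R]_n) (M : R) : measurable B -> B `<=` ball 0%R M ->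
  osc_small \1_B.
Proof.
move=> mB BM e e0.
have [M0|M0] := leP M 0%R.
  have -> : B = set0.
    by apply/seteqP; split => // x /BM; rewrite -ball_normE/= => /(le_lt_trans (normr_ge0 _)); rewrite ltNge M0.
  by rewrite indic0; exact: osc_small0.
have mb : measurable (ball (0 : 'rV[R]_n)%R M) by apply: measurable_rV_open; exact: ball_open.
have boo : leb (ball (0 : 'rV[R]_n)%R M) < +oo.
  by apply: le_lt_trans (lebesgue_rV_ball 0%R M0).1 _; rewrite ltry.
pose mu : {finite_measure set 'rV[R]_n -> \bar R} := mfrestr mb boo.
have e20 : (0 < e / 2)%R by rewrite divr_gt0.
have [C [U [cC oU CB BU muUC]]] := finite_measure_regular mu mB e20.
have {}muUC : leb ((U `&` ball 0%R M) `\` C) <= (e / 2)%:E.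
  have h : leb ((U `\` C) `&` ball (0 : 'rV[R]_n)%R M) < (e / 2)%:E by exact: muUC.
  by rewrite !setDE setIAC -setDE ltW.
have oV : open (U `&` ball (0 : 'rV[R]_n)%R M) by apply: openI => //; exact: ball_open.
have CV : C `<=` U `&` ball (0 : 'rV[R]_n)%R M by move=> x /CB Bx; split; [exact: BU|exact: BM].
have cpC : compact C by apply: (@closed_ball_bounded_compact _ _ _ M) => // x /CB; exact: BM.
have [r r0 rC] := compact_inset cpC oV CV.
set V := U `&` _ in muUC oV CV rC.
have BV : B `<=` V by move=> x Bx; split; [exact: BU|exact: BM].
exists r => // z zr.
have mD : measurable (V `\` C).
  by apply: measurableD; [exact: measurable_rV_open|exact: closed_rV_measurable].
have mDz : measurable ((fun x : 'rV[R]_n => (x + z)%R) @^-1` (V `\` C)).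
  by apply: measurable_preimageT => //; exact: measurable_rV_translation.
have bd x : ((\1_B (x + z) - \1_B x : R) != 0)%R ->
    ((V `\` C) `|` (fun x : 'rV[R]_n => (x + z)%R) @^-1` (V `\` C)) x.
  rewrite !indicE; case: (pselect (B x)) => Bx; case: (pselect (B (x + z)%R)) => Bz.
  - by rewrite !mem_set// subrr eqxx.
  - rewrite (mem_set Bx) memNset// => _.
    have [Cx|nCx] := pselect (C x); last by left; split => //; exact: BV.
    right; split; last by move=> /CB.
    by apply: rC Cx _ _; rewrite -ball_normE /= opprD addNKr normrN.
  - rewrite (mem_set Bz) memNset// => _.
    have [Cx|nCx] := pselect (C (x + z)%R); last by right; split => //; exact: BV.
    left; split; last by move=> /CB.
    by apply: rC Cx _ _; rewrite -ball_normE /= addrAC subrr add0r.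
  - by rewrite !memNset// subrr eqxx.
apply: (@le_trans _ _ (\int[leb]_(x in (V `\` C) `|` (fun x : 'rV[R]_n => (x + z)%R) @^-1` (V `\` C)) 1)).
  rewrite unlock [leRHS]integral_mkcond; apply: ge0_le_integral => //.
  - apply: measurable_normp; apply: measurable_funB => //.
    apply: (@measurableT_comp _ _ _ _ _ _ (\1_B : _ -> R)) => //.
    exact: measurable_rV_translation.
  - apply/(measurable_restrictT _ _).1 => //; exact: measurableU.
  - move=> x _; have [h|h] := eqVneq (\1_B (x + z) - \1_B x)%R (0 : R)%R; first rewrite h.
      rewrite normr0 powR0 ?gt_eqF ?(lt_le_trans ltr01)//.
      by rewrite erestrict_ge0.
    rewrite patchE mem_set; last exact: bd.
    rewrite lee_fin; apply: (@le_trans _ _ (1 `^ p)%R); last by rewrite powR1.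
    rewrite ge0_ler_powR ?nnegrE//.
      by rewrite (le_trans ler01).
    by rewrite !indicE; case: (_ \in _); case: (_ \in _); rewrite ?subrr ?subr0 ?sub0r ?normrN ?normr1 ?normr0.
rewrite integral_cst ?mul1e; last exact: measurableU.
apply: le_trans (measureU2 _ _ _) _ => //.
rewrite (_ : e = e / 2 + e / 2)%R ?EFinD; last by field.
have E : leb ((fun x : 'rV[R]_n => (x + z)%R) @^-1` (V `\` C)) <= (e / 2)%:E.
  by rewrite lebesgue_rV_translation.
exact: leeD muUC E.
Qed.

End pint.

Import HBNNSimple.

Lemma osc_small_nnsfun (R : realType) n (p : R) (h : {nnsfun 'rV[R]_n >-> R}) (M : R) : 1 <= p ->
  osc_small p (fun x => h x * \1_(ball 0 M) x).
Proof.
move=> p1.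
have [s E] : exists s : seq R, (fun x => h x * \1_(ball 0 M) x) =
    (fun x => \sum_(y <- s) y * \1_(h @^-1` [set y] `&` ball 0 M) x).
  eexists; apply/funext => x; rewrite {1}fimfunE fsbig_finite//= mulr_suml.
  by apply: eq_bigr => y _; rewrite -mulrA indicI.
have mi (y : R) : measurable (h @^-1` [set y] `&` ball (0 : 'rV[R]_n) M).
  by apply: measurableI => //; apply: measurable_rV_open; exact: ball_openT.
rewrite E; apply: osc_small_sum => // y.
  by apply: measurable_funM.
apply: osc_smallZ => //.
by apply: (@osc_small_indic _ _ _ p1 _ M) => // x [].
Qed.

(** Reduces to nonnegative functions by taking positive and negative parts, then to simple functions
    cut off to balls: these converge in L^p by domination by the [p]-th power of the function
    itself. *)
Lemma Lp_translation (R : realType) n (p : R) (u : 'rV[R]_n -> R) : 1 <= p ->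
  measurable_fun setT u -> (pint p u < +oo)%E -> osc_small p u.
Proof.
move=> p1 mu uoo.
have p0 : 0 < p by rewrite (lt_le_trans ltr01).
suff nn (v : 'rV[R]_n -> R) : measurable_fun setT v -> (forall x, 0 <= v x) -> (pint p v < +oo)%E -> osc_small p v.
  pose up x := Num.max (u x) 0; pose un x := Num.max (- u x) 0.
  have -> : u = (fun x : 'rV[R]_n => up x + -1 * un x).
    apply/funext => x; rewrite mulN1r /up /un.
    by have [h|h] := leP (u x) 0; [rewrite max_l ?oppr_ge0|rewrite max_r ?oppr_le0 1?ltW]; rewrite //; ring.
  have mp : measurable_fun setT up by exact: measurable_maxr.
  have mn : measurable_fun setT un by apply: measurable_maxr => //; exact: measurable_funN.
  have up0 x : 0 <= up x by rewrite le_max lexx orbT.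
  have un0 x : 0 <= un x by rewrite le_max lexx orbT.
  have le1 x : `|up x| <= `|u x| by rewrite ger0_norm// ge_max ler_norm normr_ge0.
  have le2 x : `|un x| <= `|u x| by rewrite ger0_norm// ge_max -normrN ler_norm normr_ge0.
  apply: osc_smallD => //.
  - by apply: measurable_funM.
  - by apply: nn => //; apply: le_lt_trans uoo; exact: le_pint.
  - apply: osc_smallZ => //.
    by apply: nn => //; apply: le_lt_trans uoo; exact: le_pint.
move=> mv v0 voo.
apply: osc_small_lim => // e e0.
have mEv : measurable_fun setT (EFin \o v) by exact/measurable_EFinP.
pose h := nnsfun_approx measurableT mEv.
pose w k x := h k x * \1_(ball (0 : 'rV[R]_n) k%:R) x.
have mb (k : nat) : measurable (ball (0 : 'rV[R]_n) k%:R).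
  by apply: measurable_rV_open; exact: ball_openT.
have mw k : measurable_fun setT (w k) by apply: measurable_funM.
have hv k x : h k x <= v x.
  by rewrite -lee_fin /h nnsfun_approxE; apply: (le_approx (f := EFin \o v)) => // y _; rewrite lee_fin.
have wv k x : 0 <= w k x <= v x.
  rewrite /w indicE; case: (_ \in _); rewrite ?mulr1 ?mulr0 ?lexx ?v0 ?andbT//=.
  by rewrite hv fun_ge0.
have cw x : w k x @[k --> \oo] --> v x.
  have := cvg_nnsfun_approx measurableT mEv (fun y _ => (v0 y : (0 <= (v y)%:E)%E)) (x := x) Logic.I.
  move=> /fine_cvgP[_ hc]; apply: cvg_trans hc; apply: near_eq_cvg.
  exists (Num.truncn `|x|).+1 => // k /= xk.
  rewrite /w indicE mem_set ?mulr1//= -ball_normE /= sub0r normrN.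
  by apply: lt_le_trans (truncnS_gt _) _; rewrite ler_nat.
have mg k : measurable_fun setT (fun x => ((`|v x - w k x| `^ p)%:E)%E).
  by apply: measurable_normp; exact: measurable_funB.
have [||||_ _] := @dominated_convergence _ _ _ (@lebesgue_rV R n) setT measurableT
  (fun k x => ((`|v x - w k x| `^ p)%:E)%E) (cst 0%E) (fun x => ((`|v x| `^ p)%:E)%E) mg.
- exact: measurable_cst.
- apply: aeW => x _.
  have : (`|v x - w k x| `^ p) @[k --> \oo] --> (0 : R).
    apply/cvgrPdist_lt => d d0.
    have dp : 0 < d `^ p^-1 by rewrite powR_gt0.
    move/cvgrPdist_lt : (cw x) => /(_ _ dp); apply: filterS => k vw.
    rewrite sub0r normrN ger0_norm ?powR_ge0//.
    rewrite [ltRHS](_ : d = (d `^ p^-1) `^ p); last first.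
      by rewrite -powRrM mulVf ?gt_eqF// powRr1 ?ltW.
    by rewrite gt0_ltr_powR ?nnegrE// ltW.
  by move=> ?; apply: cvg_EFin => //; apply: nearW.
- apply/integrableP; split; first exact: measurable_normp.
  move: voo; rewrite unlock; apply: le_lt_trans.
  by apply: ge0_le_integral => //; [apply: measurableT_comp => //; exact: measurable_normp|exact: measurable_normp|move=> x _; rewrite gee0_abs// lee_fin powR_ge0].
- apply: aeW => x k _.
  rewrite gee0_abs ?lee_fin ?powR_ge0// ge0_ler_powR ?nnegrE ?(ltW p0)//.
  by have /andP[h1 h2] := wv k x; rewrite !ger0_norm ?v0 ?subr_ge0// lerBlDr lerDl.
rewrite integral_cst// mul0e => /(cvge0_le e0)[N /(_ N (leqnn _)) hN].
exists (w N); split => //; first exact: osc_small_nnsfun.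
rewrite unlock; apply: le_trans hN; apply: ge0_le_integral => //.
Qed.

(** * Lipschitz functions *)

Section lipschitz_derivable.
Context {R : realType}.

Lemma lebesgue_stieltjes_itvoc (f : cumulative R R) (a b : R) : a <= b ->
  lebesgue_stieltjes_measure f `]a, b]%classic = (f b - f a)%:E.
Proof.
move=> ab; rewrite /lebesgue_stieltjes_measure /measure_extension measurable_mu_extE//=; last first.
  exact: is_ocitv.
rewrite wlength_itv/= lte_fin; move: ab; rewrite le_eqVlt => /orP[/eqP ->|->//].
by rewrite ltxx subrr.
Qed.

(** Both [l x + w] and [l x - w] are nondecreasing, and their Stieltjes measures add up to [2 l]
    times Lebesgue measure. Each is therefore absolutely continuous, so [w] is locally a primitive
    of an integrable function plus a linear one, and the Lebesgue differentiation theorem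
    applies. *)
Lemma lipschitz_ae_derivable (w : R -> R) (L : R) :
  (forall x y, `|w x - w y| <= L * `|x - y|) ->
  {ae lebesgue_measure, forall x, derivable w x 1}.
Proof.
move=> wL0.
have [l l0 wL] : exists2 l : R, 0 < l & forall x y, `|w x - w y| <= l * `|x - y|.
  exists (`|L| + 1) => [|x y]; first by rewrite ltr_wpDl.
  by apply: le_trans (wL0 x y) _; rewrite ler_wpM2r// (le_trans (ler_norm _))// lerDl.
have cw : continuous w.
  move=> x; apply/cvgrPdist_lt => e e0; near=> y.
  apply: le_lt_trans (wL x y) _; rewrite mulrC -ltr_pdivlMr//.
  near: y; apply: cvgr_dist_lt; first by apply: cvg_id.
  by rewrite divr_gt0.
have cl k : continuous (fun x : R => k * x) by move=> x; apply: cvgM; [exact: cvg_cst|exact: cvg_id].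
pose f1 x := l * x + w x; pose f2 x := l * x - w x.
have nd1 : nondecreasing f1.
  move=> x y xy; rewrite /f1 -subr_ge0.
  have := wL x y; rewrite ler_norml distrC ger0_norm ?subr_ge0// => /andP[_].
  by rewrite mulrBr; lra.
have nd2 : nondecreasing f2.
  move=> x y xy; rewrite /f2 -subr_ge0.
  have := wL x y; rewrite ler_norml distrC ger0_norm ?subr_ge0// => /andP[+ _].
  by rewrite mulrBr; lra.
have rc1 : right_continuous f1.
  by apply/right_continuousW => x; apply: cvgD; [exact: cl|exact: cw].
have rc2 : right_continuous f2.
  by apply/right_continuousW => x; apply: cvgB; [exact: cl|exact: cw].
pose F1 : cumulative R R := HB.pack f1 (isCumulative.Build R _ R f1 nd1 rc1).
pose F2 : cumulative R R := HB.pack f2 (isCumulative.Build R _ R f2 nd2 rc2).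
have k0 : 0 <= (2 * l)^-1 by rewrite invr_ge0 mulr_ge0// ltW.
pose nu : {measure set (measurableTypeR R) -> \bar R} :=
  mscale (NngNum k0) (measure_add (lebesgue_stieltjes_measure F1) (lebesgue_stieltjes_measure F2)).
have nuA A : nu A = ((2 * l)^-1%:E * (lebesgue_stieltjes_measure F1 A + lebesgue_stieltjes_measure F2 A))%E.
  by rewrite -measure_addE.
have nuE A : measurable (A : set (measurableTypeR R)) -> lebesgue_measure A = nu A.
  apply: lebesgue_measure_unique => _ [[a b] _ <-] /=.
  have [ab|ba] := leP a b; last first.
    have -> : `]a, b]%classic = set0 :> set R by rewrite set_itv_ge// bnd_simp -leNgt ltW.
    by rewrite (measure0 lebesgue_measure) [RHS](measure0 nu).
  rewrite [RHS]nuA [LHS]lebesgue_stieltjes_itvoc// !lebesgue_stieltjes_itvoc//.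
  rewrite -EFinD -EFinM; congr EFin.
  have E1 z : F1 z = l * z + w z by [].
  have E2 z : F2 z = l * z - w z by [].
  transitivity ((2 * l)^-1 * ((l * b + w b) - (l * a + w a) + ((l * b - w b) - (l * a - w a)))) => //.
  have -> : idfun b - idfun a = b - a by [].
  by field; rewrite gt_eqF.
have ac A : measurable (A : set (measurableTypeR R)) -> lebesgue_measure A = 0%E ->
    lebesgue_stieltjes_measure F1 A = 0%E.
  move=> mA; rewrite nuE// nuA => /eqP.
  rewrite mule_eq0 eqe invr_eq0 mulf_eq0 pnatr_eq0/= (gt_eqF l0)/=.
  by rewrite padde_eq0// => /andP[/eqP].
(* Restricting to bounded intervals makes the Stieltjes measure finite and its density
   integrable. *)
suff H (M : nat) : {ae lebesgue_measure, forall x, `|x| < M%:R -> derivable w x 1}.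
  have : {ae lebesgue_measure, forall x (M : nat), `|x| < M%:R -> derivable w x 1} by exact: ae_foralln.
  by apply: ae_mono => x; apply; exact: truncnS_gt.
pose I : set (measurableTypeR R) := `]- M%:R, M%:R]%classic.
have mI : measurable I by exact: measurable_itv.
have M0 : - M%:R <= M%:R :> R by rewrite ge0_cp// ler0n.
have Ioo : (lebesgue_stieltjes_measure F1 I < +oo)%E by rewrite lebesgue_stieltjes_itvoc// ltry.
pose n1 : {finite_measure set (measurableTypeR R) -> \bar R} := mfrestr mI Ioo.
have n1ac : n1 `<< (@lebesgue_measure R).
  apply/null_content_dominatesP => A mA A0; apply/eqP; rewrite eq_le measure_ge0 andbT.
  by rewrite -(ac _ mA A0); apply: le_measure; rewrite ?inE//; exact: measurableI.
have [f [f0 ff intf nf]] := radon_nikodym_sigma_finite n1ac.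
have iff A : measurable (A : set (measurableTypeR R)) -> lebesgue_measure.-integrable A (EFin \o (fine \o f)).
  move=> mA; apply: eq_integrable (integrableS measurableT mA (@subsetT _ _) intf) => //.
  by move=> x _ /=; rewrite fineK.
have lf : locally_integrable setT (fine \o f).
  by apply: open_integrable_locally; [exact: openT|exact: iff].
have := FTC1Ny (fun y => iff _ (measurable_itv _)) lf.
set F := (fun x => _); rewrite /=; apply: ae_mono => x [dF _] xM.
have FE y : `|y| < M%:R -> F y = f1 y - f1 (- M%:R).
  move=> yM; rewrite /F /Rintegral.
  under eq_integral do rewrite /= fineK//.
  rewrite -(nf _ (measurable_itv _)).
  rewrite /n1/= /mfrestr /mrestr.
  rewrite (_ : _ `&` _ = `]- M%:R, y]%classic) ?lebesgue_stieltjes_itvoc//.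
    by move: yM; rewrite ltr_norml => /andP[/ltW].
  move: yM; rewrite ltr_norml => /andP[h1 h2].
  apply/seteqP; split => z; rewrite /I /= !in_itv/=; first by case=> -> /andP[->].
  by move=> /andP[-> zy]; rewrite zy/= (le_trans zy)// ltW.
have : derivable (fun y => F y + f1 (- M%:R) - l * y) x 1.
  apply: derivableB; last by apply: derivableM; [exact: derivable_cst|exact: derivable_id].
  by apply: derivableD; [exact: dF|exact: derivable_cst].
apply: near_eq_derivable.
near=> y; rewrite FE; first by rewrite /f1; ring.
near: y; apply/nbhs_ballP; exists (M%:R - `|x|) => [|y]; first by rewrite /= subr_gt0.
rewrite -ball_normE /= ltrBrDl => xy; apply: le_lt_trans xy.
by rewrite -{1}(subKr x y) (le_trans (ler_normB _ _)).
Unshelve. all: by end_near. Qed.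

End lipschitz_derivable.

Section directional.
Context {R : realType} {n : nat}.
Local Notation leb := (@lebesgue_rV R n).
Implicit Types (w f g : 'rV[R]_n -> R) (v x : 'rV[R]_n).

Definition dquot w v (h : R) x := h^-1 * (w (x + h *: v) - w x).

Let dquotE w v x :
  (fun h : R => h^-1 *: ((w \o shift x) (h *: v) - w x)) = dquot w v ^~ x.
Proof. by apply/funext => h; rewrite /dquot /= [X in w X - _]addrC. Qed.

Lemma derivableE w v x : derivable w x v = cvg (dquot w v h x @[h --> 0^']).
Proof. by rewrite /derivable dquotE. Qed.

Lemma deriveE_dquot w v x : 'D_v w x = lim (dquot w v h x @[h --> 0^']).
Proof. by rewrite /derive dquotE. Qed.

Lemma dquot_line w v x (t : R) :
  (fun h => h^-1 *: (((fun s : R => w (x + s *: v)) \o shift t) (h *: 1) - w (x + t *: v))) =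
  (fun h => dquot w v h (x + t *: v)).
Proof.
apply/funext => h; rewrite /dquot /=; congr (_ * (w _ - _)).
by rewrite [h *: 1]mulr1 scalerDl addrCA addrC -addrA.
Qed.

Lemma derivable_line w v x (t : R) :
  derivable (fun s : R => w (x + s *: v)) t 1 = derivable w (x + t *: v) v.
Proof. by rewrite derivableE /derivable dquot_line. Qed.

Lemma derive_line w v x (t : R) :
  derive1 (fun s : R => w (x + s *: v)) t = 'D_v w (x + t *: v).
Proof. by rewrite derive1E deriveE_dquot /derive dquot_line. Qed.

(** The negated Cauchy criterion for the difference quotients, with thresholds and radii taken from
    countable sets. For continuous [w] each set in the intersection is open, which makes the whole
    set Borel. *)
Definition nonderivable w v := \bigcup_k \bigcap_N [set x | exists h h' : R,
  [/\ h != 0, h' != 0, `|h| < N.+1%:R^-1, `|h'| < N.+1%:R^-1 &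
    k.+1%:R^-1 < `|dquot w v h x - dquot w v h' x|]].

Lemma continuous_dquot w v h : continuous w -> continuous (dquot w v h).
Proof.
move=> cw x; apply: (@cts_ext _ _ (fun y => h^-1 * (w (y + h *: v) - w y))) => //.
apply: ctsM; first exact: cts_cst.
apply: ctsB; last exact: cw.
by apply: cts_translation; exact: cw.
Qed.

Lemma measurable_nonderivable w v : continuous w -> measurable (nonderivable w v).
Proof.
move=> cw; apply: bigcupT_measurable => k; apply: bigcap_measurable => // N _.
apply: measurable_rV_open; apply: nbhs_open => x [h [h' [h0 h'0 hN h'N kh]]].
have cc : {for x, continuous (fun y => `|dquot w v h y - dquot w v h' y|)}.
  by apply: cts_norm; apply: ctsB; exact: continuous_dquot.
have kl : nbhs `|dquot w v h x - dquot w v h' x| [set z | k.+1%:R^-1 < z].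
  by apply: open_nbhs_nbhs; split => //; exact: open_gt.
move: (cts_filter cc kl); apply: (@filterS _ _ (nbhs_filter x)) => y hy.
by exists h, h'.
Qed.

Lemma nonderivableP w v x : nonderivable w v x <-> ~ derivable w x v.
Proof.
split.
- move=> [k _ B]; rewrite derivableE => /cvg_ex[/= l /cvgrPdist_lt].
  have e0 : 0 < k.+1%:R^-1 / 2 :> R by rewrite divr_gt0// invr_gt0.
  move=> /(_ _ e0)/nbhs_ballP[d /= d0 hd].
  have [N _ Nd] : exists2 N : nat, True & N.+1%:R^-1 <= d.
    exists (Num.truncn d^-1) => //.
    by rewrite invf_ple ?posrE ?ltr0n// ltW// truncnS_gt.
  have [h [h' [h0 h'0 hN h'N]]] := B N Logic.I.
  apply/negP; rewrite -leNgt.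
  have H z : z != 0 -> `|z| < N.+1%:R^-1 -> `|l - dquot w v z x| < k.+1%:R^-1 / 2.
    move=> z0 zN; apply: hd => //; rewrite /ball/= sub0r normrN.
    exact: lt_le_trans Nd.
  have -> : dquot w v h x - dquot w v h' x = (l - dquot w v h' x) - (l - dquot w v h x) by ring.
  apply: le_trans (ler_normB _ _) _.
  by rewrite [leRHS]splitr lerD// ltW// H.
- move=> nd; apply: contrapT => nB; apply: nd; rewrite derivableE.
  apply/cauchy_cvgP/cauchy_exP => e e0.
  pose k := Num.truncn e^-1.
  have ke : k.+1%:R^-1 <= e by rewrite invf_ple ?posrE ?ltr0n// ltW// truncnS_gt.
  have /existsNP[N] : ~ forall N, True -> [set x | exists h h' : R,
      [/\ h != 0, h' != 0, `|h| < N.+1%:R^-1, `|h'| < N.+1%:R^-1 &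
      k.+2%:R^-1 < `|dquot w v h x - dquot w v h' x|]] x.
    by move=> H; apply: nB; exists k.+1.
  move=> /not_implyP[_ nN].
  have N0 : 0 < N.+1%:R^-1 :> R by rewrite invr_gt0.
  exists (dquot w v (N.+1%:R^-1 / 2) x).
  apply/nbhs_ballP; exists (N.+1%:R^-1) => //= h; rewrite /ball/= sub0r normrN => hN h0.
  apply: lt_le_trans ke; rewrite ltNge; apply/negP => kle; apply: nN.
  exists (N.+1%:R^-1 / 2), h; split => //.
  + by rewrite gtr0_norm ?divr_gt0// ltr_pdivrMr// ltr_pMr// ltr1n.
  + by apply: lt_le_trans kle; rewrite ltf_pV2 ?posrE ?ltr0n// ltr_nat.
Qed.

Lemma dquot_seq_cvg w v x : derivable w x v ->
  dquot w v k.+1%:R^-1 x @[k --> \oo] --> 'D_v w x.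
Proof.
rewrite derivableE deriveE_dquot => cw.
have h0 : (fun k : nat => k.+1%:R^-1 : R) @ \oo --> (0 : R)^'.
  move=> P [e /= e0 eP]; have /cvgrPdist_lt/(_ _ e0) := @cvg_harmonic R.
  by apply: filterS => k hk; apply: eP => //=; rewrite gt_eqF ?invr_gt0.
exact: (cvg_comp _ _ h0 cw).
Qed.

Lemma measurable_derive w v : continuous w -> measurable_fun setT (fun x => 'D_v w x).
Proof.
move=> cw; have mB := measurable_nonderivable v cw.
rewrite -(setvU (nonderivable w v)); apply/measurable_funU => //; first exact: measurableC.
split.
- apply: (@measurable_fun_cvg _ _ _ _ (fun k x => dquot w v k.+1%:R^-1 x)).
  + move=> k; apply: measurable_funTS.
    by apply: continuous_rV_measurable_fun; exact: continuous_dquot.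
  + by move=> x /= /nonderivableP/contrapT; exact: dquot_seq_cvg.
(* Where the quotients diverge, [lim] returns its default value, so the derivative is constant on
   that set. *)
- apply: (eq_measurable_fun (fun=> point)); last exact: measurable_cst.
  move=> x; rewrite inE => /nonderivableP; rewrite derivableE deriveE_dquot => nd.
  by rewrite (dvgP nd).
Qed.

(** Tonelli for the indicator of [B] at [x + t v]. For fixed [x] the set of bad [t] is null by the
    one-variable result; for fixed [t] the integral in [x] is [leb B] by translation invariance.
    Hence [leb B] times the infinite length of the line is 0, for any direction [v]. *)
Lemma dirlip_ae_derivable w v (L : R) : continuous w ->
  (forall x t, `|w (x + t *: v) - w x| <= L * `|t|) ->
  {ae leb, forall x, derivable w x v}.
Proof.
move=> cw wL; have mB := measurable_nonderivable v cw.
set B := nonderivable w v in mB.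
suff B0 : leb B = 0%E.
  by exists B; split => // x /= ?; apply/nonderivableP.
pose phi (z : measurableTypeR R * 'rV[R]_n) : \bar R := (\1_B (z.2 + z.1 *: v))%:E.
have mphi : measurable_fun setT phi.
  apply/measurable_EFinP.
  apply: (@measurableT_comp _ _ _ _ _ _ (\1_B : 'rV[R]_n -> R)) => //.
  apply: measurable_fun_rV => i; under eq_fun do rewrite !mxE.
  apply: measurable_funD; first exact: measurableT_comp (measurable_rV_coord i) measurable_snd.
  by apply: measurable_funM => //.
have phi0 z : (0 <= phi z)%E by rewrite lee_fin.
have := @fubini_tonelli _ _ _ _ R lebesgue_measure leb phi mphi phi0.
rewrite [RHS]integral0_eq; last first.
  move=> x _; rewrite /phi /=.
  transitivity (\int[lebesgue_measure]_(t in setT) (\1_((fun t : R => x + t *: v) @^-1` B) t)%:E)%E => //.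
  have mpre : measurable ((fun t : measurableTypeR R => x + t *: v) @^-1` B).
    apply: measurable_preimageT => //.
    apply: measurable_fun_rV => i; under eq_fun do rewrite !mxE.
    by apply: measurable_funD => //; apply: measurable_funM.
  rewrite integral_indic// setIT.
  have [N [mN N0 BN]] : {ae lebesgue_measure, forall t : R, derivable w (x + t *: v) v}.
    have := @lipschitz_ae_derivable R (fun s : R => w (x + s *: v)) L.
    move=> H; have {}H : {ae lebesgue_measure, forall t, derivable (fun s : R => w (x + s *: v)) t 1}.
      apply: H => s t.
      have -> : x + s *: v = (x + t *: v) + (s - t) *: v.
        by rewrite -addrA -scalerDl subrKC.
      exact: wL.
    by move: H; apply: ae_mono => t; rewrite derivable_line.
  apply/eqP; rewrite -measure_le0 -N0; apply: le_measure; rewrite ?inE//.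
  by move=> t /= /nonderivableP nd; apply: BN.
under eq_integral => t _.
  rewrite /phi/= (@ge0_integral_rV_translation _ _ (t *: v) (fun x => (\1_B x)%:E))//; last by apply/measurable_EFinP.
  rewrite integral_indic// setIT.
  over.
rewrite integral_cst//= => /eqP; rewrite mule_eq0 => /orP[/eqP//|].
by rewrite -set_itvNyy lebesgue_measure_itv.
Qed.

End directional.

Section integral_derive.
Context {R : realType} {n : nat}.
Local Notation leb := (@lebesgue_rV R n).
Implicit Types (w f g : 'rV[R]_n -> R) (v x : 'rV[R]_n).

Lemma derive_norm_le w v x (L : R) : derivable w x v ->
  (forall t, `|w (x + t *: v) - w x| <= L * `|t|) -> `|'D_v w x| <= L.
Proof.
move=> /dquot_seq_cvg dw wL.
have dL : `|dquot w v k.+1%:R^-1 x| @[k --> \oo] --> `|'D_v w x| by exact: cvg_norm.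
apply: (cvgr_to_le dL); apply: nearW => k /=.
rewrite /dquot normrM mulrC normfV ler_pdivrMr ?normr_gt0 ?invr_eq0//.
Qed.

Lemma finite_leb_ball (M : R) : (leb (ball (0 : 'rV[R]_n)%R M) < +oo)%E.
Proof.
have [M0|M0] := ltP 0 M; first by apply: le_lt_trans (lebesgue_rV_ball (0 : 'rV[R]_n) M0).1 (ltry _).
rewrite (_ : ball _ _ = set0) ?measure0//.
by apply/seteqP; split => // y [/(le_lt_trans M0)]; rewrite ltxx.
Qed.

Lemma compact_finite_leb (K : set 'rV[R]_n) : compact K -> (leb K < +oo)%E.
Proof.
move=> cK; have [M M0 KM] := compact_sub_ball cK; apply: le_lt_trans (finite_leb_ball M).
have hs : hausdorff_space 'rV[R]_n by exact: norm_hausdorff.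
have mK : measurable K by exact: closed_rV_measurable (compact_closed hs cK).
have mB : measurable (ball (0 : 'rV[R]_n) M) by apply: measurable_rV_open; exact: ball_openT.
by apply: le_measure; rewrite ?inE.
Qed.

Lemma integrable_translation (f : 'rV[R]_n -> \bar R) h : leb.-integrable setT f ->
  leb.-integrable setT (fun x => f (x + h)).
Proof.
move=> /integrableP[mf foo]; apply/integrableP; split.
  by apply: measurableT_comp => //; exact: measurable_rV_translation.
rewrite (@ge0_integral_rV_translation _ _ h (fun x => `|f x|%E))//.
exact: measurableT_comp.
Qed.

Lemma bounded_support_integrable w (C M : R) : measurable_fun setT w ->
  (forall x, `|w x| <= C) -> (forall x, ~ ball 0 M x -> w x = 0) ->
  leb.-integrable setT (EFin \o w).
Proof.
move=> mw wC w0.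
have mB : measurable (ball (0 : 'rV[R]_n) M) by apply: measurable_rV_open; exact: ball_openT.
have -> : w = w \_ (ball 0 M).
  apply/funext => x; rewrite patchE; case: ifPn => // /negP xM.
  by apply: w0 => xb; apply: xM; rewrite inE.
rewrite -restrict_EFin -integrable_mkcond//.
apply: (@measurable_bounded_integrable _ _ _ leb) => //.
- exact: finite_leb_ball.
- exact: measurable_funTS.
- exists C; split; first exact: num_real.
  by move=> N CN x _; exact: le_trans (wC x) (ltW CN).
Qed.

(** Difference quotients have integral 0 by translation invariance. They are bounded by [L] and, for
    steps at most 1, supported in the ball of radius [|M| + |v|], so dominated convergence passes to
    the derivative. This is the integration by parts that Lipschitz coefficients admit. *)
Lemma integral_derive0 w v (L C M : R) : continuous w ->
  (forall x t, `|w (x + t *: v) - w x| <= L * `|t|) ->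
  (forall x, `|w x| <= C) -> (forall x, ~ ball 0 M x -> w x = 0) ->
  (\int[leb]_x ('D_v w x)%:E = 0)%E.
Proof.
move=> cw wL wC w0.
have mw : measurable_fun setT w by exact: continuous_rV_measurable_fun.
have iw := bounded_support_integrable mw wC w0.
have mq k : measurable_fun setT (dquot w v k.+1%:R^-1).
  by apply: continuous_rV_measurable_fun; exact: continuous_dquot.
pose g : 'rV[R]_n -> R := cst L \_ (ball 0 (`|M| + `|v|)).
have qg k x : `|dquot w v k.+1%:R^-1 x| <= g x.
  rewrite /g patchE; case: ifPn => [_|/negP xM].
    by rewrite /dquot normrM mulrC normfV ler_pdivrMr ?normr_gt0 ?invr_eq0.
  have xM' : `|M| + `|v| <= `|x|.
    by rewrite leNgt; apply/negP => xM'; apply: xM; rewrite inE -ball_normE /= sub0r normrN.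
  rewrite /dquot !w0 ?subrr ?mulr0 ?normr0//.
    rewrite -ball_normE /= sub0r normrN; apply/negP; rewrite -leNgt.
    by rewrite (le_trans (ler_norm M))// (le_trans _ xM')// lerDl.
  rewrite -ball_normE /= sub0r normrN => xh.
  have kv : `|k.+1%:R^-1 *: v| <= `|v|.
    by rewrite normrZ ger0_norm ?invr_ge0// ler_piMl// invf_le1// ler1n.
  have : `|x| <= `|x + k.+1%:R^-1 *: v| + `|k.+1%:R^-1 *: v|.
    by rewrite -{1}(addrK (k.+1%:R^-1 *: v) x); exact: ler_normB.
  by have := ler_norm M; lra.
have ig : leb.-integrable setT (EFin \o g).
  apply: (@bounded_support_integrable _ `|L| (`|M| + `|v|)).
  - by apply/(measurable_restrictT _ _).1 => //; apply: measurable_rV_open; exact: ball_openT.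
  - by move=> x; rewrite /g patchE; case: ifPn => // _; rewrite normr0.
  - by move=> x xM; rewrite /g patchE memNset.
have mqE k : measurable_fun setT (fun x => (dquot w v k.+1%:R^-1 x)%:E).
  exact/measurable_EFinP.
have [||||_ _ qD] := @dominated_convergence _ _ _ leb setT measurableT
  (fun k x => (dquot w v k.+1%:R^-1 x)%:E) (fun x => ('D_v w x)%:E) (EFin \o g) mqE.
- by apply/measurable_EFinP; exact: measurable_derive.
- move: (dirlip_ae_derivable cw wL); apply: ae_mono => x dx _.
  by apply: cvg_EFin; [exact: nearW|exact: dquot_seq_cvg].
- exact: ig.
- by apply: aeW => x k _; rewrite /= lee_fin.
apply/esym/(cvg_unique _ _ qD) => //.
rewrite (_ : [sequence _]_k = cst 0%E); first exact: cvg_cst.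
apply/funext => k /=.
under eq_integral do rewrite EFinM.
have iwk := integrable_translation (k.+1%:R^-1 *: v) iw.
rewrite integralZl//; last by under eq_fun do rewrite EFinB; exact: integrableB.
have /= E := @integral_rV_translation R n (k.+1%:R^-1 *: v) (EFin \o w) ((measurable_EFinP _ _).2 mw).
rewrite (_ : (\int[leb]_x _)%E = 0%E) ?mule0//.
transitivity (\int[leb]_x ((w (x + k.+1%:R^-1 *: v)%R)%:E - (w x)%:E))%E.
  by apply: eq_integral => x _; rewrite EFinB.
rewrite integralB_EFin// E subee//.
exact: integrable_fin_num.
Qed.

End integral_derive.

(** * Mollifiers and convolution *)

Section bump.
Context {R : realType}.
Implicit Types (t s : R) (Q : {poly R}).

(** Polynomial times a power of [1 / (1 - t^2)] times the standard bump, extended by 0. The class is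
    closed under differentiation, so smoothness of every order follows by induction. *)
Definition bumpf Q (k : nat) t : R :=
  if `|t| < 1 then Q.[t] * (1 - t ^+ 2)^-1 ^+ k * expR (- (1 - t ^+ 2)^-1) else 0.

(** The polynomial factor of the derivative once [(1 - t^2)^-(k+2)] is factored out; the three terms
    come from [Q], from the power and from the exponential. *)
Definition bumpd Q (k : nat) : {poly R} :=
  Q^`() * (1 - 'X ^+ 2) ^+ 2 + (2 * k%:R)%:P * 'X * Q * (1 - 'X ^+ 2) - 2%:P * 'X * Q.

Lemma poly_bounded Q : exists2 C : R, 0 < C & forall t, `|t| < 1 -> `|Q.[t]| <= C.
Proof.
exists (1 + \sum_(i < size Q) `|Q`_i|) => [|t t1].
  by rewrite ltr_pwDl// sumr_ge0.
rewrite horner_coef (le_trans (ler_norm_sum _ _ _))// ler_wpDl// ler_sum// => i _.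
by rewrite normrM ler_piMr// normrX exprn_ile1// ltW.
Qed.

(** Raise [y / (m+1) <= exp (y / (m+1))] to the power [m+1]. *)
Lemma exprn_expRN_le m (y : R) : 0 <= y -> y ^+ m.+1 * expR (- y) <= m.+1%:R ^+ m.+1.
Proof.
move=> y0; rewrite expRN ler_pdivrMr ?expR_gt0//.
have -> : expR y = expR (y / m.+1%:R) ^+ m.+1.
  by rewrite -expRM_natl mulrCA divff ?mulr1// pnatr_eq0.
rewrite -exprMn lerXn2r ?nnegrE ?mulr_ge0 ?expR_ge0//.
rewrite mulrC -ler_pdivrMr ?ltr0n//.
by rewrite (le_trans _ (expR_ge1Dx _))// lerDr.
Qed.

(** With [y = 1 / (1 - t^2)], write [y^k exp(-y)] as the bounded quantity [y^(k+2) exp(-y)] times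
    [(1 - t^2)^2]. The quadratic factor is what forces the derivative to vanish at the ends of the
    support. *)
Lemma bumpf_bound Q k : exists2 C : R, 0 < C & forall t, `|bumpf Q k t| <= C * `|1 - t ^+ 2| ^+ 2.
Proof.
have [C C0 QC] := poly_bounded Q.
have [K K0 KE] : exists2 K : R, 0 < K & forall y : R, 0 <= y -> y ^+ k.+2 * expR (- y) <= K.
  by exists (k.+2%:R ^+ k.+2) => [|y y0]; [rewrite exprn_gt0|exact: exprn_expRN_le].
exists (C * K) => [|t]; first by rewrite mulr_gt0.
rewrite /bumpf; case: ifPn => t1; last first.
  by rewrite normr0; apply: mulr_ge0; [apply: mulr_ge0; exact: ltW|exact: exprn_ge0].
have d0 : 0 < 1 - t ^+ 2 by rewrite subr_gt0 -real_normK ?num_real// exprn_ilt1.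
have := QC t t1; move: (Q.[t]) (1 - t ^+ 2) d0 => q U U0 qC.
rewrite !normrM -mulrA -[leRHS]mulrA ler_pM//.
rewrite (gtr0_norm (expR_gt0 _)) (gtr0_norm U0) ger0_norm; last by rewrite exprn_ge0// invr_ge0 ltW.
have -> : U^-1 ^+ k = U^-1 ^+ k.+2 * U ^+ 2.
  by rewrite -addn2 exprD -mulrA -exprMn mulVf ?gt_eqF// expr1n mulr1.
rewrite mulrAC ler_wpM2r ?exprn_ge0 ?(ltW U0)//.
by apply: KE; rewrite invr_ge0 ltW.
Qed.

Lemma dR_M (f g : R -> R) t a b : is_derive t 1 f a -> is_derive t 1 g b ->
  is_derive t 1 (fun z => f z * g z) (a * g t + f t * b).
Proof.
move=> df dg; apply: is_derive_eq (is_deriveM df dg) _.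
by rewrite /GRing.scale /=; ring.
Qed.

Lemma dR_D (f g : R -> R) t a b : is_derive t 1 f a -> is_derive t 1 g b ->
  is_derive t 1 (fun z => f z + g z) (a + b).
Proof. exact: is_deriveD. Qed.

Lemma dR_B (f g : R -> R) t a b : is_derive t 1 f a -> is_derive t 1 g b ->
  is_derive t 1 (fun z => f z - g z) (a - b).
Proof. exact: is_deriveB. Qed.

Lemma dR_X (f : R -> R) m t a : is_derive t 1 f a ->
  is_derive t 1 (fun z => f z ^+ m.+1) (m.+1%:R * f t ^+ m * a).
Proof.
move=> df; have := is_deriveX m.+1 df.
by rewrite (_ : f ^+ m.+1 = fun z => f z ^+ m.+1)//; apply/funext => z; rewrite fctE.
Qed.

Lemma quadratic_is_derive0 (f : R -> R) t (C : R) : 0 < C ->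
  (forall s, `|f s - f t| <= C * `|s - t| ^+ 2) -> is_derive t 1 f 0.
Proof.
move=> C0 fC; have cf : (fun h => h^-1 *: ((f \o shift t) (h *: (1 : R)) - f t)) @ 0^' --> (0 : R).
  apply/cvgrPdist_lt => e e0; apply/nbhs_ballP; exists (e / C) => /=; first by rewrite divr_gt0.
  move=> h; rewrite /ball/= sub0r normrN => hd h0.
  rewrite sub0r normrN /= normrM normfV [h *: 1]mulr1 mulrC ltr_pdivrMr ?normr_gt0//.
  apply: le_lt_trans (fC _) _; rewrite addrK expr2 mulrA ltr_pM2r ?normr_gt0//.
  by rewrite mulrC -ltr_pdivlMr.
by split; [apply/cvg_ex; exists 0|exact: cvg_lim].
Qed.

Lemma is_derive_bumpf Q k t : is_derive t 1 (bumpf Q k) (bumpf (bumpd Q k) k.+2 t).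
Proof.
have [t1|t1] := ltP `|t| 1; last first.
  have [C C0 bC] := bumpf_bound Q k.
  rewrite [X in is_derive _ _ _ X](_ : _ = 0); last by rewrite /bumpf ltNge t1.
  (* For [|s| < 1 <= |t|] one has [1 - s^2 <= 2 |s - t|]; the factor 4 is the square of this 2. *)
  apply: (@quadratic_is_derive0 _ _ (C * 4)); first by rewrite mulr_gt0.
  move=> s; have -> : bumpf Q k t = 0 by rewrite /bumpf ltNge t1.
  rewrite subr0; have [s1|s1] := ltP `|s| 1; last first.
    by rewrite /bumpf ltNge s1/= normr0 !mulr_ge0// ltW.
  apply: le_trans (bC s) _; rewrite -mulrA ler_wpM2l ?(ltW C0)//.
  have -> : 4 * `|s - t| ^+ 2 = (2 * `|s - t|) ^+ 2 by ring.
  rewrite lerXn2r ?nnegrE// ?mulr_ge0//.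
  have s2 : 0 <= 1 - s ^+ 2 by rewrite subr_ge0 -real_normK ?num_real// exprn_ile1// ltW.
  rewrite ger0_norm// -real_normK ?num_real//.
  have -> : 1 - `|s| ^+ 2 = (1 - `|s|) * (1 + `|s|) by ring.
  have h1 : 1 - `|s| <= `|s - t|.
    have : `|t| <= `|s| + `|s - t| by rewrite -{1}(subKr s t) ler_normB.
    by lra.
  apply: (@le_trans _ _ ((1 - `|s|) * 2)); last by rewrite mulrC ler_wpM2l.
  by rewrite ler_wpM2l ?subr_ge0 1?ltW//; lra.
have d0 (z : R) : `|z| < 1 -> 0 < 1 - z ^+ 2.
  by move=> z1; rewrite subr_gt0 -real_normK ?num_real// exprn_ilt1.
have dt := d0 _ t1.
pose g (z : R) := Q.[z] * (1 - z ^+ 2)^-1 ^+ k * expR (- (1 - z ^+ 2)^-1).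
have gE : \near t, g t = bumpf Q k t.
  apply/nbhs_ballP; exists (1 - `|t|) => [|z]; first by rewrite /= subr_gt0.
  rewrite /ball/= ltrBrDl => tz; rewrite /g /bumpf ifT//; apply: le_lt_trans tz.
  by rewrite -{1}(subKr t z) (le_trans (ler_normB _ _)).
apply: (near_eq_is_derive gE).
have d1 : is_derive t 1 (fun z : R => (1 - z ^+ 2)^-1) (2 * t * (1 - t ^+ 2)^-1 ^+ 2).
  have d2 : is_derive t 1 (fun z : R => 1 - z ^+ 2) (- (2 * t)).
    rewrite [X in is_derive _ _ _ X](_ : _ = 0 - 2 * t ^+ 1 * 1); last by ring.
    by apply: dR_B; apply: (@dR_X id 1); exact: is_derive_id.
  have H : is_derive t 1 (fun z : R => (1 - z ^+ 2)^-1) (- (1 - t ^+ 2) ^- 2 *: - (2 * t)).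
    exact: (@is_deriveV R (fun z : R => 1 - z ^+ 2) t _ 1 (lt0r_neq0 dt) d2).
  by apply: is_derive_eq H _; rewrite /GRing.scale /= exprVn; ring.
pose u : R := (1 - t ^+ 2)^-1.
have uE : u * (1 - t ^+ 2) = 1 by rewrite mulVf// gt_eqF.
have d3 : is_derive t 1 (fun z : R => (1 - z ^+ 2)^-1 ^+ k) (k%:R * u ^+ k.+1 * (2 * t)).
  case: k {gE g} => [|k].
    by rewrite !mul0r; under eq_fun do rewrite expr0; exact: is_derive_cst.
  by apply: is_derive_eq (dR_X k d1) _; rewrite /= -/u !exprS; ring.
have d4 : is_derive t 1 (fun z : R => expR (- (1 - z ^+ 2)^-1)) (expR (- u) * (- (2 * t * u ^+ 2))).
  by apply: (@is_derive1_comp R expR (fun z => - (1 - z ^+ 2)^-1)); exact: is_deriveN d1.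
have H := dR_M (dR_M (is_derive_poly Q t) d3) d4.
apply: is_derive_eq H _; rewrite /bumpf t1 -/u.
have E2 : u ^+ k = u ^+ k.+2 * (1 - t ^+ 2) ^+ 2.
  by rewrite -addn2 exprD -mulrA -exprMn uE expr1n mulr1.
have E1 : u ^+ k.+1 = u ^+ k.+2 * (1 - t ^+ 2).
  by rewrite [in RHS]exprSr -mulrA uE mulr1.
have E3 : u ^+ k.+2 = u ^+ k * u * u by rewrite !exprSr.
move: (u ^+ k.+2) (u ^+ k.+1) (u ^+ k) E1 E2 E3 => w2 w1 w0 -> E2 E3.
rewrite /bumpd !hornerE /=.
move: (expR (- u)) (Q.[t]) ((Q^`()).[t]) (k%:R : R) => e q q' kr.
transitivity ((q' * w0 + q * kr * (w2 * (1 - t ^+ 2)) * 2 * t) * e - 2 * t * q * e * (w0 * u * u)).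
  by ring.
by rewrite -E3 E2; ring.
Qed.

End bump.

Section bump_rV.
Context {R : realType} {n : nat}.
Local Notation leb := (@lebesgue_rV R n).
Implicit Types (x y : 'rV[R]_n) (Q : 'I_n -> {poly R}) (k : 'I_n -> nat) (b : 'I_n -> R).

Lemma continuous_bumpf (P : {poly R}) (m : nat) : continuous (bumpf P m).
Proof.
by move=> t; apply: differentiable_continuous; apply/derivable1_diffP; have [] := is_derive_bumpf P m t.
Qed.

(** Products of one-variable bumps, again closed under partial derivatives. The scale [a] becomes
    the inverse of the mollification radius, and the offsets [b] encode translations. *)
Definition bumprV (c : R) Q k (a : R) b x := c * \prod_(i < n) bumpf (Q i) (k i) (a * x 0 i + b i).

Lemma continuous_bumprV c Q k a b : continuous (bumprV c Q k a b).
Proof.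
move=> x; apply: ctsM; first exact: cts_cst.
apply: (@cts_prod _ _ _ _ (fun i x => bumpf (Q i) (k i) (a * x 0 i + b i))) => i.
apply: (@cts_comp _ _ (bumpf (Q i) (k i)) (fun x => a * x 0 i + b i)); last exact: continuous_bumpf.
by apply: ctsD; [apply: ctsM; [exact: cts_cst|exact: cts_coord]|exact: cts_cst].
Qed.

Lemma is_derive_lineP (f : 'rV[R]_n -> R) x v d :
  is_derive (0 : R) (1 : R) (fun s : R => f (x + s *: v)) d -> is_derive x v f d.
Proof.
move=> [df dfE]; rewrite derivable_line scale0r addr0 in df.
by split => //; rewrite -dfE -derive1E derive_line scale0r addr0.
Qed.

Let Qd Q k (j : 'I_n) i := if i == j then bumpd (Q i) (k i) else Q i.
Let kd k (j : 'I_n) i := if i == j then (k i).+2 else k i.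

Lemma is_derive_bumprV c Q k a b x (j : 'I_n) :
  is_derive x (delta_mx 0 j) (bumprV c Q k a b) (bumprV (c * a) (Qd Q k j) (kd k j) a b x).
Proof.
apply: is_derive_lineP.
pose K := c * \prod_(i < n | i != j) bumpf (Q i) (k i) (a * x 0 i + b i).
have -> : (fun s : R => bumprV c Q k a b (x + s *: delta_mx 0 j)) =
    (fun s : R => bumpf (Q j) (k j) (a * s + (a * x 0 j + b j)) * K).
  apply/funext => s; rewrite /bumprV (bigD1 j)//= mulrCA; congr (_ * (_ * _)).
    by rewrite !mxE !eqxx/= mulr1; congr bumpf; ring.
  by apply: eq_bigr => i /negbTE ij; rewrite !mxE eqxx ij/= mulr0 addr0.
have d1 : is_derive (0 : R) (1 : R) (fun s : R => a * s + (a * x 0 j + b j)) a.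
  have c1 : is_derive (0 : R) (1 : R) (fun=> a) 0 by exact: is_derive_cst.
  have c2 : is_derive (0 : R) (1 : R) (fun=> a * x 0 j + b j) 0 by exact: is_derive_cst.
  have c3 : is_derive (0 : R) (1 : R) (fun s : R => s) 1 by exact: is_derive_id.
  by apply: is_derive_eq (dR_D (dR_M c1 c3) c2) _; ring.
have d2 := @is_derive1_comp R (bumpf (Q j) (k j)) (fun s : R => a * s + (a * x 0 j + b j)) 0 _ _ (is_derive_bumpf _ _ _) d1.
have c4 : is_derive (0 : R) (1 : R) (fun=> K) 0 by exact: is_derive_cst.
apply: is_derive_eq (dR_M d2 c4) _.
rewrite !mulr0 addr0 add0r /bumprV (bigD1 j)//= /Qd /kd eqxx /K.
rewrite (eq_bigr (fun i => bumpf (Q i) (k i) (a * x 0 i + b i))); last by move=> i /negbTE ->.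
by ring.
Qed.

Lemma Ck_bumprV m c Q k a b : Ck m setT (bumprV c Q k a b).
Proof.
elim: m c Q k b => [|m IHm] c Q k b; split => //; [by move=> x _; exact: continuous_bumprV| |].
  by move=> x _; exact: continuous_bumprV.
move=> i; split => [x _|]; first by have [] := is_derive_bumprV c Q k a b x i.
rewrite (_ : partial i _ = bumprV (c * a) (Qd Q k i) (kd k i) a b)//.
by apply/funext => x; rewrite /partial; have [_ ->] := is_derive_bumprV c Q k a b x i.
Qed.

Lemma bumpf_le (P : {poly R}) m : exists2 C : R, 0 < C & forall t, `|bumpf P m t| <= C.
Proof.
have [C C0 bC] := bumpf_bound P m; exists C => // t.
have [t1|t1] := ltP `|t| 1; last by rewrite /bumpf ltNge t1/= normr0 ltW.
apply: le_trans (bC t) _; rewrite ler_piMr ?(ltW C0)// exprn_ile1//.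
have t2 : `|t| ^+ 2 < 1 by rewrite exprn_ilt1.
have t3 := sqr_ge0 `|t|.
have -> : `|1 - t ^+ 2| = 1 - `|t| ^+ 2.
  by rewrite -(real_normK (num_real t)) [LHS]ger0_norm// subr_ge0 ltW.
by lra.
Qed.

Lemma bumprV_bounded Q k : exists2 C : R, 0 < C & forall c a b x, `|bumprV c Q k a b x| <= `|c| * C.
Proof.
have H i : exists C : R, 0 < C /\ forall t, `|bumpf (Q i) (k i) t| <= C.
  by have [C C0 bC] := bumpf_le (Q i) (k i); exists C.
have /choice[C HC] := H.
exists (\prod_(i < n) C i) => [|c a b x]; first by apply: prodr_gt0 => i _; exact: (HC i).1.
rewrite /bumprV normrM ler_wpM2l// normr_prod.
by apply: ler_prod => i _; rewrite normr_ge0 (HC i).2.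
Qed.

Lemma derive_translate (f : 'rV[R]_n -> R) x y v : 'D_v (fun z => f (z - y)) x = 'D_v f (x - y).
Proof.
have E : dquot (fun z => f (z - y)) v ^~ x = dquot f v ^~ (x - y).
  by apply/funext => h; rewrite /dquot addrAC.
by rewrite !deriveE_dquot E.
Qed.

(** The last bounds record the scaling of the kernel and of its gradient with a constant [C]
    independent of the radius [e]; only this scaling enters the estimates. *)
Definition is_mollifier (C e : R) (rho : 'rV[R]_n -> R) :=
  [/\ forall y m, Ck m setT (fun x => rho (x - y)), forall x, 0 <= rho x,
    forall x, ~ ball 0 e x -> rho x = 0, (\int[leb]_x (rho x)%:E = 1)%E &
    (forall x, rho x <= C / e ^+ n) /\ (forall i x, `|partial i rho x| <= C / e ^+ n.+1)].

Lemma mollifier_exists : exists2 C : R, 0 < C & forall e, 0 < e -> exists rho, is_mollifier C e rho.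
Proof.
pose Q1 (i : 'I_n) : {poly R} := 1; pose k0 (i : 'I_n) := 0%N.
have [D0 D00 D0P] := bumprV_bounded Q1 k0.
have /choice[D DP] : forall j : 'I_n, exists C : R, 0 < C /\
    forall c a b x, `|bumprV c (Qd Q1 k0 j) (kd k0 j) a b x| <= `|c| * C.
  by move=> j; have [C ? ?] := bumprV_bounded (Qd Q1 k0 j) (kd k0 j); exists C.
(* On the ball of radius [e / 2] each factor is at least [exp(-2)], because [1 / (1 - s^2) <= 4/3]
   for [|s| <= 1/2], and that ball has measure at least [(e / 2)^n]. So [c * e ^+ n] bounds the
   normalising integral from below. *)
pose c : R := (expR (- 2) / 2) ^+ n.
have c0 : 0 < c by rewrite exprn_gt0// divr_gt0// expR_gt0.
pose S := D0 + \sum_j D j.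
have SD : D0 <= S by rewrite lerDl sumr_ge0// => j _; exact: ltW (DP j).1.
have SDj j : D j <= S.
  rewrite /S (bigD1 j)//= addrCA lerDl; apply: addr_ge0; first exact: ltW.
  by apply: sumr_ge0 => i _; exact: ltW (DP i).1.
have S0 : 0 < S by exact: lt_le_trans SD.
exists (S / c) => [|e e0]; first by rewrite divr_gt0.
have ei0 : 0 < e^-1 by rewrite invr_gt0.
pose B := bumprV 1 Q1 k0 e^-1 (fun=> 0).
have BE x : B x = \prod_(i < n) bumpf 1 0 (e^-1 * x 0 i) by rewrite /B /bumprV mul1r; under eq_bigr do rewrite addr0.
have b0 t : 0 <= bumpf (1 : {poly R}) 0 t.
  by rewrite /bumpf; case: ifP => // _; rewrite hornerC expr0 !mul1r expR_ge0.
have B0 x : 0 <= B x by rewrite BE prodr_ge0.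
have BN x : ~ ball 0 e x -> B x = 0.
  move=> xe; have [i xi] : exists i, e <= `|x 0 i|.
    apply: contrapT => H; apply: xe; split => // i' i; rewrite ord1 /ball/= mxE sub0r normrN ltNge.
    by apply/negP => ?; apply: H; exists i.
  rewrite BE (bigD1 i)//= /bumpf ifF ?mul0r//; apply/negbTE; rewrite -leNgt.
  by rewrite normrM gtr0_norm// mulrC ler_pdivlMr// mul1r.
have cB : continuous B by exact: continuous_bumprV.
have mB : measurable_fun setT B by exact: continuous_rV_measurable_fun.
have iB : leb.-integrable setT (EFin \o B).
  by apply: (@bounded_support_integrable _ _ _ (`|1| * D0) e) => // x; exact: D0P.
pose I := fine (\int[leb]_x (B x)%:E)%E.
have IE : (\int[leb]_x (B x)%:E = I%:E)%E by rewrite fineK//; exact: integrable_fin_num.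
have cI : c * e ^+ n <= I.
  rewrite -lee_fin -IE.
  have mb : measurable (ball (0 : 'rV[R]_n) (e / 2)) by apply: measurable_rV_open; exact: ball_openT.
  apply: (@le_trans _ _ (\int[leb]_(x in ball (0 : 'rV[R]_n)%R (e / 2)%R) (expR (- 2) ^+ n)%:E)%E).
    rewrite integral_cst// (_ : c * _ = expR (- 2) ^+ n * (e / 2) ^+ n); last first.
      by rewrite /c -!exprMn; congr (_ ^+ _); ring.
    rewrite EFinM; apply: lee_wpmul2l; first by rewrite lee_fin exprn_ge0// expR_ge0.
    by apply: (lebesgue_rV_ball _ _).2; rewrite divr_gt0.
  apply: (@le_trans _ _ (\int[leb]_(x in ball (0 : 'rV[R]_n)%R (e / 2)%R) (B x)%:E)%E); last first.
    apply: ge0_subset_integral => //; first exact/measurable_EFinP.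
    by move=> x _; rewrite lee_fin.
  apply: ge0_le_integral => //.
  - by apply/measurable_EFinP; exact: measurable_funTS.
  move=> x [_ xe]; rewrite lee_fin BE -[X in _ ^+ X]card_ord -prodr_const ler_prod// => i _.
  rewrite expR_ge0/=; have := xe 0 i; rewrite /ball/= mxE sub0r normrN => xi.
  have ex : `|e^-1 * x 0 i| < 1 / 2.
    by rewrite normrM gtr0_norm// mulrC ltr_pdivrMr//; lra.
  rewrite /bumpf (lt_trans ex) ?hornerC ?expr0 ?mul1r ?ler_expR; last by lra.
  have q : `|e^-1 * x 0 i| ^+ 2 <= (1 / 2) ^+ 2 by rewrite lerXn2r ?nnegrE ?divr_ge0 ?(ltW ex).
  rewrite lerN2 -(real_normK (num_real (e^-1 * x 0 i))).
  have -> : 2 = (1 / 2)^-1 :> R by rewrite div1r invrK.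
  by rewrite lef_pV2 ?posrE; move: q; rewrite expr2; lra.
have ce0 : 0 < c * e ^+ n by rewrite mulr_gt0// exprn_gt0.
have I0 : 0 < I by exact: lt_le_trans cI.
pose rho := bumprV I^-1 Q1 k0 e^-1 (fun=> 0).
have rE x : rho x = I^-1 * B x by rewrite /B /rho /bumprV mul1r.
have Ic : I^-1 <= c^-1 / e ^+ n by rewrite -invfM lef_pV2.
exists rho; split.
- move=> y m; rewrite (_ : (fun x => _) = bumprV I^-1 Q1 k0 e^-1 (fun i => - (e^-1 * y 0 i))).
    exact: Ck_bumprV.
  apply/funext => x; rewrite /rho /bumprV; congr (_ * _); apply: eq_bigr => i _.
  by rewrite !mxE addr0 mulrBr.
- by move=> x; rewrite rE mulr_ge0// invr_ge0 ltW.
- by move=> x /BN; rewrite rE => ->; rewrite mulr0.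
- under eq_integral do rewrite rE EFinM.
  by rewrite integralZl// IE -EFinM mulVf// gt_eqF.
have Iv0 : 0 <= I^-1 by rewrite invr_ge0 ltW.
have en0 : 0 <= (e ^+ n)^-1 by rewrite invr_ge0 exprn_ge0// ltW.
have Sc : S / c / e ^+ n = c^-1 / e ^+ n * S by ring.
split => [x|i x].
  apply: le_trans (ler_norm _) _; apply: le_trans (D0P _ _ _ _) _.
  by rewrite ger0_norm// Sc; apply: ler_pM => //; exact: ltW.
rewrite /partial; have [_ ->] := is_derive_bumprV I^-1 Q1 k0 e^-1 (fun=> 0) x i.
apply: le_trans ((DP i).2 _ _ _ _) _.
rewrite normrM (ger0_norm Iv0) (gtr0_norm ei0).
rewrite exprSr invfM mulrA Sc mulrAC ler_wpM2r ?(ltW ei0)//.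
by apply: ler_pM => //; exact: ltW (DP i).1.
Qed.

End bump_rV.

(** * Mean value and Lipschitz bounds for functions of class C^k *)

Section lipschitz_C1.
Context {R : realType} {n : nat}.
Implicit Types (f g : 'rV[R]_n -> R) (v x y : 'rV[R]_n).

Lemma line_MVT f v x t : (forall y, derivable f y v) ->
  exists2 s, `|s| <= `|t| & f (x + t *: v) - f x = 'D_v f (x + s *: v) * t.
Proof.
move=> df; pose g := fun s : R => f (x + s *: v).
have dg (s : R) : is_derive s (1 : R) g ('D_v f (x + s *: v)).
  by split; [rewrite /g derivable_line; exact: df|rewrite -derive1E derive_line].
have cg (a b : R) : {within `[a, b], continuous g}.
  apply: continuous_subspaceT => s; apply: differentiable_continuous.
  by apply/derivable1_diffP; have [] := dg s.
have [t0|t0] := leP 0 t.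
  have [s] := @MVT_segment R g _ 0 t t0 (fun s _ => dg s) (cg _ _).
  rewrite in_itv/= subr0 {1 2}/g scale0r addr0 => /andP[s0 st] ->; exists s => //.
  by rewrite !ger0_norm.
have [s] := @MVT_segment R g _ t 0 (ltW t0) (fun s _ => dg s) (cg _ _).
rewrite in_itv/= sub0r {1 2}/g scale0r addr0 => /andP[s0 st] E; exists s.
  by rewrite !ler0_norm ?lerN2// ltW.
by rewrite -opprB E mulrN opprK.
Qed.

Lemma line_lipschitz f v x t (L : R) : (forall y, derivable f y v) ->
  (forall y, `|'D_v f y| <= L) -> `|f (x + t *: v) - f x| <= L * `|t|.
Proof. by move=> df fL; have [s _ ->] := line_MVT x t df; rewrite normrM ler_wpM2r. Qed.

Lemma coord_le_norm x i : `|x 0 i| <= `|x|.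
Proof.
apply/ler_addgt0Pr => e e0.
have [_ /(_ 0 i)] : ball 0 (`|x| + e) x by rewrite -ball_normE /= sub0r normrN ltrDl.
by rewrite /ball/= mxE sub0r normrN => /ltW.
Qed.

(** Moves from [x] to [y] one coordinate at a time: [n] steps, each of length at most the sup norm
    of [y - x]. *)
Lemma coord_lipschitz f (L : R) :
  (forall i x t, `|f (x + t *: delta_mx 0 i) - f x| <= L * `|t|) ->
  forall x y, `|f y - f x| <= n%:R * L * `|y - x|.
Proof.
move=> fL x y.
have [n0|n0] := posnP n.
  have -> : y = x by apply/rowP => -[i i0]; exfalso; move: i0; rewrite n0.
  by rewrite !subrr !normr0 mulr0.
have L0 : 0 <= L.
  have := fL (Ordinal n0) 0 1; rewrite normr1 mulr1; apply: le_trans; exact: normr_ge0.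
pose mix (s : seq 'I_n) : 'rV[R]_n := \row_i (if i \in s then y 0 i else x 0 i).
have H s : `|f (mix s) - f x| <= (size s)%:R * L * `|y - x|.
  elim: s => [|i s IH].
    by rewrite (_ : mix [::] = x) ?subrr ?normr0 ?mul0r//; apply/rowP => i; rewrite mxE.
  have -> : mix (i :: s) = mix s + (y 0 i - mix s 0 i) *: delta_mx 0 i.
    apply/rowP => j; rewrite !mxE !eqxx/= in_cons; have [->|ij] /= := eqVneq j i.
      by rewrite mulr1 addrC subrK.
    by rewrite mulr0 addr0.
  set z := mix s + _; rewrite -(subrK (f (mix s)) (f z)) -addrA.
  apply: le_trans (ler_normD _ _) _; rewrite /= -addn1 natrD !mulrDl mul1r [leRHS]addrC lerD//.
  apply: le_trans (fL _ _ _) _; rewrite ler_wpM2l// mxE; case: ifP => _.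
    by rewrite subrr normr0.
  by rewrite (_ : y 0 i - x 0 i = (y - x) 0 i) ?coord_le_norm// !mxE.
have := H (enum 'I_n); rewrite size_enum_ord (_ : mix _ = y)//.
by apply/rowP => i; rewrite mxE mem_enum.
Qed.

Lemma Ck_cts k A f x : Ck k A f -> A x -> {for x, continuous f}.
Proof. by case: k => [|k] [fc _]; exact: fc. Qed.

Lemma Ck_derivable k A f i x : Ck k.+1 A f -> A x -> derivable f x (delta_mx 0 i).
Proof. by move=> [_ /(_ i)[fc _]]; exact: fc. Qed.

Lemma Ck_partial k A f i : Ck k.+1 A f -> Ck k A (partial i f).
Proof. by move=> [_ /(_ i)[]]. Qed.

Lemma Ck_sub k A B f : A `<=` B -> Ck k B f -> Ck k A f.
Proof.
move=> AB; elim: k f => [|k IH] f [fc H]; split => //; first by move=> x /AB; exact: fc.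
  by move=> x /AB; exact: fc.
by move=> i; have [d c] := H i; split; [move=> x /AB; exact: d|exact: IH].
Qed.

Lemma Ck_le k A f : Ck k.+1 A f -> Ck k A f.
Proof.
elim: k f => [|k IH] f [fc H]; split => // i; have [d c] := H i; split => //.
exact: IH.
Qed.

Lemma cts_near0 f y r : 0 < r -> (forall z, ball y r z -> f z = 0) -> \near y, 0 = f y.
Proof. by move=> r0 H; apply/nbhs_ballP; exists r => //= z /H. Qed.

Lemma derive_near0 f v y r : 0 < r -> (forall z, ball y r z -> f z = 0) -> is_derive y v f 0.
Proof.
by move=> r0 H; apply: (near_eq_is_derive (cts_near0 r0 H)).
Qed.

Definition off_ball (x : 'rV[R]_n) (M : R) f := forall y, ~ ball x M y -> f y = 0.

Lemma partial_off_ball f x M (e : R) i : 0 < e -> off_ball x M f -> off_ball x (M + e) (partial i f).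
Proof.
move=> e0 fM y yM; rewrite /partial.
have [//|_ ->//] := @derive_near0 f (delta_mx 0 i) y e e0 _.
by move=> z yz; apply: fM => xz; apply: yM; apply: ball_triangle xz (ball_sym yz).
Qed.

Lemma cts_off_ball_bounded f x M : continuous f -> off_ball x M f ->
  exists2 C : R, 0 < C & forall y, `|f y| <= C.
Proof.
move=> fc fM.
pose K : set 'rV[R]_n := closed_ball x (`|M| + 1).
have M1 : 0 < `|M| + 1 by rewrite ltr_pwDr.
have KM : K `<=` ball 0 (`|x| + (`|M| + 1) + 1).
  move=> y; rewrite /K closed_ballE// /closed_ball_ /= -ball_normE /= sub0r normrN => xy.
  rewrite -(subrKC x y); apply: le_lt_trans (ler_normD _ _) _.
  by rewrite distrC; lra.
have cK : compact K by apply: closed_ball_bounded_compact KM; exact: closed_ball_closed.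
have K0 : K !=set0 by exists x; exact: closed_ballxx.
have nc : continuous (fun y => `|f y|) by move=> y; apply: cts_norm; exact: fc.
have [z _ zM] := compact_EVT_max K0 cK (continuous_subspaceT nc).
exists (`|f z| + 1) => [|y]; first by rewrite ltr_wpDl.
have [Ky|Ky] := pselect (K y).
  by apply: le_trans (zM _ (mem_set Ky)) _; rewrite lerDl.
rewrite fM ?normr0 ?addr_ge0// => xy; apply: Ky; apply: subset_closed_ball.
by apply: le_ball xy; rewrite ler_wpDr// ler_norm.
Qed.

Lemma Ck_lipschitz k f x M : Ck k.+1 setT f -> off_ball x M f ->
  exists2 L : R, 0 < L & forall y z, `|f z - f y| <= L * `|z - y|.
Proof.
move=> fk fM.
have /choice[C HC] i : exists C : R, 0 < C /\ forall y, `|partial i f y| <= C.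
  have [y|C C0 H] := cts_off_ball_bounded _ (partial_off_ball i ltr01 fM).
    exact: Ck_cts (Ck_partial i fk) _.
  by exists C.
have S i : C i <= \sum_j C j.
  rewrite (bigD1 i)//= lerDl; apply: sumr_ge0 => j _; exact: ltW (HC j).1.
exists (n%:R * (\sum_j C j) + 1).
  by rewrite ltr_wpDl// mulr_ge0// sumr_ge0// => j _; exact: ltW (HC j).1.
move=> y z; apply: le_trans (coord_lipschitz (L := \sum_j C j) _ y z) _.
  move=> i {}y t; apply: line_lipschitz => w; first exact: Ck_derivable fk _.
  by apply: le_trans (S i); exact: (HC i).2.
by rewrite ler_wpM2r// lerDl.
Qed.

End lipschitz_C1.

Section convolution.
Context {R : realType} {n : nat}.
Local Notation leb := (@lebesgue_rV R n).
Local Notation intg f := (leb.-integrable setT (EFin \o f)).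
Implicit Types (u k : 'rV[R]_n -> R) (x y v : 'rV[R]_n).

Lemma integrableMb u k (C : R) : intg u -> measurable_fun setT k -> (forall y, `|k y| <= C) ->
  intg (fun y => u y * k y).
Proof.
move=> iu mk kC; have mu : measurable_fun setT u by apply/measurable_EFinP; case/integrableP: iu.
apply: (@le_integrable _ _ _ _ _ measurableT _ (fun y => C%:E * (u y)%:E)%E).
- by apply/measurable_EFinP; apply: measurable_funM.
- move=> y _ /=; rewrite lee_fin !normrM mulrC ler_wpM2r//.
  by apply: le_trans (kC y) _; exact: ler_norm.
- exact: integrableZl.
Qed.

Lemma Rintegral_le u k (C : R) : intg u -> measurable_fun setT k -> (forall y, `|k y| <= C) ->
  `|\int[leb]_y (u y * k y)| <= C * \int[leb]_y `|u y|.
Proof.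
move=> iu mk kC.
have i1 := integrableMb iu mk kC.
have i2 : intg (fun y => `|u y|) by exact: integrable_norm.
apply: le_trans (le_normr_Rintegral measurableT i1) _.
rewrite -RintegralZl//; apply: le_Rintegral => //.
- exact: integrable_norm.
- by have := integrableZl measurableT C i2.
- by move=> y _; rewrite normrM mulrC ler_wpM2r.
Qed.

(* the reflected kernel y - x makes conv u k x the action of u on the translate
   of the test function k to x *)
Definition conv u k x := \int[leb]_y (u y * k (y - x)).

Lemma measurable_shift k x : measurable_fun setT k -> measurable_fun setT (fun y : 'rV[R]_n => k (y - x)).
Proof. by move=> mk; exact: measurable_translate. Qed.

Lemma conv_lipschitz u k (L C : R) : intg u -> measurable_fun setT k ->
  (forall y, `|k y| <= C) -> (forall y z, `|k z - k y| <= L * `|z - y|) ->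
  forall x y, `|conv u k y - conv u k x| <= L * (\int[leb]_y `|u y|) * `|y - x|.
Proof.
move=> iu mk kC kL x y.
have mky z := measurable_shift z mk.
rewrite /conv -RintegralB//; [|exact: integrableMb iu (mky _) _..].
under eq_Rintegral do rewrite -mulrBr.
rewrite mulrAC; apply: Rintegral_le => //; first exact: measurable_funB.
move=> z; apply: le_trans (kL _ _) _.
by rewrite opprB addrC addrA subrK distrC.
Qed.

Lemma lipschitz_continuous k (L : R) : (forall y z, `|k z - k y| <= L * `|z - y|) -> continuous k.
Proof.
move=> kL x; apply/(@cvgrPdist_lt _ _ _ _ (nbhs_filter x)) => e e0; apply/nbhs_ballP.
exists (e / (`|L| + 1)) => [|y].
  by rewrite /= divr_gt0// ltr_wpDl.
rewrite -ball_normE /= => xy; rewrite distrC; apply: le_lt_trans (kL _ _) _.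
rewrite ltr_pdivlMr ?ltr_wpDl// in xy.
apply: le_lt_trans xy; rewrite distrC mulrC ler_wpM2l//.
by rewrite ler_wpDr// ler_norm.
Qed.

(** Once the candidate linear part is removed, the mean value theorem and the Lipschitz bound on
    ['D_v k] leave a remainder of order [s^2] in the kernel, uniformly in [y]. Integrability of [u]
    then suffices, without passing to a limit under the integral. The sign comes from the reflected
    kernel [k (y - x)]. *)
Lemma conv_is_derive u k v x (L C C' : R) : intg u -> continuous k -> continuous (fun y => 'D_v k y) ->
  (forall y, `|k y| <= C) -> (forall y, `|'D_v k y| <= C') ->
  (forall y, derivable k y v) ->
  (forall y t, `|'D_v k (y + t *: v) - 'D_v k y| <= L * `|t|) ->
  is_derive x v (conv u k) (- conv u (fun y => 'D_v k y) x).
Proof.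
move=> iu ck cDk kC DC dk DL; apply: is_derive_lineP.
have mk : measurable_fun setT k by exact: continuous_rV_measurable_fun.
have mDk : measurable_fun setT (fun y => 'D_v k y) by exact: continuous_rV_measurable_fun.
have L0 : 0 <= L.
  by have := DL 0 1; rewrite normr1 mulr1; apply: le_trans; exact: normr_ge0.
have mky z := measurable_shift z mk.
have mDky z := measurable_shift z mDk.
pose g (s : R) := conv u k (x + s *: v) + s * conv u (fun y => 'D_v k y) x.
suff g0 : is_derive (0 : R) (1 : R) g 0.
  have c1 : is_derive (0 : R) (1 : R) (fun s : R => s) 1 by exact: is_derive_id.
  have c2 : is_derive (0 : R) (1 : R) (fun=> conv u (fun y => 'D_v k y) x) 0 by exact: is_derive_cst.
  have := dR_B g0 (dR_M c1 c2).
  rewrite mulr0 addr0 mul1r sub0r; congr is_derive.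
  by apply/funext => s; rewrite /g addrK.
pose K := L * \int[leb]_y `|u y|.
have K0 : 0 <= K by rewrite mulr_ge0// Rintegral_ge0.
apply: (@quadratic_is_derive0 _ _ _ (K + 1)) => [|s]; first by rewrite ltr_wpDl.
have -> : g s - g 0 = \int[leb]_y (u y * (k (y - (x + s *: v)) - k (y - x) + s * 'D_v k (y - x))).
  rewrite /g scale0r addr0 mul0r addr0 /conv.
  rewrite -[X in _ + X - _]RintegralZl//; last exact: integrableMb iu (mDky _) _.
  rewrite addrAC -RintegralB//; [|exact: integrableMb iu (mky _) _..].
  rewrite -RintegralD//.
  - by apply: eq_Rintegral => y _; ring.
  - rewrite (_ : EFin \o _ = fun y => (u y * k (y - (x + s *: v)))%:E - (u y * k (y - x)%R)%:E)%E//.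
    by apply: integrableB => //; exact: integrableMb iu (mky _) _.
  - by have := integrableZl measurableT s (integrableMb iu (mDky x) (fun y => DC _)).
rewrite subr0; apply: (@le_trans _ _ (K * `|s| ^+ 2)); last by rewrite ler_wpM2r ?exprn_ge0// lerDl.
rewrite /K mulrAC; apply: Rintegral_le => //.
  by apply: measurable_funD; [exact: measurable_funB|exact: measurable_funM].
move=> y; have [t ts E] := @line_MVT _ _ k v (y - x) (- s) dk.
have -> : y - (x + s *: v) = (y - x) + (- s) *: v by rewrite opprD addrA scaleNr.
rewrite E (_ : _ + _ = ('D_v k (y - x + t *: v) - 'D_v k (y - x)) * - s); last by ring.
rewrite normrM normrN expr2 mulrA ler_wpM2r//; apply: le_trans (DL _ _) _.
by rewrite ler_wpM2l// -(normrN s).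
Qed.

Lemma conv_partial u k i M x : intg u -> Ck 2 setT k -> off_ball 0 M k ->
  is_derive x (delta_mx 0 i) (conv u k) (- conv u (partial i k) x).
Proof.
move=> iu k2 kM.
have pM := partial_off_ball i ltr01 kM.
have ck : continuous k by move=> y; exact: Ck_cts k2 _.
have cp : continuous (partial i k) by move=> y; exact: Ck_cts (Ck_partial i k2) _.
have [C C0 kC] := cts_off_ball_bounded ck kM.
have [C' C'0 pC] := cts_off_ball_bounded cp pM.
have [L L0 pL] := Ck_lipschitz (Ck_partial i k2) pM.
apply: (@conv_is_derive u k (delta_mx 0 i) x (L * `|delta_mx 0 i : 'rV[R]_n|) C C') => //.
  by move=> y; exact: Ck_derivable k2 _.
move=> y t; apply: le_trans (pL _ _) _.
by rewrite addrAC subrr add0r normrZ mulrCA mulrC mulrAC.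
Qed.

Lemma conv_continuous u k M : intg u -> Ck 1 setT k -> off_ball 0 M k -> continuous (conv u k).
Proof.
move=> iu k1 kM; have ck : continuous k by move=> y; exact: Ck_cts k1 _.
have [C C0 kC] := cts_off_ball_bounded ck kM.
have [L L0 kL] := Ck_lipschitz k1 kM.
apply: lipschitz_continuous => y z; apply: conv_lipschitz iu _ kC kL _ _.
exact: continuous_rV_measurable_fun.
Qed.

Lemma Ck_conv u k M : intg u -> Ck 2 setT k -> off_ball 0 M k -> Ck 1 setT (conv u k).
Proof.
move=> iu k2 kM.
have cc : continuous (conv u k) by apply: conv_continuous iu (Ck_le k2) kM.
split => [x _|i]; first exact: cc.
split => [x _|]; first by have [] := conv_partial i x iu k2 kM.
have -> : partial i (conv u k) = fun x => - conv u (partial i k) x.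
  by apply/funext => x; rewrite /partial; have [_ ->] := conv_partial i x iu k2 kM.
split; last by [].
move=> x _; rewrite (_ : (fun x => _) = (fun x => 0 - conv u (partial i k) x)); last by apply/funext => y; rewrite sub0r.
apply: ctsB; first exact: cts_cst.
exact: (conv_continuous iu (Ck_partial i k2) (partial_off_ball i ltr01 kM)).
Qed.

End convolution.

(** * L^p bounds for functions dominated by averages over small balls *)

Section average.
Context {R : realType} {n : nat} (p : R) (p1 : 1 <= p).
Local Notation leb := (@lebesgue_rV R n).
Implicit Types (u T : 'rV[R]_n -> R) (x z : 'rV[R]_n).
Let p0 : 0 < p. Proof. exact: lt_le_trans p1. Qed.
Let pn0 : p != 0. Proof. exact: lt0r_neq0. Qed.

(** For [w > s] the factor [(w / s)^(p-1)] exceeds 1. Integrated in [w] and optimised in [s], this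
    plays the role of the Hölder inequality on a set of finite measure. *)
Lemma le_split_powR (s w : R) : 0 < s -> 0 <= w -> w <= s + s `^ (1 - p) * w `^ p.
Proof.
move=> s0 w0; have [ws|sw] := leP w s.
  by rewrite (le_trans ws)// lerDl mulr_ge0// powR_ge0.
have w1 : 0 < w by exact: lt_trans sw.
rewrite -[leLHS]add0r lerD ?(ltW s0)//.
have -> : w `^ p = w * w `^ (p - 1).
  rewrite -{2}(powRr1 w0) -powRD; first by congr (_ `^ _); ring.
  by rewrite (gt_eqF w1) implybT.
rewrite mulrCA ler_pMr// -opprB powRN.
by rewrite mulrC ler_pdivlMr ?powR_gt0// mul1r ge0_ler_powR ?nnegrE ?subr_ge0 ?(ltW sw) ?(ltW s0).
Qed.

(* the optimal s is (I / m)^(1/p) *)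
Lemma powR_le_of_split (t m I : R) : 0 < m -> 0 <= I -> 0 <= t ->
  (forall s, 0 < s -> t <= s * m + s `^ (1 - p) * I) -> t `^ p <= (2 * m) `^ p * (I / m).
Proof.
move=> m0 I0 t0 H.
have [I1|] := ltP 0 I; last first.
  move=> I1; have -> : I = 0 by apply/eqP; rewrite eq_le I0 I1.
  suff -> : t = 0 by rewrite powR0// mulr_ge0 ?powR_ge0// mul0r.
  apply/eqP; rewrite eq_le t0 andbT; apply/ler_addgt0Pr => e e0; rewrite add0r.
  have := H (e / m) (divr_gt0 e0 m0); rewrite divfK ?gt_eqF//.
  have -> : I = 0 by apply/eqP; rewrite eq_le I0 I1.
  by rewrite mulr0 addr0.
have q0 : 0 < I / m by rewrite divr_gt0.
pose s := (I / m) `^ p^-1.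
have s0 : 0 < s by rewrite powR_gt0.
have sp : s `^ p = I / m by rewrite -powRrM mulVf// powRr1// ltW.
have := H s s0.
have -> : s `^ (1 - p) * I = s * m.
  have -> : s `^ (1 - p) = s / (I / m).
    by rewrite powRD ?(gt_eqF s0) ?implybT// powRr1 ?(ltW s0)// powRN sp.
  by field; rewrite !gt_eqF.
rewrite (_ : s * m + s * m = 2 * (s * m)); last by ring.
move=> ts.
apply: (@le_trans _ _ ((2 * (s * m)) `^ p)).
  by rewrite ge0_ler_powR ?nnegrE ?(ltW p0) ?mulr_ge0 ?(ltW s0) ?(ltW m0).
have -> : 2 * (s * m) = (2 * m) * s by ring.
by rewrite powRM ?mulr_ge0 ?(ltW s0) ?(ltW m0)// sp.
Qed.

(** Pointwise, the [p]-th power of the average is bounded by the average of [p]-th powers; Tonelli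
    then exchanges [x] and [z], and for each [z] the inner integral is at most [eta]. The factor
    [2 ^+ n] in [K] comes from the bound [(2 e)^n] on the measure of the ball. *)
Lemma average_le (C : R) : 0 < C -> exists2 K : R, 0 < K & forall u T (e eta : R), 0 < e ->
  measurable_fun setT u -> measurable_fun setT T ->
  (forall z, ball 0 e z -> (pint p (fun x => u (x + z) - u x)%R <= eta%:E)%E) ->
  (forall x, (`|T x|%:E <= (C / e ^+ n)%:E *
     \int[leb]_(z in ball (0 : 'rV[R]_n)%R e) (`|u (x + z) - u x|%R)%:E)%E) ->
  (pint p T <= (K * eta)%:E)%E.
Proof.
move=> C0; exists ((2 * (C * 2 ^+ n)) `^ p) => [|u T e eta e0 mu mT ueta TI].
  by rewrite powR_gt0// !mulr_gt0// exprn_gt0.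
set B := ball (0 : 'rV[R]_n) e.
have mB : measurable B by apply: measurable_rV_open; exact: ball_openT.
pose m : R := (2 * e) ^+ n.
have m0 : 0 < m by rewrite exprn_gt0// mulr_gt0.
have Bm : (leb B <= m%:E)%E by have [] := @lebesgue_rV_ball R n 0 e e0.
pose w x z := `|u (x + z) - u x|.
have mw : measurable_fun setT (fun q : 'rV[R]_n * 'rV[R]_n => u (q.1 + q.2) - u q.1).
  have mD : measurable_fun setT (fun q : 'rV[R]_n * 'rV[R]_n => q.1 + q.2).
    apply: measurable_fun_rV => i; under eq_fun do rewrite mxE.
    apply: measurable_funD; first exact: measurableT_comp (measurable_rV_coord i) measurable_fst.
    exact: measurableT_comp (measurable_rV_coord i) measurable_snd.
  by apply: measurable_funB; [exact: measurableT_comp|exact: measurableT_comp].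
have mwx x : measurable_fun setT (w x).
  apply: measurableT_comp => //; apply: measurable_funB => //.
  by rewrite (_ : (fun z => _) = fun z => u (z + x)); [exact: measurable_translate|apply/funext => z; rewrite addrC].
pose I x := (\int[leb]_(z in B) ((w x z `^ p)%R)%:E)%E.
have mwp x : measurable_fun setT (fun z => (w x z `^ p)%:E).
  apply/measurable_EFinP; apply: (measurableT_comp (f := fun t : R => t `^ p)); last exact: mwx.
  exact: measurable_powR.
have I0 x : (0 <= I x)%E by apply: integral_ge0 => z _; rewrite lee_fin powR_ge0.
have Tp x : (((`|T x| `^ p)%R)%:E <= ((2 * (C * 2 ^+ n)) `^ p / m)%:E * I x)%E.
  have [Ioo|] := ltP (I x) +oo%E; last first.
    rewrite leye_eq => /eqP ->; rewrite gt0_muley ?leey// lte_fin divr_gt0//.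
    by rewrite powR_gt0// !mulr_gt0// exprn_gt0.
  have IE : I x = (fine (I x))%:E by rewrite fineK// ge0_fin_numE.
  rewrite IE -EFinM lee_fin.
  have fI0 : 0 <= fine (I x) by rewrite fine_ge0.
  have D0 : 0 < C / e ^+ n by rewrite divr_gt0// exprn_gt0.
  have -> : (2 * (C * 2 ^+ n)) = 2 * ((C / e ^+ n) * m).
    rewrite /m exprMn; have : e ^+ n != 0 by rewrite expf_neq0// gt_eqF.
    by move: (e ^+ n) => E E0; field.
  move: (C / e ^+ n) D0 TI => D D0 TI.
  have Dm : (2 * (D * m)) `^ p / m * fine (I x) = (2 * (D * m)) `^ p * ((D * fine (I x)) / (D * m)).
    have : D != 0 by rewrite gt_eqF.
    have : m != 0 by rewrite gt_eqF.
    by move=> m1 D1; field; rewrite m1 D1.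
  rewrite Dm; apply: powR_le_of_split => //; [exact: mulr_gt0|by rewrite mulr_ge0// ltW|].
  move=> s s0; rewrite -lee_fin; apply: le_trans (TI x) _.
  have -> : s * (D * m) + s `^ (1 - p) * (D * fine (I x)) = D * (s * m + s `^ (1 - p) * fine (I x)) by ring.
  rewrite [leRHS]EFinM; apply: lee_wpmul2l; first by rewrite lee_fin ltW.
  rewrite EFinD !EFinM -IE.
  apply: (@le_trans _ _ (\int[leb]_(z in B) (s%:E + (s `^ (1 - p))%:E * (w x z `^ p)%:E))%E).
    apply: ge0_le_integral => //.
    - by apply/measurable_EFinP; apply: measurable_funTS; exact: mwx.
    - apply: measurable_funTS; apply: emeasurable_funD => //.
      by apply: measurable_funeM; exact: mwp.
    - by move=> z _; rewrite -EFinM -EFinD lee_fin le_split_powR.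
  rewrite ge0_integralD//.
  - rewrite integral_cst// ge0_integralZl//.
    + by apply: leeD => //; apply: lee_wpmul2l => //; rewrite lee_fin ltW.
    + by apply: measurable_funTS; exact: mwp.
    + by move=> z _; rewrite lee_fin powR_ge0.
    + by rewrite lee_fin powR_ge0.
  - by move=> z _; rewrite lee_fin ltW.
  - by move=> z _; rewrite -EFinM lee_fin mulr_ge0 ?powR_ge0.
  - by apply: measurable_funTS; apply: measurable_funeM; exact: mwp.
have mG : measurable_fun setT (fun q : 'rV[R]_n * 'rV[R]_n => ((w q.1 q.2 `^ p) * \1_B q.2)%:E).
  apply/measurable_EFinP; apply: measurable_funM.
    apply: (measurableT_comp (f := fun t : R => t `^ p)); first exact: measurable_powR.
    exact: measurableT_comp.
  by apply: (@measurableT_comp _ _ _ _ _ _ (\1_B : 'rV[R]_n -> R)).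
have G0 q : (0 <= ((w q.1 q.2 `^ p) * \1_B q.2)%:E)%E by rewrite lee_fin mulr_ge0 ?powR_ge0.
have IG x : I x = (\int[leb]_z ((w x z `^ p) * \1_B z)%:E)%E.
  rewrite /I integral_mkcond; apply: eq_integral => z _; rewrite patchE indicE.
  by case: ifPn => zB; rewrite ?zB ?(negbTE zB) ?mulr1 ?mulr0.
have FT : (\int[leb]_x I x <= (m * eta)%:E)%E.
  under eq_integral do rewrite IG.
  rewrite (@fubini_tonelli _ _ _ _ R leb leb _ mG G0).
  apply: (@le_trans _ _ (\int[leb]_(z in B) eta%:E)%E).
    rewrite [leRHS]integral_mkcond; apply: ge0_le_integral => //.
    - by move=> z _; apply: integral_ge0 => x _; exact: G0.
    - exact: (measurable_fun_fubini_tonelli_G (m1 := leb) _ mG G0).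
    - by apply/measurable_restrict => //; rewrite setIT.
    - move=> z _ /=; rewrite patchE indicE; case: ifPn => [zB|_].
        under eq_integral do rewrite mulr1.
        by rewrite inE in zB; have := ueta z zB; rewrite pint.unlock.
      by under eq_integral do rewrite mulr0; rewrite integral0.
  have eta0 : 0 <= eta.
    rewrite -lee_fin; apply: le_trans (ueta 0 _); first exact: pint_ge0.
    exact: ballxx.
  by rewrite integral_cst// [leRHS]EFinM muleC; apply: lee_wpmul2r; rewrite ?lee_fin.
have mI : measurable_fun setT I.
  rewrite (_ : I = fubini_F leb (fun q : 'rV[R]_n * 'rV[R]_n => ((w q.1 q.2 `^ p) * \1_B q.2)%:E)).
    exact: (measurable_fun_fubini_tonelli_F (m2 := leb) _ mG G0).
  by apply/funext => x; rewrite IG.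
rewrite pint.unlock.
apply: (@le_trans _ _ (\int[leb]_x (((2 * (C * 2 ^+ n)) `^ p / m)%:E * I x))%E).
  apply: ge0_le_integral => //.
  - exact: measurable_normp.
  - exact: measurable_funeM.
rewrite ge0_integralZl//; last by rewrite lee_fin divr_ge0 ?powR_ge0// ltW.
apply: (@le_trans _ _ (((2 * (C * 2 ^+ n)) `^ p / m)%:E * (m * eta)%:E)%E).
  by apply: lee_wpmul2l => //; rewrite lee_fin divr_ge0 ?powR_ge0// ltW.
by rewrite -EFinM lee_fin [leLHS]mulrA divfK// lt0r_neq0.
Qed.

End average.

(** * Mollification in L^p and cut-offs to compact sets *)

Section weak.
Context {R : realType} {n : nat}.
Local Notation leb := (@lebesgue_rV R n).
Local Notation intg f := (leb.-integrable setT (EFin \o f)).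
Implicit Types (u k f g w phi rho : 'rV[R]_n -> R) (x y z v : 'rV[R]_n) (A B K : set 'rV[R]_n).

Lemma measurable_ball x r : measurable (ball x r : set 'rV[R]_n).
Proof. by apply: measurable_rV_open; exact: ball_openT. Qed.

Lemma measurable_compact K : compact K -> measurable K.
Proof.
have hs : hausdorff_space 'rV[R]_n by exact: norm_hausdorff.
by move=> cK; exact: closed_rV_measurable (compact_closed hs cK).
Qed.

Lemma ball0B x y r : ball x r y <-> ball (0 : 'rV[R]_n) r (y - x).
Proof. by rewrite -!ball_normE /= sub0r normrN distrC. Qed.

Lemma derive_le w v (L : R) : 0 <= L -> (forall x t, `|w (x + t *: v) - w x| <= L * `|t|) ->
  forall x, `|'D_v w x| <= L.
Proof.
move=> L0 wL x; have [d|nd] := pselect (derivable w x v); first exact: derive_norm_le.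
have -> : 'D_v w x = 0; last by rewrite normr0.
by apply: (@dvgP R); exact: nd.
Qed.

Lemma lipschitz_dir w (L : R) i : (forall x y, `|w y - w x| <= L * `|y - x|) ->
  forall x (t : R), `|w (x + t *: delta_mx 0 i) - w x| <= L * `|delta_mx 0 i : 'rV[R]_n| * `|t|.
Proof.
move=> wL x t; apply: le_trans (wL _ _) _.
by rewrite addrAC subrr add0r normrZ mulrCA mulrC mulrAC.
Qed.

Lemma lipschitzP f A : [lipschitz f x | x in A] ->
  exists2 L : R, 0 < L & forall x y, A x -> A y -> `|f y - f x| <= L * `|y - x|.
Proof.
move=> [M [Mr H]]; exists (`|M| + 1) => [|x y Ax Ay]; first by rewrite ltr_wpDl.
have M1 : M < `|M| + 1 by rewrite ltr_pwDr// ler_norm.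
by have := H _ M1 (y, x); apply; split.
Qed.

(* phi lives on B, outside of which f is not controlled *)
Lemma mul_lipschitz B f phi (Lf Mf Lp Mp : R) : 0 <= Lf -> 0 <= Mf -> 0 <= Lp -> 0 <= Mp ->
  (forall x y, B x -> B y -> `|f y - f x| <= Lf * `|y - x|) -> (forall x, B x -> `|f x| <= Mf) ->
  (forall x y, `|phi y - phi x| <= Lp * `|y - x|) -> (forall x, `|phi x| <= Mp) ->
  (forall x, ~ B x -> phi x = 0) ->
  forall x y, `|f y * phi y - f x * phi x| <= (Lf * Mp + Mf * Lp) * `|y - x|.
Proof.
move=> Lf0 Mf0 Lp0 Mp0 fL fM pL pM p0 x y.
have H1 a b : B a -> ~ B b -> `|f a * phi a - f b * phi b| <= (Lf * Mp + Mf * Lp) * `|a - b|.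
  move=> Ba Bb; rewrite (p0 b Bb) mulr0 subr0 -[phi a]subr0 -(p0 b Bb) normrM mulrDl -mulrA.
  apply: ler_wpDl; first by rewrite !mulr_ge0.
  by rewrite -mulrA ler_pM ?fM.
have [Bx|Bx] := pselect (B x); have [By|By] := pselect (B y).
- have -> : f y * phi y - f x * phi x = (f y - f x) * phi y + f x * (phi y - phi x) by ring.
  apply: le_trans (ler_normD _ _) _; rewrite !normrM mulrDl lerD//.
    by rewrite mulrAC ler_pM// fL.
  by rewrite -mulrA ler_pM// fM.
- by rewrite distrC (distrC y); exact: H1.
- exact: H1.
- by rewrite !p0// !mulr0 subrr normr0 mulr_ge0// addr_ge0// mulr_ge0.
Qed.

Lemma integral_setT0 A f : measurable A -> (forall x, ~ A x -> f x = 0) ->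
  (\int[leb]_(x in A) (f x)%:E = \int[leb]_x (f x)%:E)%E.
Proof.
move=> mA f0; rewrite integral_mkcond; apply: eq_integral => x _.
by rewrite patchE; case: ifPn => // /negP xA; rewrite f0// => Ax; apply: xA; rewrite inE.
Qed.

(** Subtracting the constant [u x] under the integral leaves increments of [u] on the ball carrying
    [k]. It serves twice: for a mollifier, whose integral is 1, and for the commutator kernel, whose
    integral is 0. *)
Lemma kernel_le u k x (D e : R) : 0 <= D -> intg u -> measurable_fun setT k ->
  (forall y, `|k y| <= D) -> off_ball x e k ->
  ((`|\int[leb]_y (u y * k y) - u x * \int[leb]_y k y|%R)%:E <=
    D%:E * \int[leb]_(z in ball (0 : 'rV[R]_n)%R e) (`|u (x + z) - u x|%R)%:E)%E.
Proof.
move=> D0 iu mk kD k0.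
have mu : measurable_fun setT u by apply/measurable_EFinP; case/integrableP: iu.
have ik : intg k.
  apply: (@bounded_support_integrable _ _ k D (`|x| + e)) => // y ye; apply: k0 => xy; apply: ye.
  move: xy; rewrite -!ball_normE /= sub0r normrN => xy; rewrite -(subrKC x y).
  by apply: le_lt_trans (ler_normD _ _) _; rewrite ltrD2l distrC.
have iuk := integrableMb iu mk kD.
have iuxk : intg (fun y => u x * k y) by have := integrableZl measurableT (u x) ik.
rewrite -RintegralZl// -RintegralB//.
under eq_Rintegral do rewrite -mulrBl.
have id : intg (fun y => (u y - u x) * k y).
  rewrite (_ : EFin \o _ = fun y => ((u y * k y)%:E - (u x * k y)%R%:E)%E).
    exact: integrableB.
  by apply/funext => y; rewrite /= mulrBl EFinB.
apply: (@le_trans _ _ (\int[leb]_y (`|(u y - u x) * k y|%R)%:E)%E).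
  rewrite -[leRHS]fineK; last by apply: integrable_fin_num => //; exact: integrable_norm.
  by rewrite lee_fin; apply: le_normr_Rintegral.
have mB := measurable_ball (0 : 'rV[R]_n) e.
have md : measurable_fun setT (fun z => u (x + z) - u x).
  apply: measurable_funB => //.
  by rewrite (_ : (fun z => _) = fun z => u (z + x)); [exact: measurable_translate|apply/funext => z; rewrite addrC].
rewrite -(@ge0_integral_rV_translation _ _ x) /=; last 2 first.
- by apply/measurable_EFinP; apply: measurableT_comp => //; apply: measurable_funM => //; exact: measurable_funB.
- by move=> y; rewrite lee_fin.
rewrite -ge0_integralZl//; last by apply/measurable_EFinP; apply: measurable_funTS; exact: measurableT_comp.
rewrite [leRHS]integral_mkcond; apply: ge0_le_integral => //.
- apply/measurable_EFinP; apply: measurableT_comp => //; apply: measurable_funM.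
    by rewrite (_ : (fun z => _) = fun z => u (x + z) - u x)//; apply/funext => z; rewrite (addrC z).
  exact: measurable_translate.
- apply/(measurable_restrictT _ _).1 => //.
  by apply: measurable_funTS; apply: measurable_funeM; apply/measurable_EFinP; exact: measurableT_comp.
- move=> z _; rewrite patchE; case: ifPn => [_|/negP zB].
    by rewrite -EFinM lee_fin normrM mulrC addrC ler_wpM2r.
  rewrite k0 ?mulr0 ?normr0// => /ball0B; rewrite addrK => zB'.
  by apply: zB; rewrite inE.
Qed.

Lemma pint_eq0_ae p u : 1 <= p -> measurable_fun setT u -> (forall e : R, 0 < e -> (pint p u <= e%:E)%E) ->
  {ae leb, forall x, u x = 0}.
Proof.
move=> p1 mu H.
have I0 : (\int[leb]_x `| (`|u x| `^ p)%:E | = 0)%E.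
  apply/eqP; rewrite eq_le; apply/andP; split; last exact: integral_ge0.
  apply/lee_addgt0Pr => e e0; rewrite add0e.
  have := H e e0; rewrite pint.unlock; apply: le_trans.
  under eq_integral do rewrite gee0_abs ?lee_fin ?powR_ge0//.
  exact: lexx.
have mp := measurable_normp p mu.
have /(ae_eq_integral_abs leb measurableT mp) := I0.
apply: ae_mono => x /(_ Logic.I) [] /eqP; rewrite powR_eq0 normr_eq0.
by move=> /andP[/eqP].
Qed.

Lemma mollifier_off C e rho : is_mollifier C e rho -> off_ball 0 e rho.
Proof. by case. Qed.

Lemma mollifier_Ck C e rho y m : is_mollifier C e rho -> Ck m setT (fun x => rho (x - y)).
Proof. by case. Qed.

Lemma mollifier_Ck0 C e rho m : is_mollifier C e rho -> Ck m setT rho.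
Proof.
case=> /(_ 0 m) + _ _ _ _; congr Ck.
by apply/funext => x; rewrite subr0.
Qed.

Lemma mollifier_bound C e rho y : is_mollifier C e rho -> `|rho y| <= C / e ^+ n.
Proof. by case=> _ r0 _ _ [rC _]; rewrite ger0_norm. Qed.

Lemma mollifier_continuous C e rho : is_mollifier C e rho -> continuous rho.
Proof. by move=> mr y; exact: Ck_cts (mollifier_Ck0 0 mr) _. Qed.

Lemma mollifier_measurable C e rho : is_mollifier C e rho -> measurable_fun setT rho.
Proof. by move=> /mollifier_continuous; exact: continuous_rV_measurable_fun. Qed.

Lemma mollify_le C e rho u x : is_mollifier C e rho -> intg u ->
  ((`|conv u rho x - u x|%R)%:E <=
    (C / e ^+ n)%:E * \int[leb]_(z in ball (0 : 'rV[R]_n)%R e) (`|u (x + z) - u x|%R)%:E)%E.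
Proof.
move=> mr iu; have mm := mollifier_measurable mr.
have D0 : 0 <= C / e ^+ n by apply: le_trans (mollifier_bound 0 mr); exact: normr_ge0.
have := @kernel_le u (fun y => rho (y - x)) x _ e D0 iu (measurable_shift x mm)
  (fun y => mollifier_bound _ mr).
rewrite (_ : (\int[leb]_y rho (y - x)) = 1) ?mulr1.
  by apply=> y /ball0B yx; exact: mollifier_off mr _ _.
have [_ _ _ r1 _] := mr.
rewrite /Rintegral (@integral_rV_translation _ _ (- x) (EFin \o rho)).
  by rewrite r1.
exact/measurable_EFinP.
Qed.

Lemma mollify_cvg p u (C : R) : 1 <= p -> intg u -> (pint p u < +oo)%E -> 0 < C ->
  forall eta : R, 0 < eta -> exists2 d : R, 0 < d & forall e rho, 0 < e -> e < d ->
  is_mollifier C e rho -> (pint p (fun x => conv u rho x - u x)%R <= eta%:E)%E.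
Proof.
move=> p1 iu pu C0 eta eta0.
have mu : measurable_fun setT u by apply/measurable_EFinP; case/integrableP: iu.
have [K K0 HK] := @average_le R n p p1 C C0.
have [d d0 Hd] := Lp_translation p1 mu pu (divr_gt0 eta0 K0).
exists d => // e rho e0 ed mr.
have := HK u (fun x => conv u rho x - u x) e (eta / K) e0 mu.
rewrite [K * _]mulrC divfK ?gt_eqF//; apply.
- apply: measurable_funB => //; apply: continuous_rV_measurable_fun.
  exact: conv_continuous iu (mollifier_Ck0 1 mr) (mollifier_off mr).
- by move=> z; rewrite -ball_normE /= sub0r normrN => ze; apply: Hd; exact: lt_trans ed.
- by move=> x; exact: mollify_le.
Qed.

Lemma off_ball0 x (M : R) f : off_ball x M f -> off_ball 0 (`|x| + M) f.
Proof.
move=> fM y yM; apply: fM => xy; apply: yM.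
move: xy; rewrite -!ball_normE /= sub0r normrN => xy; rewrite -(subrKC x y).
by apply: le_lt_trans (ler_normD _ _) _; rewrite ltrD2l distrC.
Qed.

Lemma delta_norm_le i : `|delta_mx 0 i : 'rV[R]_n| <= 1.
Proof.
apply/ler_addgt0Pr => e e0.
have : ball 0 (1 + e) (delta_mx 0 i : 'rV[R]_n).
  split=> [|a j]; first by rewrite addr_gt0.
  rewrite /ball/= !mxE sub0r normrN; apply: (@le_lt_trans _ _ 1); last by rewrite ltrDl.
  by case: (_ && _); rewrite ?normr1 ?normr0.
by rewrite -ball_normE /= sub0r normrN => /ltW.
Qed.

Lemma supp_near0 phi x : ~ closure [set x | phi x != 0] x ->
  exists2 r : R, 0 < r & forall y, ball x r y -> phi y = 0.
Proof.
move=> xS; have : nbhs x (~` closure [set x | phi x != 0]).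
  by apply: open_nbhs_nbhs; split => //; rewrite openC; exact: closed_closure.
move=> /nbhs_ballP[r r0 H]; exists r => // y /H yS; apply/eqP; apply: contrapT => /negP y0.
by apply: yS; exact: subset_closure.
Qed.

Lemma supp0 phi x : ~ closure [set x | phi x != 0] x -> phi x = 0.
Proof. by move=> /supp_near0[r r0]; apply; exact: ballxx. Qed.

Lemma L1loc_intg A K g : open A -> L1loc A g -> compact K -> K `<=` A -> intg (g \_ K).
Proof.
move=> /measurable_rV_open mA [mg gK] cK KA; have mK := measurable_compact cK.
rewrite -restrict_EFin -integrable_mkcond//; apply/integrableP; split; last exact: gK.
by apply/measurable_EFinP; exact: measurable_funS mg.
Qed.

Lemma cts_compact_bounded K f : compact K -> (forall x, K x -> {for x, continuous f}) ->
  exists2 C : R, 0 < C & forall x, K x -> `|f x| <= C.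
Proof.
move=> cK fc; have [->|/set0P K0] := eqVneq K set0; first by exists 1.
have cf : {within K, continuous (fun x => `|f x|)}.
  apply: continuous_in_subspaceT => x; rewrite inE => /fc; exact: cts_norm.
have [z _ zM] := compact_EVT_max K0 cK cf.
exists (`|f z| + 1) => [|x Kx]; first by rewrite ltr_wpDl.
by rewrite ler_wpDr// zM// inE.
Qed.

Lemma patch_mul K g phi : (forall x, ~ K x -> phi x = 0) ->
  (fun x => (g \_ K) x * phi x) = (fun x => g x * phi x).
Proof.
move=> p0; apply/funext => x; rewrite patchE; case: ifPn => // /negP xK.
by rewrite p0 ?mulr0// => Kx; apply: xK; rewrite inE.
Qed.

End weak.

(** * The Euclidean norm and its powers *)

Section eucl_norm.
Context {R : realType} {m : nat}.
Implicit Types (x y : 'rV[R]_m).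

Lemma eucl_ge0 x : 0 <= eucl_norm x.
Proof. exact: sqrtr_ge0. Qed.

Lemma eucl_normZ (k : R) x : eucl_norm (k *: x) = `|k| * eucl_norm x.
Proof.
rewrite /eucl_norm -sqrtr_sqr -sqrtrM ?sqr_ge0// mulr_sumr; congr Num.sqrt.
by apply: eq_bigr => i _; rewrite mxE exprMn.
Qed.

Lemma cauchy_schwarz (I : finType) (f g : I -> R) :
  (\sum_i f i * g i) ^+ 2 <= (\sum_i f i ^+ 2) * (\sum_i g i ^+ 2).
Proof.
set A := \sum_i f i ^+ 2; set B := \sum_i g i ^+ 2; set C := \sum_i f i * g i.
have B0 : 0 <= B by apply: sumr_ge0 => i _; exact: sqr_ge0.
have [Bz|Bn] := eqVneq B 0.
  have gz (i : I) : g i = 0.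
    have /eqP := Bz; rewrite psumr_eq0 => [/allP/(_ i (mem_index_enum i))|j _]; last exact: sqr_ge0.
    by rewrite sqrf_eq0 => /eqP.
  by rewrite /C big1 ?expr0n ?Bz ?mulr0//= => i _; rewrite gz mulr0.
have : 0 <= \sum_i (B * f i - C * g i) ^+ 2 by apply: sumr_ge0 => i _; exact: sqr_ge0.
have -> : \sum_i (B * f i - C * g i) ^+ 2 = B * (A * B - C ^+ 2).
  rewrite (eq_bigr (fun i => B ^+ 2 * f i ^+ 2 - 2 * B * C * (f i * g i) + C ^+ 2 * g i ^+ 2)); last by move=> i _; ring.
  by rewrite big_split sumrB /= -!mulr_sumr -/A -/B -/C; ring.
by rewrite pmulr_rge0 ?lt_def ?Bn// subr_ge0.
Qed.

Lemma eucl_triangle x y : eucl_norm (x + y) <= eucl_norm x + eucl_norm y.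
Proof.
rewrite -[leRHS]ger0_norm ?addr_ge0 ?eucl_ge0// -sqrtr_sqr ler_wsqrtr//.
have E (z : 'rV[R]_m) : eucl_norm z ^+ 2 = \sum_i z 0 i ^+ 2.
  by rewrite sqr_sqrtr// sumr_ge0// => i _; exact: sqr_ge0.
rewrite sqrrD !E.
rewrite (eq_bigr (fun i => x 0 i ^+ 2 + (x 0 i * y 0 i) *+ 2 + y 0 i ^+ 2)); last first.
  by move=> i _; rewrite mxE sqrrD.
rewrite !big_split /= lerD2r lerD2l -mulr2n ler_wMn2r//.
apply: le_trans (ler_norm _) _; rewrite -sqrtrM ?sumr_ge0// => [|i _]; last exact: sqr_ge0.
by rewrite -sqrtr_sqr ler_wsqrtr// cauchy_schwarz.
Qed.

Lemma eucl_le_sum x : eucl_norm x <= \sum_i `|x 0 i|.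
Proof.
rewrite -[leRHS]ger0_norm ?sumr_ge0// -sqrtr_sqr ler_wsqrtr// expr2 mulr_suml ler_sum// => i _.
rewrite -real_normK ?num_real// expr2 ler_wpM2l// (bigD1 i)//= lerDl.
by apply: sumr_ge0.
Qed.

Lemma eucl_powR_le (p : R) x : 0 < p -> (0 < m)%N ->
  eucl_norm x `^ p <= m%:R `^ p * \sum_i `|x 0 i| `^ p.
Proof.
move=> p0 m0; pose i0 := Ordinal m0.
have [j _ xj] := @arg_maxP _ R 'I_m i0 predT (fun i => `|x 0 i|) isT.
apply: (@le_trans _ _ ((m%:R * `|x 0 j|) `^ p)).
  apply: ge0_ler_powR; rewrite ?nnegrE ?(ltW p0) ?eucl_ge0 ?mulr_ge0//.
  apply: le_trans (eucl_le_sum x) _; rewrite mulr_natl -[X in _ *+ X]card_ord -sumr_const.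
  by apply: ler_sum => i _; exact: xj.
rewrite powRM// ler_wpM2l ?powR_ge0// (bigD1 j)//= lerDl.
by apply: sumr_ge0 => i _; exact: powR_ge0.
Qed.

Lemma measurable_eucl d (S : measurableType d) (A : set S) (G : S -> 'rV[R]_m) :
  (forall j, measurable_fun A (fun z => G z 0 j)) -> measurable_fun A (fun z => eucl_norm (G z)).
Proof.
move=> mG; apply: (measurableT_comp (f := @Num.sqrt R)).
  by apply: continuous_measurable_fun; exact: sqrt_continuous.
by apply: measurable_sum => j; exact: measurable_funX.
Qed.

End eucl_norm.

(** * The C^1 staircase *)

Section staircase.
Context {R : realType}.

Definition ramp (t : R) : R := Num.max t 0.

Lemma rampE (t : R) : (0 <= t -> ramp t = t) /\ (t <= 0 -> ramp t = 0).
Proof. by split=> t0; rewrite /ramp; [exact/max_idPl|exact/max_idPr]. Qed.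

Lemma ramp_pos (t : R) : 0 <= t -> ramp t = t. Proof. exact: (rampE t).1. Qed.
Lemma ramp_neg (t : R) : t <= 0 -> ramp t = 0. Proof. exact: (rampE t).2. Qed.

Lemma ramp_continuous : continuous ramp.
Proof. by move=> t; apply: continuous_max; [exact: cvg_id|exact: cvg_cst]. Qed.

Lemma is_derive_ramp (t : R) : is_derive t 1 (fun s : R => s * ramp s / 2) (ramp t).
Proof.
have near_nbhs (d : R) : 0 < d -> forall P : R -> Prop, (forall s, `|t - s| < d -> P s) -> \near t, P t.
  by move=> d0 P H; apply/nbhs_ballP; exists d => // s; exact: H.
have [t0|t0|->] := ltgtP t 0.
- rewrite ramp_neg ?(ltW t0)//.
  have E : \near t, (fun=> 0) t = t * ramp t / 2.
    apply: (near_nbhs (- t)); first by rewrite oppr_gt0.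
    move=> s ts; rewrite ramp_neg ?mulr0 ?mul0r//.
    have := ler_norm (s - t); rewrite distrC; lra.
  by apply: (near_eq_is_derive E); exact: is_derive_cst.
- rewrite ramp_pos ?(ltW t0)//.
  have E : \near t, (fun s : R => s * s / 2) t = t * ramp t / 2.
    apply: (near_nbhs t) => // s ts; rewrite ramp_pos//.
    have := ler_norm (t - s); lra.
  apply: (near_eq_is_derive E).
  have c1 : is_derive t (1 : R) (fun s : R => s) 1 by exact: is_derive_id.
  have c2 : is_derive t (1 : R) (fun=> 2^-1 : R) 0 by exact: is_derive_cst.
  by apply: is_derive_eq (dR_M (dR_M c1 c1) c2) _; field.
- rewrite ramp_neg//; apply: (@quadratic_is_derive0 _ _ _ 1) => // s.
  rewrite mul0r mul0r !subr0 mul1r !normrM -mulrA expr2 ler_wpM2l//.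
  have r : `|ramp s| <= `|s|.
    have [s0|s0] := leP 0 s; first by rewrite ramp_pos.
    by rewrite ramp_neg ?normr0 // ltW.
  have -> : `|2^-1 : R| = 2^-1 by rewrite ger0_norm.
  have := normr_ge0 (ramp s); lra.
Qed.

(* a C^1 step of height l and slope 1, rising on [0, l + 1] *)
Definition block (l t : R) : R := t * ramp t / 2 - (t - 1) * ramp (t - 1) / 2
  - (t - l) * ramp (t - l) / 2 + (t - l - 1) * ramp (t - l - 1) / 2.
Definition dblock (l t : R) : R := ramp t - ramp (t - 1) - ramp (t - l) + ramp (t - l - 1).

Lemma block_le0 (l t : R) : 1 <= l -> t <= 0 -> block l t = 0 /\ dblock l t = 0.
Proof. by move=> l1 t0; rewrite /block /dblock !ramp_neg; [split; ring|lra..]. Qed.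

Lemma block_mid (l t : R) : 1 <= t -> t <= l -> block l t = t - 2^-1 /\ dblock l t = 1.
Proof.
move=> t1 tl; rewrite /block /dblock (@ramp_pos t) ?(@ramp_pos (t - 1)) ?(@ramp_neg (t - l)) ?(@ramp_neg (t - l - 1)); [|lra..].
by split; field.
Qed.

Lemma block_ge (l t : R) : 1 <= l -> l + 1 <= t -> block l t = l /\ dblock l t = 0.
Proof.
move=> l1 tl; rewrite /block /dblock !ramp_pos; [|lra..].
by split; field.
Qed.

Lemma block_bound (l t : R) : 1 <= l -> 0 <= block l t <= l /\ 0 <= dblock l t <= 1.
Proof.
move=> l1; have [t0|t0] := leP t 0.
  by have [-> ->] := block_le0 l1 t0; lra.
have [t1|t1] := leP t 1.
  rewrite /block /dblock (@ramp_pos t) ?(@ramp_neg (t - 1)) ?(@ramp_neg (t - l)) ?(@ramp_neg (t - l - 1)); [|lra..].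
  by split; nra.
have [tl|tl] := leP t l.
  by have [-> ->] := block_mid (ltW t1) tl; lra.
have [tl1|tl1] := leP (l + 1) t.
  by have [-> ->] := block_ge l1 tl1; lra.
rewrite /block /dblock (@ramp_pos t) ?(@ramp_pos (t - 1)) ?(@ramp_pos (t - l)) ?(@ramp_neg (t - l - 1)); [|lra..].
by split; nra.
Qed.

(** [J] steps of height [l], one per period of length [N]; the mean slope is [l / N]. *)
Definition stair (l N : R) (J : nat) (t : R) := \sum_(i < J) block l (t - i%:R * N).
Definition dstair (l N : R) (J : nat) (t : R) := \sum_(i < J) dblock l (t - i%:R * N).

Lemma stair_full (l N : R) J t : 1 <= l -> l + 1 <= N -> J%:R * N <= t -> stair l N J t = J%:R * l /\ dstair l N J t = 0.
Proof.
move=> l1 lN; have N0 : 0 <= N by lra.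
elim: J => [|J IH] Jt; first by rewrite /stair /dstair !big_ord0 mul0r.
have Jt' : J%:R * N + N <= t by move: Jt; rewrite -addn1 natrD; lra.
have [E1 E2] := IH (ltac:(lra)).
rewrite /stair /dstair !big_ord_recr/= -/(stair l N J t) -/(dstair l N J t) E1 E2.
have [-> ->] := @block_ge l (t - J%:R * N) l1 ltac:(lra).
by split; rewrite ?addr0// -[in RHS]addn1 natrD mulrDl mul1r.
Qed.

(** In period [i] the earlier steps are complete and contribute [i * l], while the later ones have
    not begun. *)
Lemma stair_cell (l N : R) J (i : nat) t : 1 <= l -> l + 1 <= N -> (i < J)%N -> i%:R * N <= t -> t <= i.+1%:R * N ->
  stair l N J t = i%:R * l + block l (t - i%:R * N) /\ dstair l N J t = dblock l (t - i%:R * N).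
Proof.
move=> l1 lN; have N0 : 0 <= N by lra.
elim: J => [|J IH] // iJ it ti.
rewrite /stair /dstair !big_ord_recr/= -/(stair l N J t) -/(dstair l N J t).
move: iJ; rewrite ltnS leq_eqVlt => /orP[/eqP E|iJ].
  have [-> ->] := @stair_full l N J t l1 lN ltac:(by rewrite -E).
  by rewrite -E add0r.
have [-> ->] := IH iJ it ti.
have [|-> ->] := @block_le0 l (t - J%:R * N) l1; last by rewrite !addr0.
rewrite subr_le0 (le_trans ti)// ler_wpM2r// ler_nat.
by [].
Qed.

Lemma cell_ex (N : R) J t : 0 < N -> 0 <= t -> t < J%:R * N ->
  exists2 i : nat, (i < J)%N & i%:R * N <= t < i.+1%:R * N.
Proof.
move=> N0 t0 tJ; exists (Num.truncn (t / N)).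
  have h := @truncn_le R (t / N); rewrite divr_ge0 ?(ltW N0)// in h.
  rewrite -(ltr_nat R); apply: le_lt_trans h _; by rewrite ltr_pdivrMr.
have h := @truncn_le R (t / N); rewrite divr_ge0 ?(ltW N0)// in h.
by rewrite -ler_pdivlMr// h/= -ltr_pdivrMr// truncnS_gt.
Qed.

(** Staircase and line of slope [l / N] meet at the ends of each period and both rise by [l] over
    it, so they differ by at most [l] in between. *)
Lemma stair_near (l N : R) J t : 1 <= l -> l + 1 <= N -> 0 <= t -> t < J%:R * N ->
  `|stair l N J t - l / N * t| <= N /\ 0 <= dstair l N J t <= 1.
Proof.
move=> l1 lN t0 tJ; have N0 : 0 < N by lra.
have [i iJ /andP[it ti]] := cell_ex N0 t0 tJ.
have [-> ->] := stair_cell l1 lN iJ it (ltW ti).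
have [/andP[B0 Bl] D01] := block_bound (t - i%:R * N) l1; split => //.
have z0 : 0 <= t - i%:R * N by rewrite subr_ge0.
have zN : t - i%:R * N <= N by move: ti; rewrite -addn1 natrD; lra.
have -> : i%:R * l + block l (t - i%:R * N) - l / N * t = block l (t - i%:R * N) - l * ((t - i%:R * N) / N).
  by field; rewrite gt_eqF.
have y0 : 0 <= (t - i%:R * N) / N by rewrite divr_ge0 ?(ltW N0).
have y1 : (t - i%:R * N) / N <= 1 by rewrite ler_pdivrMr// mul1r.
move: ((t - i%:R * N) / N) y0 y1 => y y0 y1.
have ly : 0 <= l * y <= l by apply/andP; split; nra.
by rewrite ler_norml; lra.
Qed.

Lemma is_derive_stair (l N : R) J (t : R) : is_derive t 1 (stair l N J) (dstair l N J t).
Proof.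
elim: J => [|J IH].
  rewrite /dstair big_ord0 (_ : stair l N 0 = fun=> 0); first exact: is_derive_cst.
  by apply/funext => s; rewrite /stair big_ord0.
have -> : stair l N J.+1 = fun s => stair l N J s + block l (s - J%:R * N).
  by apply/funext => s; rewrite /stair big_ord_recr.
rewrite /dstair big_ord_recr/= -/(dstair l N J t); apply: (dR_D IH).
have shift (d s : R) : is_derive s (1 : R) (fun s : R => s - d) 1.
  have c1 : is_derive s (1 : R) (fun s : R => s) 1 by exact: is_derive_id.
  have c2 : is_derive s (1 : R) (fun=> d) 0 by exact: is_derive_cst.
  by apply: is_derive_eq (dR_B c1 c2) _; rewrite subr0.
have db (s : R) : is_derive s 1 (block l) (dblock l s).
  have c (d : R) : is_derive s (1 : R) (fun s : R => (s - d) * ramp (s - d) / 2) (ramp (s - d)).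
    have := @is_derive1_comp R (fun s : R => s * ramp s / 2) (fun s : R => s - d) s _ _ (is_derive_ramp _) (shift d s).
    by rewrite mulr1.
  have := dR_D (dR_B (dR_B (c 0) (c 1)) (c l)) (c (l + 1)).
  rewrite /dblock subr0 opprD addrA; congr is_derive.
  by apply/funext => z; rewrite /block subr0 addrA.
have := @is_derive1_comp R (block l) (fun s : R => s - J%:R * N) t _ _ (db _) (shift _ t).
by rewrite mulr1.
Qed.

Lemma dstair_continuous (l N : R) J : continuous (dstair l N J).
Proof.
elim: J => [|J IH] t.
  rewrite (_ : dstair l N 0 = fun=> 0); first exact: cvg_cst.
  by apply/funext => s; rewrite /dstair big_ord0.
rewrite (_ : dstair l N J.+1 = fun s => dstair l N J s + dblock l (s - J%:R * N)); last first.
  by apply/funext => s; rewrite /dstair big_ord_recr.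
have c (d z : R) : {for z, continuous (fun s : R => ramp (s - d))}.
  apply: (@continuous_comp _ _ _ (fun s : R => s - d) ramp); last exact: ramp_continuous.
  by apply: cvgB; [exact: cvg_id|exact: cvg_cst].
have dc (z : R) : {for z, continuous (dblock l)}.
  rewrite (_ : dblock l = fun s => ramp (s - 0) - ramp (s - 1) - ramp (s - l) + ramp (s - (l + 1))).
    by apply: cvgD; [apply: cvgB; [apply: cvgB|]|]; exact: c.
  by apply/funext => s; rewrite /dblock subr0 opprD addrA.
apply: cvgD; first exact: IH.
apply: (@continuous_comp _ _ _ (fun s : R => s - J%:R * N) (dblock l)); last exact: dc.
by apply: cvgB; [exact: cvg_id|exact: cvg_cst].
Qed.

(* the integers k below M with al < t - k < be *)
Lemma count_itv (al be t : R) (M : nat) : al <= be ->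
  \sum_(k < M) (al < t - k%:R < be)%R%:R <= be - al + 1 :> R.
Proof.
move=> ab.
(* Only [be] is used here: the integers counted exceed [t - be]. The bound [al] enters afterwards,
   at the largest integer counted, which lies below [t - al]. *)
have P N : \sum_(k < N) (al < t - k%:R < be)%R%:R <= Num.max 0 (N%:R - (t - be)) :> R.
  elim: N => [|N IH]; first by rewrite big_ord0 le_max lexx.
  rewrite big_ord_recr/= -addn1 natrD; move: IH.
  rewrite /Num.max /Order.max; do 2 case: ifP => ?; case: (boolP (al < t - N%:R < be)) => [/andP[? ?]|_] /=; lra.
elim: M => [|M IH]; first by rewrite big_ord0; lra.
have [/andP[k1 k2]|kn] := boolP (al < t - M%:R < be).
  apply: le_trans (P M.+1) _; rewrite -addn1 natrD /Num.max /Order.max; case: ifP => ?; lra.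
by rewrite big_ord_recr/= (negbTE kn) addr0.
Qed.

End staircase.

(** * Measures with a density *)

Section densities.
Context {R : realType} {n : nat}.
Local Notation leb := (@lebesgue_rV R n).
Implicit Types (O E U : set 'rV[R]_n) (g h : 'rV[R]_n -> R).
Local Open Scope ereal_scope.

Definition with_density h of measurable_fun setT h & (forall x, (0 <= h x)%R) : set 'rV[R]_n -> \bar R :=
  fun E => \int[leb]_(x in E) (h x)%:E.

Section with_density_measure.
Context h (mh : measurable_fun setT h) (h0 : forall x, (0 <= h x)%R).

Let d0 : with_density mh h0 set0 = 0. Proof. exact: integral_set0. Qed.

Let d_ge0 E : 0 <= with_density mh h0 E.
Proof. by apply: integral_ge0 => x _; rewrite lee_fin. Qed.

Let d_sigma : semi_sigma_additive (with_density mh h0).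
Proof.
move=> E mE tE mUE; rewrite /with_density ge0_integral_bigcup//.
- by apply: is_cvg_nneseries => k _ _; exact: d_ge0.
- by apply/measurable_EFinP; exact: measurable_funTS.
- by move=> x _; rewrite lee_fin.
Qed.

HB.instance Definition _ := isMeasure.Build _ _ _ (with_density mh h0) d0 d_ge0 d_sigma.

End with_density_measure.

Lemma le_open_measurable (mu nu : {measure set 'rV[R]_n -> \bar R}) O : open O ->
  nu O < +oo -> (forall U, open U -> U `<=` O -> mu U <= nu U) ->
  forall E, measurable E -> E `<=` O -> mu E <= nu E.
Proof.
move=> oO nuO H E mE EO; have mO := measurable_rV_open oO.
have muO : mu O < +oo by apply: le_lt_trans nuO; exact: H.
have rE (m : {measure set 'rV[R]_n -> \bar R}) (moo : m O < +oo) A : A `<=` O -> mfrestr mO moo A = m A.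
  by move=> AO; rewrite /mfrestr /mrestr setIidl.
rewrite -(rE mu muO E EO) -(rE nu nuO E EO).
apply: (@le_measure_openP R n (mfrestr mO muO) (mfrestr mO nuO) O) => // U oU UO.
by rewrite [leLHS](rE mu)// [leRHS](rE nu)//; exact: H.
Qed.

Lemma patch_density O h : open O -> measurable_fun O h -> (forall x, O x -> (0 <= h x)%R) ->
  [/\ measurable_fun setT (h \_ O), forall x, (0 <= (h \_ O) x)%R &
      forall E, E `<=` O -> \int[leb]_(x in E) ((h \_ O) x)%:E = \int[leb]_(x in E) (h x)%:E].
Proof.
move=> oO mh h0; have mO := measurable_rV_open oO; split.
- by apply/(measurable_restrictT _ _).1.
- by move=> x; rewrite patchE; case: ifPn => // /set_mem/h0.
- by move=> E EO; apply: eq_integral => x /set_mem/EO Ox; rewrite patchE mem_set.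
Qed.

(** The comparison passes from open to Borel sets and is then tested on the bad set [E] where
    [h < g]: the positive function [g - h] has integral 0 there. Finiteness of the integral of [h]
    permits the subtraction. *)
Lemma ae_le_open O g h : open O -> measurable_fun O g -> measurable_fun O h ->
  (forall x, O x -> (0 <= g x)%R) -> (forall x, O x -> (0 <= h x)%R) ->
  \int[leb]_(x in O) (h x)%:E < +oo ->
  (forall U, open U -> U `<=` O -> \int[leb]_(x in U) (g x)%:E <= \int[leb]_(x in U) (h x)%:E) ->
  {ae leb, forall x, O x -> (g x <= h x)%R}.
Proof.
move=> oO mg mh g0 h0 hoo H; have mO := measurable_rV_open oO.
have [mg' g0' gE] := patch_density oO mg g0.
have [mh' h0' hE] := patch_density oO mh h0.
have {}H : forall E, measurable E -> E `<=` O -> \int[leb]_(x in E) (g x)%:E <= \int[leb]_(x in E) (h x)%:E.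
  move=> E mE EO.
  rewrite -gE// -hE//; apply: (@le_open_measurable (with_density mg' g0') (with_density mh' h0') O) => //.
    by rewrite [ltLHS]hE.
  by move=> U oU UO; rewrite [leLHS]gE// [leRHS]hE// H.
pose E := O `&` [set x | (h x < g x)%R].
have mE : measurable E.
  have mt : measurable [set true] by [].
  have := measurable_fun_ltr mh mg mO mt.
  by congr measurable; apply/seteqP; split => x [Ox] /= hx; split.
have EO : E `<=` O by move=> x [].
have mgE : measurable_fun E g by exact: measurable_funS mg.
have mhE : measurable_fun E h by exact: measurable_funS mh.
have hEoo : \int[leb]_(x in E) (h x)%:E < +oo.
  by apply: le_lt_trans hoo; apply: ge0_subset_integral => //; first [exact/measurable_EFinP|by move=> x /h0; rewrite lee_fin].
have S : \int[leb]_(x in E) (g x)%:E = \int[leb]_(x in E) (g x - h x)%:E + \int[leb]_(x in E) (h x)%:E.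
  rewrite -ge0_integralD//; first by apply: eq_integral => x _; rewrite -EFinD subrK.
  - by move=> x [_ /ltW] /= hg; rewrite lee_fin subr_ge0.
  - by apply/measurable_EFinP; exact: measurable_funB.
  - by move=> x /EO/h0; rewrite lee_fin.
  - exact/measurable_EFinP.
have I0 : \int[leb]_(x in E) (g x - h x)%:E = 0.
  apply/eqP; rewrite eq_le; apply/andP; split; last first.
    by apply: integral_ge0 => x [_ /ltW] /= hg; rewrite lee_fin subr_ge0.
  have := H E mE EO; rewrite S.
  have h0I : 0 <= \int[leb]_(x in E) (h x)%:E by apply: integral_ge0 => x /EO/h0; rewrite lee_fin.
  have hfin : \int[leb]_(x in E) (h x)%:E \is a fin_num by rewrite ge0_fin_numE.
  by rewrite -leeBrDr// subee.
have [+ _] := @ae_eq_integral_abs _ _ _ leb E mE (fun x => (g x - h x)%:E)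
  ((measurable_EFinP _ _).2 (measurable_funB mgE mhE)).
have -> : \int[leb]_(x in E) `|(g x - h x)%:E| = 0.
  rewrite -[RHS]I0; apply: eq_integral => x /set_mem [_ /ltW] /= hg.
  by rewrite ger0_norm// subr_ge0.
move=> /(_ erefl); apply: ae_mono => x Hx Ox; rewrite leNgt; apply/negP => hg.
by have := Hx (conj Ox hg) => /= -[] /eqP; rewrite subr_eq0 gt_eqF.
Qed.

(** Once extended to Borel sets, the bound by an integral makes [mu] finite on [O] and absolutely
    continuous, so Radon-Nikodym applies. *)
Lemma density_exists O h (mu : {measure set 'rV[R]_n -> \bar R}) : open O -> measurable_fun O h ->
  (forall x, O x -> (0 <= h x)%R) -> \int[leb]_(x in O) (h x)%:E < +oo ->
  (forall U, open U -> U `<=` O -> mu U <= \int[leb]_(x in U) (h x)%:E) ->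
  exists g, [/\ measurable_fun setT g, forall x, (0 <= g x)%R &
    forall E, measurable E -> E `<=` O -> mu E = \int[leb]_(x in E) (g x)%:E].
Proof.
move=> oO mh h0 hoo H; have mO := measurable_rV_open oO.
have [mh' h0' hE] := patch_density oO mh h0.
have {}H : forall E, measurable E -> E `<=` O -> mu E <= \int[leb]_(x in E) (h x)%:E.
  move=> E mE EO.
  rewrite -hE//; apply: (@le_open_measurable mu (with_density mh' h0') O) => //.
    by rewrite [ltLHS]hE.
  by move=> U oU UO; rewrite [leRHS]hE// H.
have muO : mu O < +oo by apply: le_lt_trans hoo; exact: H.
have dom : mfrestr mO muO `<< leb.
  apply/null_content_dominatesP => E mE E0; rewrite /mfrestr /mrestr.
  have mEO : measurable (E `&` O) by exact: measurableI.
  have EO0 : leb (E `&` O) = 0 by apply: (subset_measure0 mEO mE _ E0) => x [].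
  apply/eqP; rewrite eq_le measure_ge0 andbT; apply: le_trans (H _ mEO (@subIsetr _ E O)) _.
  by rewrite null_set_integral//; apply: (@measurable_funS _ _ _ _ O); [exact: mO|exact: subIsetr|exact/measurable_EFinP].
have [f [f0 ffin fint fE]] := radon_nikodym_sigma_finite dom.
exists (fine \o f); split.
- apply: measurableT_comp => //; exact: (measurable_int _ fint).
- by move=> x; rewrite fine_ge0.
- move=> E mE EO; transitivity (mfrestr mO muO E); first by rewrite /mfrestr /mrestr setIidl.
  by rewrite [LHS]fE//; apply: eq_integral => x _; rewrite /= fineK.
Qed.

End densities.

(** * Envelopes of densities over a dense set of slopes *)

(** The arithmetic that concludes [envelope_segment], over abstract reals: a nearby weight [s]
    stands in for [l], and the errors add up to three quarters of [e]. *)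
Lemma convex_perturb (R : realFieldType) (l s F X Y G GX GY e : R) : 0 <= e ->
  F <= G + e / 4 -> s * (GX - e / 4) <= s * X -> (1 - s) * (GY - e / 4) <= (1 - s) * Y ->
  G <= s * GX + (1 - s) * GY -> (s - l) * (X - Y) <= e / 4 -> F <= l * X + (1 - l) * Y + e.
Proof. by lra. Qed.

Section envelope.
Context {R : realType} {m : nat} {T : Type}.
Variables (z : T -> 'rV[R]_m) (g : T -> R) (alpha b p : R).
Implicit Types (q : T) (eta xi : 'rV[R]_m) (e : R).

(** The cost [t (alpha + b |xi + (eta - xi) / t|^p)] of passing from slope [xi] to slope [eta], at
    [t = 1 / (k+2)]. This sequence tends to 0 inside the open unit interval, and its countability
    keeps the envelope Borel. *)
Definition penalty xi (k : nat) eta : R :=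
  k.+2%:R^-1 * (alpha + b * eucl_norm (xi + k.+2%:R *: (eta - xi)) `^ p).

Definition envelope eta : \bar R :=
  ereal_inf (range (fun qk : T * nat => (g qk.1 + penalty (z qk.1) qk.2 eta)%:E)).

Hypotheses (p0 : 0 < p) (b0 : 0 <= b) (alpha0 : 0 <= alpha) (g0 : forall q, 0 <= g q).
Hypothesis z_dense : forall eta e, 0 < e -> exists q, `|z q - eta| < e.
Hypothesis g_lip : forall q q' k, g q' <= g q + penalty (z q) k (z q').
Hypothesis g_le : forall q, g q <= alpha + b * eucl_norm (z q) `^ p.

Lemma penalty_ge0 xi k eta : 0 <= penalty xi k eta.
Proof. by rewrite /penalty mulr_ge0 ?invr_ge0// addr_ge0// mulr_ge0// powR_ge0. Qed.

Lemma eucl_le_norm xi : eucl_norm xi <= m%:R * `|xi|.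
Proof.
apply: le_trans (eucl_le_sum _) _; rewrite -[X in X%:R]card_ord -sum1_card natr_sum mulr_suml.
by apply: ler_sum => i _; rewrite mul1r; exact: coord_le_norm.
Qed.

Let B eta := alpha + b * (eucl_norm eta + 2 * m%:R) `^ p.

Let t_gt0 (k : nat) : 0 < k.+2%:R^-1 :> R. Proof. by rewrite invr_gt0. Qed.

(** When the slopes differ by at most [t], the extrapolated slope stays within Euclidean distance
    [2 m] of [eta], the factor [m] passing from sup norm to Euclidean norm. The penalty is then
    [O(t)] in both directions. *)
Lemma penalty_le xi k eta : `|eta - xi| <= k.+2%:R^-1 ->
  penalty xi k eta <= k.+2%:R^-1 * B eta /\ penalty eta k xi <= k.+2%:R^-1 * B eta.
Proof.
move=> H; have t1 : k.+2%:R^-1 <= 1 :> R by rewrite invf_le1// ler1n.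
have m0 : 0 <= m%:R :> R by [].
have s1 : eucl_norm (k.+2%:R *: (eta - xi)) <= m%:R.
  rewrite eucl_normZ ger0_norm//; apply: (@le_trans _ _ (k.+2%:R * (m%:R * `|eta - xi|))).
    by rewrite ler_wpM2l//; exact: eucl_le_norm.
  by rewrite mulrCA ler_piMr// -ler_pdivlMl// mulr1.
have s2 : eucl_norm (eta - xi) <= m%:R.
  apply: le_trans (eucl_le_norm _) _; rewrite ler_piMr//; exact: le_trans H t1.
have mono x y : 0 <= x -> x <= y -> alpha + b * x `^ p <= alpha + b * y `^ p.
  move=> x0 xy; rewrite lerD2l ler_wpM2l// ge0_ler_powR// ?nnegrE ?(ltW p0)//.
  exact: le_trans xy.
split; rewrite ler_wpM2l ?(ltW (t_gt0 _))// mono ?eucl_ge0//; apply: le_trans (eucl_triangle _ _) _.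
  have : eucl_norm xi <= eucl_norm eta + m%:R.
    rewrite (_ : xi = eta + (-1) *: (eta - xi)); last by rewrite scaleN1r opprB addrC subrK.
    by apply: le_trans (eucl_triangle _ _) _; rewrite lerD2l eucl_normZ normrN1 mul1r.
  by move=> ?; lra.
have -> : xi - eta = (-1) *: (eta - xi) by rewrite scaleN1r opprB.
rewrite scalerA mulrN1 scaleNr -scaleN1r eucl_normZ normrN1 mul1r; lra.
Qed.

Lemma small_step (M e : R) : 0 <= M -> 0 < e -> exists k : nat, k.+2%:R^-1 * M <= e.
Proof.
move=> M1 e0; have e1 : 0 < e / (M + 1) by rewrite divr_gt0// ltr_wpDl.
exists (Num.truncn (e / (M + 1))^-1).
set k := Num.truncn _; have : (e / (M + 1))^-1 < k.+2%:R.
  by apply: lt_trans (truncnS_gt _) _; rewrite ltr_nat.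
rewrite -[X in _ < X]invrK ltf_pV2 ?posrE// => /ltW H.
apply: le_trans (ler_wpM2r M1 H) _.
by rewrite -mulrA ler_piMr ?(ltW e0)// mulrC ler_pdivrMr ?ltr_wpDl// mul1r lerDl.
Qed.

Let B_ge0 eta : 0 <= B eta.
Proof. by rewrite /B addr_ge0// mulr_ge0// powR_ge0. Qed.

Lemma envelope_ge0 eta : (0 <= envelope eta)%E.
Proof.
by apply: le_ereal_inf_tmp => _ [[q k] _ <-]; rewrite lee_fin addr_ge0// penalty_ge0.
Qed.

Lemma envelope_le q k eta : (envelope eta <= (g q + penalty (z q) k eta)%:E)%E.
Proof. by apply: ereal_inf_lbound; exists (q, k). Qed.

Lemma envelope_fin eta : envelope eta \is a fin_num.
Proof.
have [q _] := @z_dense eta 1 ltr01.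
rewrite ge0_fin_numE ?envelope_ge0//; apply: le_lt_trans (envelope_le q 0 eta) _.
exact: ltry.
Qed.

(** One inequality is the definition of the infimum. For the other, a slope [z q] within [1 / (k+2)]
    of [eta] makes both penalties small. With [v] the density of a function whose X-gradient is
    [eta] at a point, this is where the density is seen to depend on the gradient only. *)
Lemma envelope_unique eta (v : R) : (forall q k, v <= g q + penalty (z q) k eta) ->
  (forall q k, g q <= v + penalty eta k (z q)) -> envelope eta = v%:E.
Proof.
move=> H1 H2; apply/eqP; rewrite eq_le; apply/andP; split; last first.
  by apply: le_ereal_inf_tmp => _ [[q k] _ <-]; rewrite lee_fin.
apply/lee_addgt0Pr => e e0; have e20 : 0 < e / 2 by rewrite divr_gt0.
have [k ke] := small_step (B_ge0 eta) e20.
have [q qe] := z_dense eta (t_gt0 k).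
have [E1 E2] : penalty (z q) k eta <= k.+2%:R^-1 * B eta /\ penalty eta k (z q) <= k.+2%:R^-1 * B eta.
  by apply: penalty_le; rewrite distrC ltW.
apply: le_trans (envelope_le q k eta) _; rewrite -EFinD lee_fin.
have := H2 q k; move: (penalty _ _ _) (penalty _ _ _) (_ * B eta) E1 E2 ke => P1 P2 M E1 E2 ke; lra.
Qed.

Lemma slope_near eta e : 0 < e -> exists2 d : R, 0 < d & forall xi, `|xi - eta| < d ->
  alpha + b * eucl_norm xi `^ p <= alpha + b * eucl_norm eta `^ p + e.
Proof.
move=> e0; have b1 : 0 < b + 1 by rewrite ltr_wpDl.
have e1 : 0 < e / (b + 1) by rewrite divr_gt0.
set r := eucl_norm eta; have r0 : 0 <= r by exact: eucl_ge0.
have rp : 0 <= r `^ p by exact: powR_ge0.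
(* The radius at which the [p]-th power has grown by [e / (b + 1)]; dividing by [b + 1] rather than
   [b] covers [b = 0]. *)
pose s := (r `^ p + e / (b + 1)) `^ p^-1.
have s0 : 0 <= s by exact: powR_ge0.
have sE : s `^ p = r `^ p + e / (b + 1).
  by rewrite -powRrM mulVf ?gt_eqF// powRr1// addr_ge0// ltW.
have rs : r < s.
  rewrite ltNge; apply/negP => sr.
  have : s `^ p <= r `^ p by rewrite ge0_ler_powR// ?nnegrE// ltW.
  by rewrite sE gerDl leNgt e1.
have m1 : 0 < m%:R + 1 :> R by rewrite ltr_wpDl.
exists ((s - r) / (m%:R + 1)) => [|xi]; first by rewrite divr_gt0// subr_gt0.
rewrite ltr_pdivlMr// => H.
have xis : eucl_norm xi <= s.
  rewrite -[xi](subrK eta); apply: le_trans (eucl_triangle _ _) _; rewrite -lerBrDr.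
  apply: le_trans (eucl_le_norm _) (ltW _); apply: le_lt_trans H.
  by rewrite mulrC ler_wpM2l// lerDl.
have : eucl_norm xi `^ p <= s `^ p by rewrite ge0_ler_powR// ?nnegrE ?eucl_ge0// ltW.
rewrite sE -addrA lerD2l => /(ler_wpM2l b0) /le_trans; apply.
rewrite mulrDr lerD2l mulrCA ler_piMr ?(ltW e0)// ler_pdivrMr// mul1r lerDl//.
Qed.

(* both sides are continuous in the slope [eta], so it may be taken in the dense range of [z] *)
Lemma g_le_envelope q k eta : g q <= fine (envelope eta) + penalty eta k (z q).
Proof.
rewrite -lee_fin EFinD fineK ?envelope_fin// -leeBlDr//.
apply: le_ereal_inf_tmp => _ [[q' k'] _ <-]; rewrite -EFinB lee_fin lerBlDr /=.
apply/ler_addgt0Pr => e e0; have e20 : 0 < e / 2 by rewrite divr_gt0.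
have half (G P1 P2 : R) : G + (P1 + e / 2) + (P2 + e / 2) = G + P1 + P2 + e by field.
have t1 (l : nat) : l.+2%:R^-1 <= 1 :> R by rewrite invf_le1// ler1n.
have pen (l : nat) (X Y : R) : X <= Y + e / 2 -> l.+2%:R^-1 * X <= l.+2%:R^-1 * Y + e / 2.
  move=> /(ler_wpM2l (ltW (t_gt0 l))) /le_trans; apply.
  by rewrite mulrDr lerD2l ler_piMl// ltW.
have [d1 d10 H1] := slope_near (z q' + k'.+2%:R *: (eta - z q')) e20.
have [d2 d20 H2] := slope_near (eta + k.+2%:R *: (z q - eta)) e20.
(* The extrapolated slopes move [k'.+2 - 0] and at most [k.+2] times as fast as the slope [z q2],
   whence the two divisors. *)
pose d := Num.min (d1 / k'.+2%:R) (d2 / k.+2%:R).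
have d0 : 0 < d by rewrite lt_min !divr_gt0.
have [q2] := z_dense eta d0; rewrite lt_min !ltr_pdivlMr// => /andP[Q1 Q2].
have {}H1 : penalty (z q') k' (z q2) <= penalty (z q') k' eta + e / 2.
  apply: pen; apply: H1; rewrite opprD addrACA subrr add0r -scalerBr opprB addrA subrK.
  by rewrite normrZ ger0_norm// mulrC.
have {}H2 : penalty (z q2) k (z q) <= penalty eta k (z q) + e / 2.
  apply: pen; apply: H2.
  have -> : z q2 + k.+2%:R *: (z q - z q2) - (eta + k.+2%:R *: (z q - eta)) = (1 - k.+2%:R) *: (z q2 - eta).
    by apply/rowP => i; rewrite !mxE; ring.
  rewrite normrZ distrC ger0_norm ?subr_ge0 ?ler1n// mulrC; apply: le_lt_trans Q2.
  by rewrite ler_wpM2l// lerBlDr lerDl.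
apply: le_trans (g_lip q2 q k) _.
apply: le_trans (lerD (g_lip q' q2 k') H2) _.
apply: le_trans (lerD (lerD (lexx _) H1) (lexx _)) _.
by rewrite half.
Qed.

(** The envelope is thus the continuous extension of [g], seen as a function of the slope. The
    growth bound and convexity then pass to all slopes by density. *)
Lemma envelope_near eta e : 0 < e -> exists2 d : R, 0 < d & forall q, `|z q - eta| <= d ->
  `|fine (envelope eta) - g q| <= e.
Proof.
move=> e0; have [k ke] := small_step (B_ge0 eta) e0.
exists k.+2%:R^-1 => // q qe.
have [E1 E2] : penalty (z q) k eta <= k.+2%:R^-1 * B eta /\ penalty eta k (z q) <= k.+2%:R^-1 * B eta.
  by apply: penalty_le; rewrite distrC.
have F1 := g_le_envelope q k eta.
have F2 : fine (envelope eta) <= g q + penalty (z q) k eta.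
  by rewrite -lee_fin fineK ?envelope_fin// envelope_le.
rewrite ler_distl lerBlDr (le_trans F1) ?(le_trans F2)// lerD2l.
  exact: le_trans ke.
exact: le_trans ke.
Qed.

Lemma envelope_bound eta : fine (envelope eta) <= alpha + b * eucl_norm eta `^ p.
Proof.
apply/ler_addgt0Pr => e e0; have e20 : 0 < e / 2 by rewrite divr_gt0.
have [d1 d10 H1] := slope_near eta e20.
have [d2 d20 H2] := envelope_near eta e20.
have d0 : 0 < Num.min d1 d2 by rewrite lt_min d10 d20.
have [q] := z_dense eta d0; rewrite lt_min => /andP[/H1 h1 /ltW/H2].
rewrite ler_distl => /andP[_ /le_trans]; apply.
apply: le_trans (lerD (le_trans (g_le q) h1) (lexx (e / 2))) _.
by rewrite -addrA -splitr.
Qed.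

Hypothesis g_conv : forall q0 q1 (s : rat), 0 < s -> s < 1 -> exists2 q,
  z q = ratr s *: z q1 + (1 - ratr s) *: z q0 & g q <= ratr s * g q1 + (1 - ratr s) * g q0.

(** Convexity of [g] is available for rational weights in the open unit interval and for slopes in
    the range of [z]. Replacing [l], [x] and [y] by such data moves the combined slope and the
    values only slightly. *)
Lemma envelope_segment x y (l : R) (f := fun eta => fine (envelope eta)) : 0 <= l -> l <= 1 ->
  f (l *: x + (1 - l) *: y) <= l * f x + (1 - l) * f y.
Proof.
move=> l0 l1; apply/ler_addgt0Pr => e e0; have e40 : 0 < e / 4 by rewrite divr_gt0.
have [dx dx0 Hx] := envelope_near x e40.
have [dy dy0 Hy] := envelope_near y e40.
have [d d0 Hd] := envelope_near (l *: x + (1 - l) *: y) e40.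
have d20 : 0 < d / 2 by rewrite divr_gt0.
have [qx] : exists q, `|z q - x| < Num.min dx (d / 2) by apply: z_dense; rewrite lt_min dx0.
rewrite lt_min => /andP[/ltW/Hx gx zx].
have [qy] : exists q, `|z q - y| < Num.min dy (d / 2) by apply: z_dense; rewrite lt_min dy0.
rewrite lt_min => /andP[/ltW/Hy gy zy].
(* The first bound keeps [(s - l) (x - y)] below [d / 2], so the combined slope stays within [d] of
   its target; the second keeps the change of the right-hand side below [e / 4]. *)
pose h := Num.min (d / 2 / (`|x - y| + 1)) (e / 4 / (`|f x - f y| + 1)).
have xy1 : 0 < `|x - y| + 1 by rewrite ltr_wpDl.
have fxy1 : 0 < `|f x - f y| + 1 by rewrite ltr_wpDl.
have h0 : 0 < h by rewrite lt_min !divr_gt0.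
have [s] : exists s : rat, (Num.max 0 (l - h) < ratr s < Num.min 1 (l + h)).
  have H : Num.max 0 (l - h) < Num.min 1 (l + h).
    have lh1 : l - h < 1 by rewrite ltrBlDr (le_lt_trans l1)// ltrDl.
    by rewrite lt_min !gt_max ltr01 lh1 ltr_wpDl//= ltrD2l gtrN.
  by have [s] := rat_in_itvoo H; rewrite in_itv/=; exists s.
rewrite lt_min gt_max => /andP[/andP[s0 ls] /andP[s1 sl]].
have slh : `|ratr s - l| < h by rewrite ltr_distl ls sl.
have [q zq gq] := @g_conv qy qx s ltac:(by rewrite -(ltr_rat R) rmorph0) ltac:(by rewrite -(ltr_rat R) rmorph1).
move: s0 ls s1 sl slh zq gq; move: (ratr s : R) => {}s s0 ls s1 sl slh zq gq.
move: slh; rewrite lt_min (ltr_pdivlMr _ _ xy1) (ltr_pdivlMr _ _ fxy1) => /andP[h1 h2].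
have s10 : 0 <= 1 - s by rewrite subr_ge0 ltW.
have near : `|z q - (l *: x + (1 - l) *: y)| <= d.
  have -> : z q - (l *: x + (1 - l) *: y) =
      (s *: (z qx - x) + (1 - s) *: (z qy - y)) + (s - l) *: (x - y).
    by rewrite zq; apply/rowP => i; rewrite !mxE; ring.
  rewrite [d in leRHS]splitr; apply: le_trans (ler_normD _ _) _; apply: lerD.
    apply: le_trans (ler_normD _ _) _; rewrite !normrZ !ger0_norm ?(ltW s0)//.
    apply: le_trans (lerD (ler_wpM2l (ltW s0) (ltW zx)) (ler_wpM2l s10 (ltW zy))) _.
    by rewrite -mulrDl addrCA subrr addr0 mul1r.
  rewrite normrZ; apply: le_trans (ltW h1).
  by rewrite ler_wpM2l// lerDl.
have := Hd _ near; rewrite ler_distl => /andP[_ fq].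
move: gx gy; rewrite !ler_distl => /andP[gx _] /andP[gy _].
have gx' := ler_wpM2l (ltW s0) gx; have gy' := ler_wpM2l s10 gy.
have h3 : (s - l) * (f x - f y) <= e / 4.
  apply: le_trans (ler_norm _) _; rewrite normrM; apply: le_trans (ltW h2).
  by rewrite ler_wpM2l// lerDl.
have {}fq : f (l *: x + (1 - l) *: y) <= g q + e / 4 := fq.
have {}gx' : s * (g qx - e / 4) <= s * f x := gx'.
have {}gy' : (1 - s) * (g qy - e / 4) <= (1 - s) * f y := gy'.
exact: convex_perturb (ltW e0) fq gx' gy' gq h3.
Qed.

Lemma envelope_convex : convex_function [set: 'rV[R]_m] (fun eta => fine (envelope eta)).
Proof. by move=> t x y _ _; apply: envelope_segment. Qed.

End envelope.

Lemma measurable_ereal_inf_count {R : realType} d (S : measurableType d) (T : countType) (t0 : T)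
    (h : T -> S -> \bar R) : (forall t, measurable_fun setT (h t)) ->
  measurable_fun setT (fun s => ereal_inf (range (h^~ s))).
Proof.
move=> mh; pose E (i : nat) := odflt t0 (unpickle i).
have -> : (fun s => ereal_inf (range (h^~ s))) = fun s => einfs (fun i => h (E i) s) 0.
  apply/funext => s; congr ereal_inf; apply/seteqP; split => [_ [t _ <-]|_ [i _ <-]].
    by exists (pickle t) => //; rewrite /E pickleK.
  by exists (E i).
exact: measurable_fun_einfs.
Qed.

(** * Linear functions, rational slopes and countable almost everywhere statements *)

Section linear_forms.
Context {R : realType} {n : nat}.

Definition lin (v x : 'rV[R]_n) : R := \sum_i v 0 i * x 0 i.

Lemma lin_incr v (h : R) (w x : 'rV[R]_n) : lin v (h *: w + x) - lin v x = h * lin v w.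
Proof.
rewrite /lin -sumrB mulr_sumr; apply: eq_bigr => i _; rewrite !mxE; ring.
Qed.

Lemma linD (v w : 'rV[R]_n) (s : R) : (fun x => lin v x + s * lin w x) = lin (v + s *: w).
Proof.
apply/funext => x; rewrite /lin mulr_sumr -big_split/=; apply: eq_bigr => i _.
by rewrite !mxE; ring.
Qed.

Lemma derive_lin v (w x : 'rV[R]_n) : derivable (lin v) x w /\ 'D_w (lin v) x = lin v w.
Proof.
have H : \forall h \near (0 : R)^', h^-1 *: ((lin v \o shift x) (h *: w) - lin v x) = lin v w.
  rewrite /= near_withinE; near=> h => h0.
  by rewrite /shift lin_incr -[LHS]/(h^-1 * (h * lin v w)) mulKf.
by split; [apply: is_cvg_near_cst; exact: H|apply: cvg_lim => //; apply: cvg_near_cst; exact: H].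
Unshelve. all: by end_near. Qed.

Lemma partial_lin v i : partial i (lin v) = fun=> v 0 i.
Proof.
apply/funext => x; rewrite /partial (derive_lin v _ x).2 /lin (bigD1 i)//= big1 => [|k ki].
  by rewrite addr0 mxE !eqxx mulr1.
by rewrite mxE (negbTE ki) andbF mulr0.
Qed.

Lemma Ck_lin v : Ck 1 setT (lin v).
Proof.
split=> [x _|i].
  apply: cts_sum => i; apply: ctsM; [exact: cst_continuous|exact: coord_continuous].
by split=> [x _|]; [exact: (derive_lin v _ x).1|split => // x _; rewrite partial_lin; exact: cst_continuous].
Qed.

Lemma norm_row_lt k (y : 'rV[R]_k) (e : R) : 0 < e -> (forall i, `|y 0 i| < e) -> `|y| < e.
Proof.
move=> e0 ye; have : ball (0 : 'rV[R]_k) e y.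
  by split => // i j; rewrite ord1 /ball/= mxE sub0r normrN.
by rewrite -ball_normE /= sub0r normrN.
Qed.

Definition ratv (q : 'rV[rat]_n) : 'rV[R]_n := map_mx ratr q.

Lemma ratv_near (v : 'rV[R]_n) (e : R) : 0 < e -> exists q, forall i, `|(ratv q : 'rV[R]_n) 0 i - v 0 i| < e.
Proof.
move=> e0; have H i : exists q : rat, `|ratr q - v 0 i| < e.
  have vi : v 0 i - e < v 0 i + e by rewrite ltrD2l gtrN.
  by have [q] := rat_in_itvoo vi; rewrite in_itv/= => q1; exists q; rewrite ltr_distl.
have {H} [q qE] := choice H.
by exists (\row_i q i) => i; rewrite !mxE.
Qed.

Lemma ae_and d (S : measurableType d) (mu : {measure set S -> \bar R}) (P Q : S -> Prop) :
  {ae mu, forall x, P x} -> {ae mu, forall x, Q x} -> {ae mu, forall x, P x /\ Q x}.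
Proof. by move=> HP HQ; apply: filterI; [exact: HP|exact: HQ]. Qed.

Lemma ae_forall_count d (S : measurableType d) (mu : {measure set S -> \bar R})
    (T : countType) (P : T -> S -> Prop) :
  (forall q, {ae mu, forall x, P q x}) -> {ae mu, forall x, forall q, P q x}.
Proof.
move=> H; have : {ae mu, forall x, forall k : nat, forall q : T, unpickle k = Some q -> P q x}.
  apply: ae_foralln => k; case: (unpickle k) => [q|]; last exact: aeW.
  by apply: ae_mono (H q) => x Px _ [<-].
by apply: ae_mono => x Hx q; apply: (Hx (pickle q)); rewrite pickleK.
Qed.

End linear_forms.

(** * Weak X-gradients *)

Section X_calculus.
Context {R : realType} {n m : nat}.
Context (Omega : set 'rV[R]_n) (c : 'I_m -> 'I_n -> 'rV[R]_n -> R) (L M0 Mc : R).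
Context (oO : open Omega) (OM : Omega `<=` ball 0 M0) (L0 : 0 <= L) (Mc0 : 0 <= Mc).
Context (cL : forall j i x y, Omega x -> Omega y -> `|c j i y - c j i x| <= L * `|y - x|).
Context (cM : forall j i x, Omega x -> `|c j i x| <= Mc).
Local Notation leb := (@lebesgue_rV R n).
Local Notation intg f := (leb.-integrable setT (EFin \o f)).
Implicit Types (u f g w phi rho v : 'rV[R]_n -> R) (x y z : 'rV[R]_n) (A B K : set 'rV[R]_n).
Implicit Types (i : 'I_n) (j : 'I_m).

(** Integration by parts against a C^1 function [v] uses the product [v * phi], which is no longer
    smooth; this wider class contains the test functions and is stable under such products. *)
Definition C1c A phi := [/\ Ck 1 setT phi, compact (closure [set x | phi x != 0]) &
  closure [set x | phi x != 0] `<=` A].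

Lemma test_C1c A phi : test_function A phi -> C1c A phi.
Proof. by case=> H1 H2 H3; split. Qed.

Lemma C1c_off A phi : C1c A phi -> exists M, off_ball 0 M phi.
Proof.
case=> _ /compact_sub_ball[M M0' KM] _; exists M => x xM.
by apply: supp0 => /KM.
Qed.

Lemma C1c_out A phi x : C1c A phi -> ~ A x -> phi x = 0.
Proof. by case=> _ _ SA xA; apply: supp0 => /SA. Qed.

Lemma C1c_cts A phi : C1c A phi -> continuous phi.
Proof. by case=> p1 _ _ x; exact: Ck_cts p1 _. Qed.

Lemma C1c_bounded A phi : C1c A phi -> exists2 C : R, 0 < C & forall x, `|phi x| <= C.
Proof. by move=> cp; have [M] := C1c_off cp; exact: cts_off_ball_bounded (C1c_cts cp). Qed.

Lemma c_continuous j i x : Omega x -> {for x, continuous (c j i)}.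
Proof.
move=> Ox; apply/(@cvgrPdist_lt _ _ _ _ (nbhs_filter x)) => e e0.
have : nbhs x Omega by exact: open_nbhs_nbhs.
move=> /nbhs_ballP[r r0 rO]; apply/nbhs_ballP; exists (Num.min r (e / (L + 1))).
  by rewrite /= lt_min r0 divr_gt0// ltr_wpDl.
move=> y; rewrite -ball_normE /= lt_min => /andP[yr ye].
have Oy : Omega y by apply: rO; rewrite -ball_normE.
rewrite distrC; apply: le_lt_trans (cL _ _ Ox Oy) _.
rewrite ltr_pdivlMr ?ltr_wpDl// in ye; apply: le_lt_trans ye.
by rewrite distrC mulrC ler_wpM2l// lerDl.
Qed.

Lemma cphi_lipschitz A j i phi : A `<=` Omega -> C1c A phi ->
  exists2 K : R, 0 < K & forall x y, `|c j i y * phi y - c j i x * phi x| <= K * `|y - x|.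
Proof.
move=> AO cp; have [C C0 pC] := C1c_bounded cp; have [M pM] := C1c_off cp.
have [p1 _ _] := cp.
have [Lp Lp0 pL] := Ck_lipschitz p1 pM.
exists (L * C + Mc * Lp + 1) => [|x y].
  by rewrite ltr_wpDl// addr_ge0 ?mulr_ge0// ltW.
apply: le_trans (mul_lipschitz (B := Omega) L0 Mc0 (ltW Lp0) (ltW C0) _ _ pL pC _ x y) _.
- exact: cL.
- exact: cM.
- by move=> z zO; apply: C1c_out cp _ => /AO.
- by rewrite ler_wpM2r// lerDl.
Qed.

Lemma cphi_continuous A j i phi : A `<=` Omega -> C1c A phi -> continuous (fun x => c j i x * phi x).
Proof. by move=> AO /(cphi_lipschitz j i AO)[K _]; exact: lipschitz_continuous. Qed.

Lemma cphi_derivable A j i phi : A `<=` Omega -> C1c A phi ->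
  {ae leb, forall x, derivable (fun x => c j i x * phi x) x (delta_mx 0 i)}.
Proof.
move=> AO cp; have [K K0 H] := cphi_lipschitz j i AO cp.
apply: (@dirlip_ae_derivable _ _ _ _ (K * `|delta_mx 0 i : 'rV[R]_n|)).
  exact: cphi_continuous AO cp.
exact: (lipschitz_dir i H).
Qed.

Lemma cphi_off phi M j i : off_ball 0 M phi -> off_ball 0 M (fun x => c j i x * phi x).
Proof. by move=> pM x xM; rewrite pM// mulr0. Qed.

Lemma integral_partial_cphi A j i phi : A `<=` Omega -> C1c A phi ->
  (\int[leb]_x (partial i (fun y => c j i y * phi y) x)%:E = 0)%E.
Proof.
move=> AO cp; have [K K0 H] := cphi_lipschitz j i AO cp.
have [M pM] := C1c_off cp.
have cc : continuous (fun x => c j i x * phi x) := cphi_continuous AO cp.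
have [C C0 wC] := cts_off_ball_bounded cc (cphi_off j i pM).
exact: (integral_derive0 cc (lipschitz_dir i H) wC (cphi_off j i pM)).
Qed.

(** Minus the formal adjoint of [X_j], with derivatives existing almost everywhere. *)
Definition adj j phi x := \sum_(i < n) partial i (fun y => c j i y * phi y) x.

Lemma measurable_partial_cphi A j i phi : A `<=` Omega -> C1c A phi ->
  measurable_fun setT (partial i (fun y => c j i y * phi y)).
Proof. by move=> AO cp; apply: measurable_derive; exact: cphi_continuous AO cp. Qed.

Lemma measurable_adj A j phi : A `<=` Omega -> C1c A phi -> measurable_fun setT (adj j phi).
Proof. by move=> AO cp; apply: measurable_sum => i; exact: measurable_partial_cphi AO cp. Qed.

Lemma partial_cphi_bounded A j i phi : A `<=` Omega -> C1c A phi ->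
  exists2 C : R, 0 < C & forall x, `|partial i (fun y => c j i y * phi y) x| <= C.
Proof.
move=> AO cp; have [K K0 H] := cphi_lipschitz j i AO cp.
exists (K * `|delta_mx 0 i : 'rV[R]_n| + 1) => [|x]; first by rewrite ltr_wpDl// mulr_ge0// ltW.
apply: le_trans (derive_le _ (lipschitz_dir i H) x) _; last by rewrite lerDl.
by rewrite mulr_ge0// ltW.
Qed.

Lemma adj_bounded A j phi : A `<=` Omega -> C1c A phi ->
  exists2 C : R, 0 < C & forall x, `|adj j phi x| <= C.
Proof.
move=> AO cp.
have /choice[C HC] i : exists C : R, 0 < C /\ forall x, `|partial i (fun y => c j i y * phi y) x| <= C.
  by have [C] := partial_cphi_bounded j i AO cp; exists C.
exists (\sum_i C i + 1) => [|x].
  by rewrite ltr_wpDl// sumr_ge0// => i _; exact: ltW (HC i).1.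
apply: le_trans (ler_norm_sum _ _ _) _; apply: ler_wpDr => //.
by apply: ler_sum => i _; exact: (HC i).2.
Qed.

Lemma adj_out A j phi x : C1c A phi -> ~ closure [set x | phi x != 0] x -> adj j phi x = 0.
Proof.
move=> cp /supp_near0[r r0 H]; rewrite /adj big1// => i _; rewrite /partial.
have [//|_ ->//] := @derive_near0 _ _ (fun y => c j i y * phi y) (delta_mx 0 i) x r r0 _.
by move=> y /H ->; rewrite mulr0.
Qed.

Definition Xc v j x := \sum_(i < n) c j i x * partial i v x.

Lemma derivable_mul (f g : 'rV[R]_n -> R) x d : derivable f x d -> derivable g x d ->
  'D_d (fun y => f y * g y) x = f x * 'D_d g x + g x * 'D_d f x.
Proof. by move=> df dg; rewrite (deriveM df dg). Qed.

Lemma C1c_mul A v phi : Ck 1 setT v -> C1c A phi -> C1c A (fun x => v x * phi x).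
Proof.
move=> v1 [p1 cK KA].
have sub : closure [set x | v x * phi x != 0] `<=` closure [set x | phi x != 0].
  by apply: closure_subset => x /=; apply: contraNneq => ->; rewrite mulr0.
split; last exact: subset_trans KA.
  split=> [x _|i]; first by apply: ctsM; [exact: Ck_cts v1 _|exact: Ck_cts p1 _].
  split=> [x _|].
    by apply: derivableM; [exact: Ck_derivable v1 _|exact: Ck_derivable p1 _].
  split=> // x _; apply: (@cts_ext _ _ (fun x => v x * partial i phi x + phi x * partial i v x)).
    by move=> y; rewrite [RHS]derivable_mul//; [exact: Ck_derivable v1 _|exact: Ck_derivable p1 _].
  apply: ctsD; apply: ctsM; [exact: Ck_cts v1 _|exact: Ck_cts (Ck_partial i p1) _
    |exact: Ck_cts p1 _|exact: Ck_cts (Ck_partial i v1) _].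
apply: (subclosed_compact _ cK sub); exact: closed_closure.
Qed.

Lemma Xc_continuous v j x : Ck 1 setT v -> Omega x -> {for x, continuous (Xc v j)}.
Proof.
move=> v1 Ox; apply: (@cts_sum _ _ _ _ (fun i x => c j i x * partial i v x)) => i.
by apply: ctsM; [exact: c_continuous|exact: Ck_cts (Ck_partial i v1) _].
Qed.

Lemma measurable_Xc A v j : Ck 1 setT v -> open A -> A `<=` Omega -> measurable_fun A (Xc v j).
Proof.
move=> v1 oA AO; apply: open_continuous_measurable_fun => // x /AO Ox.
exact: Xc_continuous.
Qed.

Lemma C1_L1loc A f : open A -> (forall x, A x -> {for x, continuous f}) -> L1loc A f.
Proof.
move=> oA fc; split; first exact: open_continuous_measurable_fun.
move=> K cK KA; have mK := measurable_compact cK.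
have mf : measurable_fun K f.
  by apply: measurable_funS (open_continuous_measurable_fun oA fc) => //; exact: measurable_rV_open.
have [C C0 fC] := cts_compact_bounded cK (fun x Kx => fc x (KA x Kx)).
apply: (@le_lt_trans _ _ (\int[leb]_(x in K) C%:E)%E).
  apply: ge0_le_integral => //.
  - by apply/measurable_EFinP; exact: measurableT_comp.
rewrite integral_cst//; apply: lte_mul_pinfty; rewrite ?lee_fin ?(ltW C0)//.
exact: compact_finite_leb.
Qed.

Lemma ae_all_i (P : 'I_n -> 'rV[R]_n -> Prop) : (forall i, {ae leb, forall x, P i x}) ->
  {ae leb, forall x, forall i, P i x}.
Proof. by move=> H; apply: filter_forall. Qed.

Lemma integrable_mul_adj A j f phi : A `<=` Omega -> C1c A phi -> measurable_fun A f ->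
  open A -> (exists C : R, forall x, closure [set x | phi x != 0] x -> `|f x| <= C) ->
  intg (fun x => f x * adj j phi x).
Proof.
move=> AO cp mf oA [C fC]; have [D D0 aD] := adj_bounded j AO cp.
have [_ cK KA] := cp; have [M M0' KM] := compact_sub_ball cK.
have E : (fun x => f x * adj j phi x) = (fun x => (f \_ A) x * adj j phi x).
  apply/funext => x; rewrite patchE; case: ifPn => // /negP xA.
  by rewrite (adj_out j cp) ?mulr0// => /KA Ax; apply: xA; rewrite inE.
apply: (@bounded_support_integrable _ _ _ (`|C| * D) M).
- rewrite E; apply: measurable_funM; last exact: measurable_adj AO cp.
  by apply/(measurable_restrictT _ _).1 => //; exact: measurable_rV_open.
- move=> x; have [Kx|Kx] := pselect (closure [set x | phi x != 0] x).
    by rewrite normrM ler_pM// (le_trans (fC x Kx))// ler_norm.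
  by rewrite (adj_out j cp Kx) mulr0 normr0 mulr_ge0// ltW.
- by move=> x xM; rewrite (adj_out j cp) ?mulr0// => /KM.
Qed.

(** Almost everywhere [Xc v j * phi + v * adj j phi] equals [adj j (v * phi)] by the product rule,
    and the latter is a sum of derivatives of compactly supported Lipschitz functions, so its
    integral is 0. *)
Lemma C1_weak_X A v j : open A -> A `<=` Omega -> Ck 1 setT v -> weak_X c A j v (Xc v j).
Proof.
move=> oA AO v1; have mA := measurable_rV_open oA; split.
  by apply: C1_L1loc => // x /AO; exact: Xc_continuous.
move=> phi /test_C1c cp; have [_ cK KA] := cp.
have cv : continuous v by move=> x; exact: Ck_cts v1 _.
pose f1 x := Xc v j x * phi x; pose f2 x := v x * adj j phi x.
have f10 x : ~ A x -> f1 x = 0 by move=> xA; rewrite /f1 (C1c_out cp xA) mulr0.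
have f20 x : ~ A x -> f2 x = 0 by move=> xA; rewrite /f2 (adj_out j cp) ?mulr0// => /KA.
have i1 : intg f1.
  have [M pM] := C1c_off cp.
  have off : off_ball 0 M f1 by move=> x /pM; rewrite /f1 => ->; rewrite mulr0.
  have cf1 : continuous f1.
    move=> x; apply: (@cts_ext _ _ (fun x => \sum_(i < n) (c j i x * phi x) * partial i v x)).
      by move=> y; rewrite /f1 /Xc mulr_suml; apply: eq_bigr => i _; rewrite mulrAC.
    apply: (@cts_sum _ _ _ _ (fun i x => (c j i x * phi x) * partial i v x)) => i.
    apply: ctsM; last exact: Ck_cts (Ck_partial i v1) _.
    by have cc : continuous (fun x => c j i x * phi x) := cphi_continuous AO cp; exact: cc.
  have [C C0 fC] := cts_off_ball_bounded cf1 off.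
  exact: bounded_support_integrable (continuous_rV_measurable_fun cf1) fC off.
have i2 : intg f2.
  apply: (@integrable_mul_adj A) => //.
    exact: measurable_funTS (continuous_rV_measurable_fun cv).
  by have [C _ vC] := cts_compact_bounded cK (fun x _ => cv x); exists C.
have cvp := C1c_mul v1 cp.
have I3 : (\int[leb]_x (adj j (fun y => v y * phi y)%R x)%:E = 0)%E.
  under eq_integral do rewrite /adj -sumEFin.
  rewrite integral_sum//.
    by rewrite big1// => i _; exact: integral_partial_cphi AO cvp.
  move=> i; have [C C0 HC] := partial_cphi_bounded j i AO cvp.
  have [M pM] := C1c_off cvp.
  apply: (@bounded_support_integrable _ _ _ C (M + 1)) => //.
    exact: measurable_partial_cphi AO cvp.
  by apply: partial_off_ball => //; exact: cphi_off.
have I12 : (\int[leb]_x (f1 x + f2 x)%:E = 0)%E.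
  rewrite -I3; apply: ae_eq_integral => //.
  - apply/measurable_EFinP; apply: measurable_funD; apply/measurable_EFinP.
      exact: measurable_int i1.
    exact: measurable_int i2.
  - by apply/measurable_EFinP; exact: measurable_adj AO cvp.
  have := ae_all_i (fun i => cphi_derivable j i AO cp); apply: ae_mono => x dx _; congr EFin.
  rewrite /f1 /f2 /Xc /adj mulr_suml mulr_sumr -big_split; apply: eq_bigr => i _ /=.
  rewrite /partial (_ : (fun y => c j i y * (v y * phi y)) = fun y => v y * (c j i y * phi y)).
    by rewrite [RHS]derivable_mul//; [ring|exact: Ck_derivable v1 _].
  by apply/funext => y; rewrite mulrCA.
rewrite (integral_setT0 (f := f1) mA f10) (integral_setT0 (f := f2) mA f20).
rewrite integralD_EFin// in I12.
have fin1 := integrable_fin_num measurableT i1; have fin2 := integrable_fin_num measurableT i2.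
move: I12; rewrite -(fineK fin1) -(fineK fin2) -EFinD => -[I12].
by rewrite -EFinN; congr EFin; apply/eqP; rewrite -addr_eq0 I12.
Qed.

Lemma weak_X_Rint A j u g phi K : open A -> A `<=` Omega -> weak_X c A j u g ->
  test_function A phi -> closure [set x | phi x != 0] `<=` K ->
  \int[leb]_x ((g \_ K) x * phi x) = - \int[leb]_x ((u \_ Omega) x * adj j phi x).
Proof.
move=> oA AO [_ /(_ phi)+] tp pK; have mA := measurable_rV_open oA.
have cp := test_C1c tp; have [_ _ KA] := cp.
move=> /(_ tp).
rewrite (integral_setT0 (f := fun x => g x * phi x) mA); last first.
  by move=> x xA; rewrite (C1c_out cp xA) mulr0.
rewrite (integral_setT0 (f := fun x => u x * adj j phi x) mA); last first.
  by move=> x xA; rewrite (adj_out j cp) ?mulr0// => /KA.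
rewrite (patch_mul _ (fun x xK => supp0 (fun xS => xK (pK x xS)))).
have H x : ~ Omega x -> adj j phi x = 0 by move=> xO; apply: adj_out cp _ => /KA/AO.
rewrite (patch_mul _ H) /Rintegral => ->.
by rewrite fineN.
Qed.

Lemma LpP A p u : 1 <= p -> Lp A p u <-> measurable_fun setT (u \_ A) /\ (pint p (u \_ A) < +oo)%E.
Proof.
move=> p1; have p0 : 0 < p by exact: lt_le_trans p1.
have E : (pint p (u \_ A) = 'N[leb]_p%:E[EFin \o (u \_ A)] `^ p)%E.
  rewrite powR_Lnorm ?gt_eqF// pint.unlock; apply: eq_integral => x _.
  by transitivity (`|(u \_ A) x|%:E `^ p)%E; rewrite ?poweR_EFin.
split=> [|[mu pu]].
  rewrite /Lp /= inE => /andP[]; rewrite inE => mu; rewrite inE /= /finite_norm => fu; split => //.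
  by rewrite E poweR_lty.
rewrite /Lp /= inE; apply/andP; split; first by rewrite inE.
rewrite inE /= /finite_norm; move: pu; rewrite E.
by apply: lty_poweRy; rewrite gt_eqF.
Qed.

Lemma compact_insetO A r : A `<=` Omega -> 0 < r -> compact (inset A r).
Proof.
move=> AO r0; apply: (@closed_ball_bounded_compact _ _ _ M0); first exact: closed_inset.
by move=> x /(inset_sub r0) /AO /OM.
Qed.

Lemma test_mollifier C e rho x r A : is_mollifier C e rho -> 0 < e -> e < r -> ball x r `<=` A ->
  test_function A (fun y => rho (y - x)) /\
  closure [set y | rho (y - x) != 0] `<=` ball x r.
Proof.
move=> mr e0 er xA.
have S : [set y | rho (y - x) != 0] `<=` ball x e.
  move=> y /= y0; apply: contrapT => xy; move/eqP : y0; apply.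
  by apply: (mollifier_off mr) => b; apply: xy; exact/ball0B.
have cS : closure [set y | rho (y - x) != 0] `<=` ball x r.
  move=> y /(closure_subset S); rewrite -/(closed_ball x e) closed_ballE// /closed_ball_ /= => xy.
  by rewrite -ball_normE /=; exact: le_lt_trans er.
split => //; split; [by move=> k; exact: mollifier_Ck mr| |exact: subset_trans xA].
apply: (@closed_ball_bounded_compact _ _ _ (`|x| + r)); first exact: closed_closure.
move=> y /cS; rewrite -!ball_normE /= sub0r normrN => xy; rewrite -(subrKC x y).
by apply: le_lt_trans (ler_normD _ _) _; rewrite ltrD2l distrC.
Qed.

Lemma inset_half A r x : 0 < r -> inset A r x -> ball x (r / 2) `<=` inset A (r / 2).
Proof.
move=> r0 xA y xy z yz; apply: xA; rewrite (splitr r); exact: ball_triangle xy yz.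
Qed.

Lemma ae_inset A (P : 'rV[R]_n -> Prop) : open A ->
  (forall r, 0 < r -> {ae leb, forall x, inset A r x -> P x}) -> {ae leb, forall x, A x -> P x}.
Proof.
move=> oA H.
have Hk (k : nat) : {ae leb, forall x, inset A k.+1%:R^-1 x -> P x} by apply: H; rewrite invr_gt0.
by move: (ae_foralln Hk); apply: ae_mono => x Hx; rewrite -{1}(inset_bigcup oA) => -[k _]; exact: Hx.
Qed.

(** At points of [inset A r] the translated mollifier is a test function on [A], so the mollified
    [g] vanishes there; it also converges to [g] in L^1, by [mollify_cvg] with exponent 1. *)
Lemma fundamental_lemma A g : open A -> A `<=` Omega -> L1loc A g ->
  (forall phi, test_function A phi -> (\int[leb]_(x in A) (g x * phi x)%:E = 0)%E) ->
  {ae leb, forall x, A x -> g x = 0}.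
Proof.
move=> oA AO lg g0; have mA := measurable_rV_open oA.
apply: ae_inset => // r r0; have r20 : 0 < r / 2 by rewrite divr_gt0.
have KA : inset A (r / 2) `<=` A by exact: inset_sub.
have ig := L1loc_intg oA lg (compact_insetO AO r20) KA.
set g1 := g \_ (inset A (r / 2)) in ig.
have mg1 : measurable_fun setT g1 by apply/measurable_EFinP; case/integrableP: ig.
have mr : measurable (inset A r) by apply: closed_rV_measurable; exact: closed_inset.
have pg : (pint 1 g1 < +oo)%E.
  rewrite pint.unlock; case/integrableP: ig => _; congr (_ < _)%E.
  by apply: eq_integral => x _; rewrite powRr1.
have [C C0 HC] := @mollifier_exists R n.
pose T := g1 \_ (inset A r).
have mT : measurable_fun setT T by apply/(measurable_restrictT _ _).1 => //; exact: measurable_funTS.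
have T0 : {ae leb, forall x, T x = 0}.
  apply: (@pint_eq0_ae _ _ 1) => // eta eta0.
  have [d d0 Hd] := mollify_cvg (lexx 1) ig pg C0 eta0.
  (* Below [d] for the convergence, and below [r / 2] so that mollifiers centred in [inset A r] live
     in [inset A (r / 2)], where [g1] is [g]. *)
  pose e := Num.min (d / 2) (r / 4).
  have e0 : 0 < e by rewrite lt_min !divr_gt0.
  have ed : e < d by rewrite gt_min ltr_pdivrMr// ltr_pMr// ltr1n.
  have er : e < r / 2 by rewrite gt_min; apply/orP; right; lra.
  have [rho mrho] := HC e e0.
  apply: le_trans (Hd e rho e0 ed mrho); apply: le_pint => //.
    apply: measurable_funB => //; apply: continuous_rV_measurable_fun.
    exact: conv_continuous ig (mollifier_Ck0 1 mrho) (mollifier_off mrho).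
  move=> x; rewrite /T patchE; case: ifPn => [|_]; last by rewrite normr0.
  rewrite inE => xA; have xb := inset_half r0 xA.
  have [tp Sp] := test_mollifier mrho e0 er (subset_trans xb KA).
  rewrite (_ : conv g1 rho x = 0) ?sub0r ?normrN// /conv patch_mul.
    rewrite /Rintegral -(integral_setT0 mA) ?g0//.
    by move=> y yA; rewrite (C1c_out (test_C1c tp) yA) mulr0.
  move=> y yK; apply: (@supp0 _ _ (fun y => rho (y - x))) => yS.
  exact: yK (xb _ (Sp _ yS)).
move: T0; apply: ae_mono => x; rewrite /T patchE => + xA.
rewrite ifT ?inE// /g1 patchE ifT// inE.
by apply: le_inset xA; rewrite ler_pdivrMr// ler_peMr ?(ltW r0)// ler1n.
Qed.

Lemma L1locP A g : open A -> L1loc A g <->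
  measurable_fun A g /\ forall K, compact K -> K `<=` A -> leb.-integrable K (EFin \o g).
Proof.
move=> oA; have mA := measurable_rV_open oA; split=> -[mg H]; split => // K cK KA.
  have mK := measurable_compact cK.
  apply/integrableP; split; last exact: H.
  by apply/measurable_EFinP; exact: measurable_funS mg.
by have /integrableP[] := H K cK KA.
Qed.

Lemma L1loc_lin A g h (k : R) : open A -> L1loc A g -> L1loc A h -> L1loc A (fun x => g x + k * h x).
Proof.
move=> oA /(L1locP _ oA)[mg ig] /(L1locP _ oA)[mh ih]; apply/(L1locP _ oA); split.
  by apply: measurable_funD => //; exact: measurable_funM.
move=> K cK KA; have mK := measurable_compact cK.
have := integrableD mK (ig K cK KA) (integrableZl mK k (ih K cK KA)).
by apply: eq_integrable => // x _ /=; rewrite -EFinM -EFinD.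
Qed.

(** Moves the defining identity to real integrals of integrable functions over the whole space,
    where linearity applies freely. Cutting [g] to the support of the test function is needed
    because it is only locally integrable. *)
Lemma weak_XP A j u g : open A -> A `<=` Omega -> L1loc A g -> intg (u \_ Omega) ->
  weak_X c A j u g <-> forall phi, test_function A phi ->
    \int[leb]_x ((g \_ (closure [set x | phi x != 0])) x * phi x) =
    - \int[leb]_x ((u \_ Omega) x * adj j phi x).
Proof.
move=> oA AO lg iu; split=> [wu phi tp|H].
  exact: (weak_X_Rint oA AO wu tp).
split => // phi tp; have cp := test_C1c tp; have [_ cK KA] := cp.
have mA := measurable_rV_open oA.
have ig := L1loc_intg oA lg cK KA.
have [Cp _ pC] := C1c_bounded cp.
have [Ca _ aC] := adj_bounded j AO cp.
have i1 := integrableMb ig (continuous_rV_measurable_fun (C1c_cts cp)) pC.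
have i2 := integrableMb iu (measurable_adj j AO cp) aC.
have E := H phi tp; have := congr1 EFin E; rewrite /Rintegral {E}.
rewrite fineK; last exact: integrable_fin_num i1.
rewrite EFinN fineK; last exact: integrable_fin_num i2.
rewrite (integral_setT0 (f := fun x => g x * phi x) mA); last first.
  by move=> x xA; rewrite (C1c_out cp xA) mulr0.
rewrite (integral_setT0 (f := fun x => u x * adj j phi x) mA); last first.
  by move=> x xA; rewrite (adj_out j cp) ?mulr0// => /KA.
have P1 x := congr1 (@^~ x) (patch_mul g (@supp0 _ _ phi)).
have aO x : ~ Omega x -> adj j phi x = 0 by move=> xO; apply: adj_out cp _ => /KA/AO.
have P2 x := congr1 (@^~ x) (patch_mul u aO).
under eq_integral do rewrite P1.
by under [in X in (- X)%E]eq_integral do rewrite P2.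
Qed.

Lemma weak_X_lin A j u w g h (k : R) : open A -> A `<=` Omega -> intg (u \_ Omega) -> intg (w \_ Omega) ->
  weak_X c A j u g -> weak_X c A j w h ->
  weak_X c A j (fun x => u x + k * w x) (fun x => g x + k * h x).
Proof.
move=> oA AO iu iw wu ww.
have lg := wu.1; have lh := ww.1; have lgh := L1loc_lin k oA lg lh.
have patchL (f1 f2 : 'rV[R]_n -> R) B : (fun x => f1 x + k * f2 x) \_ B = (fun x => (f1 \_ B) x + k * (f2 \_ B) x).
  by apply/funext => x; rewrite !patchE; case: ifP => //; rewrite mulr0 addr0.
have ikw : intg (fun x => k * (w \_ Omega) x) by have := integrableZl measurableT k iw.
have iuw : intg ((fun x => u x + k * w x) \_ Omega) by rewrite patchL; exact: integrableD iu ikw.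
move/(weak_XP j oA AO lg iu) in wu; move/(weak_XP j oA AO lh iw) in ww.
apply/(weak_XP j oA AO lgh iuw) => phi tp.
have cp := test_C1c tp; have [_ cK KA] := cp.
have [Cp _ pC] := C1c_bounded cp.
have [Ca _ aC] := adj_bounded j AO cp.
have mp := continuous_rV_measurable_fun (C1c_cts cp); have ma := measurable_adj j AO cp.
have RD (f1 f2 psi : 'rV[R]_n -> R) C : intg f1 -> intg f2 -> measurable_fun setT psi -> (forall x, `|psi x| <= C) ->
    \int[leb]_x ((f1 x + k * f2 x) * psi x) = \int[leb]_x (f1 x * psi x) + k * \int[leb]_x (f2 x * psi x).
  move=> if1 if2 mpsi psiC; have j1 := integrableMb if1 mpsi psiC; have j2 := integrableMb if2 mpsi psiC.
  rewrite -RintegralZl// -RintegralD//; last by have := integrableZl measurableT k j2.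
  by apply: eq_Rintegral => x _; ring.
rewrite !patchL (RD _ _ _ _ _ _ mp pC); [|exact: L1loc_intg KA..].
rewrite (RD _ _ _ _ _ _ ma aC)// wu// ww//; ring.
Qed.

Lemma weak_X_unique A j u g g' : open A -> A `<=` Omega -> intg (u \_ Omega) ->
  weak_X c A j u g -> weak_X c A j u g' -> {ae leb, forall x, A x -> g x = g' x}.
Proof.
move=> oA AO iu wg wg'.
have lg := wg.1; have lg' := wg'.1; have ld := L1loc_lin (-1) oA lg lg'.
have wd := weak_X_lin (-1) oA AO iu iu wg wg'.
have : {ae leb, forall x, A x -> g x + -1 * g' x = 0}.
  apply: fundamental_lemma => // phi tp; have [_ ->//] := wd.
  rewrite integral0_eq ?oppe0// => x _.
  by rewrite mulN1r subrr mul0r.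
by apply: ae_mono => x + Ax => /(_ Ax); rewrite mulN1r => /subr0_eq.
Qed.

Lemma weak_X_sub A B j u g : open A -> open B -> B `<=` A -> A `<=` Omega -> intg (u \_ Omega) ->
  weak_X c A j u g -> weak_X c B j u g.
Proof.
move=> oA oB BA AO iu wg; have lg := wg.1.
have lB : L1loc B g.
  case: lg => mg H; split; first by apply: measurable_funS mg => //; exact: measurable_rV_open.
  by move=> K cK KB; apply: H => //; exact: subset_trans BA.
move/(weak_XP j oA AO lg iu) in wg; apply/(weak_XP j oB (subset_trans BA AO) lB iu).
by move=> phi [p1 p2 p3]; apply: wg; split => //; exact: subset_trans BA.
Qed.

Lemma weak_X_ae A j u g g' : open A -> A `<=` Omega -> intg (u \_ Omega) ->
  weak_X c A j u g -> measurable_fun A g' -> {ae leb, forall x, A x -> g x = g' x} ->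
  weak_X c A j u g'.
Proof.
move=> oA AO iu wg mg' gg'; have lg := wg.1; have mA := measurable_rV_open oA.
have mg := lg.1.
have lg' : L1loc A g'.
  split => // K cK KA; have mK := measurable_compact cK.
  have := lg.2 K cK KA; congr (_ < _)%E; apply: ae_eq_integral => //.
  - by apply/measurable_EFinP; apply: measurableT_comp => //; exact: measurable_funS mg.
  - by apply/measurable_EFinP; apply: measurableT_comp => //; exact: measurable_funS mg'.
  - by move: gg'; apply: ae_mono => x H /KA /H ->.
move/(weak_XP j oA AO lg iu) in wg; apply/(weak_XP j oA AO lg' iu) => phi tp.
rewrite -wg// /Rintegral; congr fine; have cp := test_C1c tp; have [_ cK KA] := cp.
have mp := continuous_rV_measurable_fun (C1c_cts cp).
have H g0 : L1loc A g0 -> measurable_fun setT (fun x => ((g0 \_ (closure [set x | phi x != 0])) x * phi x)%:E).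
  move=> lg0; have /integrableP[/measurable_EFinP mg0 _] := L1loc_intg oA lg0 cK KA.
  by apply/measurable_EFinP; exact: measurable_funM.
apply: ae_eq_integral => //; [exact: H|exact: H|].
move: gg'; apply: ae_mono => x gg' _; congr (_ * _)%:E; rewrite !patchE; case: ifP => //.
by rewrite inE => /KA /gg'.
Qed.

(** An open counterpart of [inset]: the strict margin makes it open, and it is squeezed between
    insets. For open [A] inside the bounded [Omega] the cores are an increasing exhaustion by
    compactly contained sets. *)
Definition core A (k : nat) := [set x : 'rV[R]_n | exists2 s, k.+1%:R^-1 < s & ball x s `<=` A].

Lemma open_core A (k : nat) : open (core A k).
Proof.
apply: nbhs_open => x [s ks sA].
have d0 : 0 < (s - k.+1%:R^-1) / 2 by rewrite divr_gt0// subr_gt0.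
apply/nbhs_ballP; exists ((s - k.+1%:R^-1) / 2) => // y xy.
exists (k.+1%:R^-1 + (s - k.+1%:R^-1) / 2); first by rewrite ltrDl.
move=> z yz; apply: sA.
rewrite (_ : s = (s - k.+1%:R^-1) / 2 + (k.+1%:R^-1 + (s - k.+1%:R^-1) / 2)); last by field.
exact: ball_triangle xy yz.
Qed.

Lemma core_inset A (k : nat) : core A k `<=` inset A k.+1%:R^-1.
Proof. by move=> x [s ks sA] y xy; apply: sA; apply: le_ball xy; exact: ltW. Qed.

Lemma inset_core A (k : nat) r : k.+1%:R^-1 < r -> inset A r `<=` core A k.
Proof. by move=> kr x xA; exists r. Qed.

Lemma core_sub A (k : nat) : core A k `<=` A.
Proof. by apply: subset_trans (@core_inset A k) _; apply: inset_sub; rewrite invr_gt0. Qed.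

Lemma core_closure A (k : nat) : closure (core A k) `<=` inset A k.+1%:R^-1.
Proof.
move=> x /(closure_subset (@core_inset A k)); rewrite -(closure_id _).1//.
exact: closed_inset.
Qed.

Lemma core_contained A (k : nat) : A `<=` Omega -> compactly_contained (core A k) A.
Proof.
move=> AO; have k0 : 0 < k.+1%:R^-1 :> R by rewrite invr_gt0.
split; last by apply: subset_trans (@core_closure A k) _; exact: inset_sub.
apply: (subclosed_compact _ (compact_insetO AO k0) (@core_closure A k)).
exact: closed_closure.
Qed.

Lemma inv_lt_ex (r : R) : 0 < r -> exists k : nat, k.+1%:R^-1 < r.
Proof.
move=> r0; exists (Num.truncn r^-1); rewrite -[r]invrK ltf_pV2 ?posrE ?invr_gt0//.
by rewrite invrK; exact: truncnS_gt.
Qed.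

Lemma compact_core A K : open A -> compact K -> K `<=` A -> exists k : nat, K `<=` core A k.
Proof.
move=> oA cK KA; have [r r0 Kr] := compact_inset cK oA KA.
have [k kr] := inv_lt_ex r0; exists k; exact: subset_trans (inset_core kr).
Qed.

Lemma core_bigcup A : open A -> \bigcup_k core A k = A.
Proof.
move=> oA; apply/seteqP; split => [x [k _] /core_sub//|x Ax].
have : nbhs x A by exact: open_nbhs_nbhs.
move=> /nbhs_ballP[r r0 rA]; have [k kr] := inv_lt_ex r0.
by exists k => //; exists r.
Qed.

Lemma core_homo A (k l : nat) : (k <= l)%N -> core A k `<=` core A l.
Proof.
move=> kl x [s ks sA]; exists s => //; apply: le_lt_trans ks.
by rewrite lef_pV2 ?posrE// ler_nat.
Qed.

Lemma weak_X_exhaust A j u g : open A -> A `<=` Omega -> intg (u \_ Omega) -> measurable_fun A g ->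
  (forall k : nat, weak_X c (core A k) j u g) -> weak_X c A j u g.
Proof.
move=> oA AO iu mg wk.
have lg : L1loc A g.
  split => // K cK KA; have [k Kk] := compact_core oA cK KA.
  exact: (wk k).1.2.
apply/(weak_XP j oA AO lg iu) => phi [p1 p2 p3]; have [k Kk] := compact_core oA p2 p3.
have := (weak_XP j (@open_core A k) (subset_trans (@core_sub A k) AO) (wk k).1 iu).1 (wk k).
by apply; split.
Qed.

Lemma Lp_ae A p u w : 1 <= p -> measurable A -> Lp A p u -> measurable_fun A w ->
  {ae leb, forall x, A x -> u x = w x} -> Lp A p w.
Proof.
move=> p1 mA /(LpP _ _ p1)[mu pu] mw uw; apply/(LpP _ _ p1).
have mw' : measurable_fun setT (w \_ A) by apply/(measurable_restrictT _ _).1.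
split; first by [].
suff -> : pint p (w \_ A) = pint p (u \_ A) by [].
rewrite pint.unlock; apply: ae_eq_integral => //; [exact: measurable_normp|exact: measurable_normp|].
move: uw; apply: ae_mono => x uw _; rewrite !patchE; case: ifP => //.
by rewrite inE => /uw ->.
Qed.

Lemma Lp_sub A B p u : 1 <= p -> measurable A -> measurable B -> B `<=` A -> Lp A p u -> Lp B p u.
Proof.
move=> p1 mA mB BA /(LpP _ _ p1)[mu pu].
have E : u \_ B = (u \_ A) \_ B.
  apply/funext => x; rewrite !patchE; case: ifPn => // xB; rewrite ifT// inE; apply: BA.
  by rewrite inE in xB.
have mB' : measurable_fun setT (u \_ B).
  by rewrite E; apply/(measurable_restrictT _ _).1 => //; exact: measurable_funTS.
apply/(LpP _ _ p1); split => //; apply: le_lt_trans pu; apply: le_pint => // x.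
by rewrite E patchE; case: ifP => // _; rewrite normr0.
Qed.

(** From [|u| <= 1 + |u|^p] and the finite measure of the bounded set [Omega]. *)
Lemma Lp_intg p u : 1 <= p -> Lp Omega p u -> intg (u \_ Omega).
Proof.
move=> p1 /(LpP _ _ p1)[mu pu].
have mO := measurable_rV_open oO.
have OO : (leb Omega < +oo)%E.
  apply: le_lt_trans (finite_leb_ball M0); apply: le_measure; rewrite ?inE//.
  exact: measurable_ball.
apply/integrableP; split; first exact/measurable_EFinP.
apply: (@le_lt_trans _ _ (\int[leb]_x ((\1_Omega x)%:E + (`|(u \_ Omega) x| `^ p)%:E))%E).
  apply: ge0_le_integral => //.
  - by apply/measurable_EFinP; exact: measurableT_comp.
  - apply: emeasurable_funD; last exact: measurable_normp.
    by apply/measurable_EFinP.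
  - move=> x _; rewrite -EFinD lee_fin /= indicE patchE; case: ifPn => xO.
      by have := @le_split_powR _ _ p1 1 `|u x| ltr01 (normr_ge0 _); rewrite powR1 mul1r.
    by rewrite normr0 add0r powR_ge0.
rewrite ge0_integralD//; last 2 first.
- by apply/measurable_EFinP.
- exact: measurable_normp.
rewrite integral_indic// setIT; apply: lte_add_pinfty => //.
by move: pu; rewrite pint.unlock.
Qed.

(** Local membership provides one gradient per core, with no relation between them. The gradient of
    core [k] is used on the layer that core [k] adds to the previous ones; almost everywhere
    uniqueness makes the result agree with every local gradient on its own core. *)
Lemma glue A p u : 1 <= p -> open A -> A `<=` Omega -> intg (u \_ Omega) -> W1pX_loc c A p u ->
  exists G, is_Xgrad c A u G /\ forall A' j, open A' -> compactly_contained A' A -> Lp A' p (fun x => G x 0 j).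
Proof.
move=> p1 oA AO iu wu.
have H (jk : 'I_m * nat) : exists g, Lp (core A jk.2) p g /\ weak_X c (core A jk.2) jk.1 u g.
  by have [_ /(_ jk.1)[g]] := wu _ (@open_core A jk.2) (core_contained jk.2 AO); exists g.
have {H} [g Hg] := choice H.
(* The index of the layer containing [x]; the default 0 is taken only outside [A]. *)
pose kk x : nat := xget 0%N [set k | seqDU (core A) k x].
pose G x : 'rV[R]_m := \row_j g (j, kk x) x.
have mcore k : measurable (core A k) by apply: measurable_rV_open; exact: open_core.
have mD k : measurable (seqDU (core A) k).
  by apply: measurableD => //; exact: bigsetU_measurable.
have kkE k x : seqDU (core A) k x -> kk x = k.
  move=> Dx; rewrite /kk; case: xgetP => [l _ Dl|/(_ k)//].
  by have /trivIsetP/(_ k l Logic.I Logic.I) := @trivIset_seqDU _ (core A); case: (eqVneq k l) => // _ /(_ isT) /seteqP[+ _]; move=> /(_ x (conj Dx Dl)).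
have GE j k x : seqDU (core A) k x -> G x 0 j = g (j, k) x by move=> /kkE kx; rewrite mxE kx.
have mG j : measurable_fun A (fun x => G x 0 j).
  rewrite -(core_bigcup oA) seqDU_bigcup_eq; apply/measurable_fun_bigcup => // k.
  apply: (@eq_measurable_fun _ _ _ _ _ (g (j, k))) => [x|]; first by rewrite inE => /GE ->.
  apply: measurable_funS (Hg (j, k)).2.1.1 => //.
  by move=> x [].
have aeG j l : {ae leb, forall x, core A l x -> g (j, l) x = G x 0 j}.
  have : {ae leb, forall x, forall k, (k <= l)%N -> core A k x -> g (j, k) x = g (j, l) x}.
    apply: ae_foralln => k; have [kl|kl] := boolP (k <= l)%N; last by apply: aeW.
    have kA := subset_trans (@core_sub A k) AO; have lA := subset_trans (@core_sub A l) AO.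
    have := weak_X_unique (@open_core A k) kA iu (Hg (j, k)).2
      (weak_X_sub (@open_core A l) (@open_core A k) (core_homo kl) lA iu (Hg (j, l)).2).
    by apply: ae_mono => x + _.
  apply: ae_mono => x E xl.
  have [k _ Dk] : (\bigcup_k seqDU (core A) k) x by rewrite -seqDU_bigcup_eq; exists l.
  rewrite (GE j k x Dk) E//; last by case: Dk.
  rewrite leqNgt; apply/negP => lk; case: Dk => _; apply.
  by rewrite -bigcup_mkord; exists l.
have wk j k : weak_X c (core A k) j u (fun x => G x 0 j).
  have kA := subset_trans (@core_sub A k) AO.
  apply: (weak_X_ae (@open_core A k) kA iu (Hg (j, k)).2 _ (aeG j k)).
  by apply: measurable_funS (mG j) => //; [exact: measurable_rV_open|exact: core_sub].
exists G; split.
  by move=> j; exact: weak_X_exhaust.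
move=> A' j oA' [cA' A'A].
have [k A'k] := compact_core oA cA' A'A.
have mA' := measurable_rV_open oA'.
apply: (Lp_sub p1 (mcore k) mA'); first by apply: subset_trans A'k; exact: subset_closure.
apply: (Lp_ae p1 (mcore k) (Hg (j, k)).1 _ (aeG j k)).
by apply: measurable_funS (mG j) => //; [exact: measurable_rV_open|exact: core_sub].
Qed.

(** * Friedrichs' commutator lemma *)

Lemma min_pos (I : finType) (d : I -> R) : (forall i : I, 0 < d i) ->
  exists2 e : R, 0 < e & forall i : I, e <= d i.
Proof.
move=> d0; exists (\big[Num.min/1]_i d i); first by rewrite lt_bigmin.
by move=> i; exact: bigmin_le.
Qed.

Lemma intg_sum (I : Type) (s : seq I) (f : I -> 'rV[R]_n -> R) : (forall i : I, intg (f i)) ->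
  intg (fun x => \sum_(i <- s) f i x).
Proof.
move=> fi; rewrite (_ : EFin \o _ = fun x => (\sum_(i <- s) (f i x)%:E)%E).
  by apply: integrable_sum => // i _; exact: fi.
by apply/funext => x; rewrite /= sumEFin.
Qed.

Lemma Rintegral_sum (I : Type) (s : seq I) (f : I -> 'rV[R]_n -> R) : (forall i : I, intg (f i)) ->
  \int[leb]_x (\sum_(i <- s) f i x) = \sum_(i <- s) \int[leb]_x f i x.
Proof.
move=> fi; elim: s => [|i s IH].
  by rewrite big_nil; under eq_Rintegral do rewrite big_nil; rewrite /Rintegral integral0.
rewrite big_cons -IH -RintegralD//; last exact: intg_sum.
by apply: eq_Rintegral => x _; rewrite big_cons.
Qed.

Lemma mollifier_lipschitz C e rho : is_mollifier C e rho ->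
  forall x y, `|rho y - rho x| <= n%:R * (C / e ^+ n.+1) * `|y - x|.
Proof.
move=> mr x y; have r1 := mollifier_Ck0 1 mr; have [_ _ _ _ [_ dr]] := mr.
apply: coord_lipschitz => i {}x t; apply: line_lipschitz => z; last exact: dr.
exact: Ck_derivable r1 _.
Qed.

(* the commutator of X_j with the convolution by rho has the kernel
   \sum_i d_i ((c_ji - c_ji(x)) rho(. - x)), which has mean zero and is O(e^-n) *)
Lemma commutator_le (C : R) : 0 < C -> exists2 C' : R, 0 < C' &
  forall A K j u g e rho r x, open A -> A `<=` Omega -> intg (u \_ Omega) -> weak_X c A j u g ->
  is_mollifier C e rho -> 0 < e -> e < r -> ball x r `<=` A -> ball x r `<=` K ->
  ((`|Xc (conv (u \_ Omega) rho) j x - conv (g \_ K) rho x|%R)%:E <= (C' / (2 * e) ^+ n)%:E *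
    \int[leb]_(z in ball (0 : 'rV[R]_n)%R (2 * e)%R) (`|(u \_ Omega) (x + z) - (u \_ Omega) x|%R)%:E)%E.
Proof.
(* On the ball of radius [e] the coefficient varies by at most [L e] against a kernel slope
   [n C / e^(n+1)], and it has slope [L] against a kernel bounded by [C / e^n]. Together this is
   [L C (1 + n) / e^n] for each of the [n] directions; the final 1 ensures positivity. *)
move=> C0; pose C1 := n%:R * (L * C * (1 + n%:R)) + 1.
have C10 : 0 < C1 by rewrite ltr_wpDl// !mulr_ge0// ?addr_ge0// ltW.
exists (C1 * 2 ^+ n) => [|A K j u g e rho r x oA AO iu wu mr e0 er xA xK].
  by rewrite mulr_gt0// exprn_gt0.
have -> : C1 * 2 ^+ n / (2 * e) ^+ n = C1 / e ^+ n.
  have en : e ^+ n != 0 by rewrite expf_neq0// gt_eqF.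
  have tn : 2 ^+ n != 0 :> R by rewrite expf_neq0.
  by rewrite exprMn; field; rewrite en tn.
set u1 := u \_ Omega in iu *.
have [tp Sp] := test_mollifier mr e0 er xA.
pose phi y := rho (y - x).
have cp : C1c A phi by exact: test_C1c tp.
have E1 : conv (g \_ K) rho x = - \int[leb]_y (u1 y * adj j phi y).
  exact: (weak_X_Rint oA AO wu tp (subset_trans Sp xK)).
have r2 := mollifier_Ck0 2 mr; have ro := mollifier_off mr.
have dphi i y : partial i rho (y - x) = partial i phi y by rewrite /partial derive_translate.
have [_ _ _ _ [_ dr]] := mr.
have mdr i : measurable_fun setT (partial i rho).
  by apply: continuous_rV_measurable_fun => y; exact: Ck_cts (Ck_partial i r2) _.
have mdp i : measurable_fun setT (partial i phi).
  rewrite (_ : partial i phi = fun y => partial i rho (y - x)); first exact: measurable_shift.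
  by apply/funext => y; rewrite dphi.
have dpC i y : `|partial i phi y| <= C / e ^+ n.+1 by rewrite -dphi.
have idp i : intg (fun y => u1 y * partial i phi y) by exact: integrableMb iu (mdp i) (dpC i).
have E2 : Xc (conv u1 rho) j x = - \int[leb]_y (u1 y * \sum_i (c j i x * partial i phi y)).
  rewrite /Xc (eq_bigr (fun i => - (c j i x * \int[leb]_y (u1 y * partial i phi y)))); last first.
    move=> i _; have [_ H] := conv_partial i x iu r2 ro.
    rewrite -[partial i (conv u1 rho) x]/('D_(delta_mx 0 i) (conv u1 rho) x) H mulrN.
    suff -> : conv u1 (partial i rho) x = \int[leb]_y (u1 y * partial i phi y) by [].
    by rewrite /conv; apply: eq_Rintegral => y _; rewrite dphi.
  rewrite sumrN; congr (- _).
  rewrite (eq_bigr (fun i => \int[leb]_y (c j i x * (u1 y * partial i phi y)))); last first.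
    by move=> i _; rewrite RintegralZl.
  rewrite -Rintegral_sum; last by move=> i; have := integrableZl measurableT (c j i x) (idp i).
  by apply: eq_Rintegral => y _; rewrite mulr_sumr; apply: eq_bigr => i _; ring.
(* Subtracting [c j i x] gains a factor [e]: the Lipschitz constant of [w i] is of order [e^-n]
   instead of [e^-(n+1)]. *)
pose w i y := (c j i y - c j i x) * phi y.
pose k y := \sum_i partial i (w i) y.
have Ox : Omega x by apply: AO; apply: xA; apply: ballxx; exact: lt_trans er.
have BO : ball x e `<=` Omega.
  by apply: subset_trans AO; apply: subset_trans xA; apply: le_ball; exact: ltW.
have pL y z : `|phi z - phi y| <= n%:R * (C / e ^+ n.+1) * `|z - y|.
  apply: le_trans (mollifier_lipschitz mr _ _) _.
  by rewrite opprB addrA subrK.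
have pC y : `|phi y| <= C / e ^+ n by exact: mollifier_bound mr.
have p0 y : ~ ball x e y -> phi y = 0.
  by move=> xy; apply: ro => b; apply: xy; exact/ball0B.
have en0 m' : 0 <= C / e ^+ m' by rewrite divr_ge0 ?exprn_ge0 ?(ltW C0) ?(ltW e0).
have wL i y z : `|w i z - w i y| <= L * C * (1 + n%:R) / e ^+ n * `|z - y|.
  have := @mul_lipschitz _ _ (ball x e) (fun y => c j i y - c j i x) phi L (L * e)
    (n%:R * (C / e ^+ n.+1)) (C / e ^+ n) L0 _ _ (en0 n) _ _ pL pC p0 y z.
  rewrite (_ : L * (C / e ^+ n) + L * e * (n%:R * (C / e ^+ n.+1)) = L * C * (1 + n%:R) / e ^+ n); last first.
    rewrite exprS; have : e ^+ n != 0 by rewrite expf_neq0// gt_eqF.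
    have : e != 0 by rewrite gt_eqF.
    by move: (e ^+ n) => E Ee E0; field; rewrite Ee E0.
  apply; [by rewrite mulr_ge0// ltW|by rewrite mulr_ge0| |].
    by move=> a b /BO Oa /BO Ob; rewrite opprB addrA subrK; exact: cL.
  move=> a xa; apply: le_trans (cL _ _ Ox (BO _ xa)) _.
  by rewrite ler_wpM2l// distrC; move: xa; rewrite -ball_normE /= => /ltW.
have L1 : 0 <= L * C * (1 + n%:R) / e ^+ n.
  by rewrite divr_ge0 ?exprn_ge0 ?(ltW e0)// !mulr_ge0 ?addr_ge0 ?(ltW C0).
have cw i : continuous (w i) by exact: lipschitz_continuous (wL i).
have wo i : off_ball x e (w i) by move=> y /p0; rewrite /w => ->; rewrite mulr0.
have wd i := lipschitz_dir i (wL i).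
have dwC i y : `|partial i (w i) y| <= L * C * (1 + n%:R) / e ^+ n.
  apply: le_trans (derive_le _ (wd i) y) _; first by rewrite mulr_ge0.
  by rewrite ler_piMr// delta_norm_le.
have mdw i : measurable_fun setT (partial i (w i)) by exact: measurable_derive.
have mk : measurable_fun setT k by exact: measurable_sum.
have kC y : `|k y| <= C1 / e ^+ n.
  apply: le_trans (ler_norm_sum _ _ _) _.
  apply: (@le_trans _ _ (\sum_(i < n) L * C * (1 + n%:R) / e ^+ n)).
    by apply: ler_sum => i _; exact: dwC.
  rewrite sumr_const card_ord -(mulr_natl (L * C * (1 + n%:R) / e ^+ n)) [leLHS]mulrA.
  rewrite ler_wpM2r ?invr_ge0 ?exprn_ge0 ?(ltW e0)//.
  by rewrite /C1 lerDl.
(* Differentiation enlarges the supporting ball by a positive margin, here taken equal to [e]; this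
   is the origin of the radius [2 * e] in the statement. *)
have ko : off_ball x (2 * e) k.
  move=> y xy; rewrite /k big1// => i _; apply: (partial_off_ball i e0 (wo i)).
  by rewrite (_ : e + e = 2 * e)//; ring.
have ik0 : \int[leb]_y k y = 0.
  rewrite /k Rintegral_sum => [|i].
    rewrite big1// => i _; have [Cw _ wC] := cts_off_ball_bounded (cw i) (wo i).
    by rewrite /Rintegral (integral_derive0 (cw i) (wd i) wC (off_ball0 (wo i))).
  exact: (bounded_support_integrable (mdw i) (dwC i) (off_ball0 (partial_off_ball i e0 (wo i)))).
have kE : {ae leb, forall y, adj j phi y - \sum_i (c j i x * partial i phi y) = k y}.
  have := ae_all_i (fun i => cphi_derivable j i AO cp); apply: ae_mono => y dy.
  rewrite /adj /k -sumrB; apply: eq_bigr => i _.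
  have dp : derivable phi y (delta_mx 0 i) by have [p1 _ _] := cp; exact: Ck_derivable p1 _.
  have dcp : derivable (fun z => c j i x * phi z) y (delta_mx 0 i).
    by apply: derivableM; [exact: derivable_cst|exact: dp].
  rewrite /partial (_ : w i = (fun z => c j i z * phi z) - (fun z => c j i x * phi z)); last first.
    by apply/funext => z; rewrite /w mulrBl.
  rewrite (deriveB (dy i) dcp); congr (_ - _).
  have cx : derivable (fun=> c j i x) y (delta_mx 0 i : 'rV[R]_n) by exact: derivable_cst.
  by rewrite (derivable_mul cx dp) (derive_cst (c j i x)) mulr0 addr0.
have mS : measurable_fun setT (fun y => \sum_i (c j i x * partial i phi y)).
  by apply: measurable_sum => i; exact: measurable_funM.
have [Ca _ aC] := adj_bounded j AO cp.
have ma := measurable_adj j AO cp.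
have ia := integrableMb iu ma aC.
have iS : intg (fun y => u1 y * \sum_i (c j i x * partial i phi y)).
  rewrite (_ : (fun y => _) = fun y => \sum_i (c j i x * (u1 y * partial i phi y))).
    by apply: intg_sum => i; have := integrableZl measurableT (c j i x) (idp i).
  by apply/funext => y; rewrite mulr_sumr; apply: eq_bigr => i _; ring.
have -> : Xc (conv u1 rho) j x - conv (g \_ K) rho x = \int[leb]_y (u1 y * k y) - u1 x * \int[leb]_y k y.
  rewrite ik0 mulr0 subr0 E1 E2 opprK addrC -RintegralB//.
  rewrite /Rintegral; congr fine; apply: ae_eq_integral => //.
  - by have := measurable_int _ (integrableB measurableT ia iS).
  - apply/measurable_EFinP; apply: measurable_funM => //.
    by apply/measurable_EFinP; case/integrableP: iu.
  - by move: kE; apply: ae_mono => y <- _; rewrite mulrBr.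
apply: kernel_le => //; by rewrite divr_ge0 ?exprn_ge0 ?(ltW e0) ?(ltW C10).
Qed.

(** [Xc v j - g j] splits into the commutator, controlled by the oscillation of [u] through
    [average_le], and the mollification error of [g j] cut to [inset A (r / 2)]. Shrinking from
    [r / 2] to [r] keeps the kernels inside the region of the cut-off. *)
Lemma friedrichs p A u (g : 'I_m -> 'rV[R]_n -> R) r : 1 <= p -> open A -> A `<=` Omega ->
  Lp Omega p u -> (forall j, weak_X c A j u (g j)) ->
  (forall A' j, open A' -> compactly_contained A' A -> Lp A' p (g j)) -> 0 < r ->
  forall eta : R, 0 < eta -> exists v, [/\ Ck 1 setT v,
    (pint p (fun x => v x - (u \_ Omega) x)%R <= eta%:E)%E &
    forall j, (pint p ((fun x => Xc v j x - g j x)%R \_ (inset A r)) <= eta%:E)%E].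
Proof.
move=> p1 oA AO Lu wu Lg r0 eta eta0.
have iu := Lp_intg p1 Lu; have [mu pu] := (LpP _ _ p1).1 Lu.
have r20 : 0 < r / 2 by rewrite divr_gt0.
set B := inset A (r / 2).
have BA : B `<=` A by exact: inset_sub.
have cB : compact B by exact: compact_insetO.
have mB := measurable_compact cB.
pose g1 j := g j \_ B.
have ig j : intg (g1 j) by exact: L1loc_intg oA (wu j).1 cB BA.
have pg j : (pint p (g1 j) < +oo)%E.
  have [k Bk] := compact_core oA cB BA.
  have mk : measurable (core A k) by apply: measurable_rV_open; exact: open_core.
  have := Lp_sub p1 mk mB Bk (Lg _ j (@open_core A k) (core_contained k AO)).
  by move=> /(LpP _ _ p1)[].
have [C C0 HC] := @mollifier_exists R n.
have [C' C'0 HT] := commutator_le C0.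
have [KA KA0 Hav] := @average_le R n p p1 C' C'0.
have p20 : (0 : R) < 2 `^ p by rewrite powR_gt0.
(* Two terms of this size add up to [eta] after the factor [2 ^ p] of [pintD]. *)
pose eta1 := eta / 2 / 2 `^ p.
have eta10 : 0 < eta1 by rewrite !divr_gt0.
have [du du0 Hu] := mollify_cvg p1 iu pu C0 eta0.
have /choice[dg Hg] j : exists d : R, 0 < d /\ forall e rho, 0 < e -> e < d -> is_mollifier C e rho ->
    (pint p (fun x => conv (g1 j) rho x - g1 j x)%R <= eta1%:E)%E.
  by have [d] := mollify_cvg p1 (ig j) (pg j) C0 eta10; exists d.
have [dm dm0 dmg] := min_pos (fun j => (Hg j).1).
have [dt dt0 Ht] := Lp_translation p1 mu pu (divr_gt0 eta10 KA0).
pose e := Num.min (Num.min (du / 2) (dm / 2)) (Num.min (dt / 2) (r / 4)).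
have e0 : 0 < e by rewrite !lt_min !divr_gt0.
have edu : e < du by rewrite !gt_min ltr_pdivrMr// ltr_pMr// ltr1n.
have edm : e < dm.
  by apply: (@le_lt_trans _ _ (dm / 2)); [rewrite !ge_min lexx ?orbT|lra].
have edt : 2 * e <= dt by rewrite mulrC -ler_pdivlMr// !ge_min lexx !orbT.
have er : e < r / 2 by rewrite !gt_min; apply/orP; right; apply/orP; right; lra.
have [rho mr] := HC e e0.
have ro := mollifier_off mr.
exists (conv (u \_ Omega) rho); have v1 := Ck_conv iu (mollifier_Ck0 2 mr) ro.
split => // [|j]; first exact: Hu mr.
set v := conv _ _ in v1 *.
have mI : measurable (inset A r) by apply: closed_rV_measurable; exact: closed_inset.
have IA : inset A r `<=` A by exact: inset_sub.
pose T := (fun x => Xc v j x - conv (g1 j) rho x) \_ (inset A r).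
pose S := (fun x => conv (g1 j) rho x - g1 j x) \_ (inset A r).
have mg1 : measurable_fun setT (g1 j) by apply/measurable_EFinP; case/integrableP: (ig j).
have mc : measurable_fun setT (conv (g1 j) rho).
  by apply: continuous_rV_measurable_fun; exact: conv_continuous (ig j) (mollifier_Ck0 1 mr) ro.
have mT : measurable_fun setT T.
  apply/(measurable_restrictT _ _).1 => //; apply: measurable_funB; last exact: measurable_funTS.
  apply: measurable_funS (measurable_Xc j v1 oA AO) => //; exact: measurable_rV_open.
have mcg : measurable_fun setT (fun x => conv (g1 j) rho x - g1 j x) by exact: measurable_funB.
have mS : measurable_fun setT S by apply/(measurable_restrictT _ _).1 => //; exact: measurable_funTS.
have -> : (fun x => Xc v j x - g j x) \_ (inset A r) = fun x => T x + S x.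
  apply/funext => x; rewrite /T /S !patchE; case: ifPn => [|_]; last by rewrite addr0.
  rewrite inE => xA; rewrite /g1 patchE ifT; first by rewrite addrA subrK.
  by rewrite inE; apply: le_inset xA; rewrite ler_pdivrMr// ler_peMr ?(ltW r0)// ler1n.
apply: le_trans (pintD p1 mT mS) _.
have pT : (pint p T <= eta1%:E)%E.
  have -> : eta1 = KA * (eta1 / KA) by rewrite mulrC divfK// gt_eqF.
  apply: (Hav (u \_ Omega) T (2 * e)) => //; first by rewrite mulr_gt0.
    move=> z; rewrite -ball_normE /= sub0r normrN => ze; apply: Ht; exact: lt_le_trans edt.
  move=> x; rewrite /T patchE; case: ifPn => [|_]; last first.
    rewrite normr0; apply: mule_ge0; last by apply: integral_ge0 => z _; rewrite lee_fin.
    by rewrite lee_fin divr_ge0 ?exprn_ge0 ?mulr_ge0 ?(ltW C'0) ?(ltW e0).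
  rewrite inE => xA; apply: (HT A B j u (g j) e rho (r / 2)) => //.
    by apply: subset_trans BA; exact: inset_half.
  exact: inset_half.
have pS : (pint p S <= eta1%:E)%E.
  apply: le_trans ((Hg j).2 e rho e0 (lt_le_trans edm (dmg j)) mr).
  apply: le_pint => // x; rewrite /S patchE; case: ifP => //; by rewrite normr0.
apply: (@le_trans _ _ ((2 `^ p)%:E * (eta1%:E + eta1%:E))%E).
  by apply: lee_wpmul2l; [rewrite lee_fin ltW|exact: leeD].
rewrite -EFinD -EFinM lee_fin /eta1.
have : 2 `^ p != 0 :> R by rewrite gt_eqF.
move: (2 `^ p) => q q0.
by rewrite (_ : q * _ = eta)//; field.
Qed.

(** * The growth bound for functions with an X-gradient *)

Context (p : R) (p1 : 1 < p) (m_gt0 : (0 < m)%N).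
Context (F : ('rV[R]_n -> R) -> set 'rV[R]_n -> \bar R) (a : 'rV[R]_n -> R) (b : R).
Context (F0 : nonneg_functional Omega p F)
  (Floc : local_functional Omega p F) (Fmeas : measure_functional Omega p F)
  (Flsc : lsc_functional Omega p F)
  (Ftr : forall u A (k : R), Lp Omega p u -> open_subsets Omega A -> F (fun x => u x + k) A = F u A).
Context (la : L1loc Omega a) (a0 : forall x, Omega x -> 0 <= a x) (b0 : 0 < b).
Context (Fub : forall u A, Lp Omega p u -> open_subsets Omega A -> Ck 1 A u ->
    (F u A <= \int[@lebesgue_rV R n]_(x in A)
      (a x + b * eucl_norm (Xgrad c A u x) `^ p)%:E)%E).
Local Notation En U G := (\int[leb]_(x in U) (a x + b * eucl_norm (G x) `^ p)%:E)%E.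
Implicit Types (U : set 'rV[R]_n) (G : 'rV[R]_n -> 'rV[R]_m).

Let p1' : 1 <= p. Proof. exact: ltW. Qed.
Let p0 : 0 < p. Proof. exact: lt_trans p1. Qed.

Lemma pint_patch A u : measurable A -> pint p (u \_ A) = (\int[leb]_(x in A) (`|u x| `^ p)%:E)%E.
Proof.
move=> mA; rewrite pint.unlock [RHS]integral_mkcond; apply: eq_integral => x _.
by rewrite !patchE; case: ifP => // _; rewrite normr0 powR0// gt_eqF.
Qed.

Lemma Lp_dist_lt u v (d : R) : 0 < d -> Lp Omega p u -> Lp Omega p v ->
  (pint p ((u \- v)%R \_ Omega) < (d `^ p)%:E)%E -> (Lp_dist Omega p u v < d%:E)%E.
Proof.
move=> d0 Lu Lv; have E : (pint p ((u \- v)%R \_ Omega) = Lp_dist Omega p u v `^ p)%E.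
  rewrite /Lp_dist powR_Lnorm ?gt_eqF// pint.unlock; apply: eq_integral => x _.
  by transitivity (`|((u \- v) \_ Omega) x|%:E `^ p)%E; rewrite ?poweR_EFin.
rewrite E => H; have D0 : (0 <= Lp_dist Omega p u v)%E by exact: Lnorm_ge0.
rewrite ltNge; apply/negP => dD.
move: H; rewrite ltNge => /negP; apply.
rewrite -poweR_EFin; apply: gt0_ler_poweR => //; rewrite ?(ltW p0)// in_itv/= ?leey ?andbT//.
by rewrite lee_fin ltW.
Qed.

(** The form in which lower semicontinuity is applied throughout: it suffices to produce
    approximants whose distance and excess over [M] are both at most [e]. An infinite [M] is
    harmless. *)
Lemma lsc_le u U (M : \bar R) : open_subsets Omega U -> Lp Omega p u -> (0 <= M)%E ->
  (forall e : R, 0 < e -> exists v, [/\ Lp Omega p v, (pint p ((v \- u)%R \_ Omega) <= e%:E)%E &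
     (F v U <= M + e%:E)%E]) -> (F u U <= M)%E.
Proof.
move=> oU Lu M0' H; rewrite leNgt; apply/negP => MF.
case: M M0' MF H => [M| |] //; last by move=> _; rewrite ltNge leey.
move=> M0' MF H.
have [t Mt tF] : exists2 t : R, M < t & (t%:E < F u U)%E.
  case: (F u U) MF => [r| |] //; rewrite ?lte_fin.
    by move=> Mr; exists ((M + r) / 2); [|rewrite lte_fin]; have := midf_lt Mr; lra.
  by move=> _; exists (M + 1); [rewrite ltrDl|rewrite ltry].
have [d d0 Hd] := Flsc oU Lu tF.
(* The first bound keeps [F v U] at most [t], the second places [v] in the neighbourhood where it
   must exceed [t]. *)
pose e := Num.min (t - M) ((d `^ p) / 2).
have dp0 : 0 < d `^ p by rewrite powR_gt0.
have e0 : 0 < e by rewrite lt_min subr_gt0 Mt divr_gt0.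
have [v [Lv pv Fv]] := H e e0.
have : (t%:E < F v U)%E.
  apply: Hd => //; apply: Lp_dist_lt => //; apply: le_lt_trans pv _; rewrite lte_fin.
  by rewrite gt_min; apply/orP; right; lra.
rewrite ltNge => /negP; apply; apply: le_trans Fv _.
by rewrite -EFinD lee_fin -lerBrDl ge_min lexx.
Qed.

Lemma Lp_add A u w (k : R) : Lp A p u -> Lp A p w -> Lp A p (fun x => u x + k * w x).
Proof.
move=> /(LpP _ _ p1')[mu pu] /(LpP _ _ p1')[mw pw]; apply/(LpP _ _ p1').
have -> : (fun x => u x + k * w x) \_ A = fun x => (u \_ A) x + k * (w \_ A) x.
  by apply/funext => x; rewrite !patchE; case: ifP => //; rewrite mulr0 addr0.
have mkw : measurable_fun setT (fun x => k * (w \_ A) x) by exact: measurable_funM.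
split; first exact: measurable_funD.
apply: le_lt_trans (pintD p1' mu mkw) _; rewrite pintZ//.
apply: lte_mul_pinfty; rewrite ?lee_fin ?powR_ge0//.
by apply: lte_add_pinfty => //; apply: lte_mul_pinfty; rewrite ?lee_fin ?powR_ge0.
Qed.

Lemma C1_bounded v : continuous v -> exists2 C : R, 0 < C & forall x, Omega x -> `|v x| <= C.
Proof.
move=> cv; pose M := `|M0| + 1; have M1 : 0 < M by rewrite ltr_wpDl.
have cK : compact (closed_ball (0 : 'rV[R]_n) M).
  apply: (@closed_ball_bounded_compact _ _ _ (M + 1)); first exact: closed_ball_closed.
  move=> y; rewrite closed_ballE// /closed_ball_ -ball_normE /= => /le_lt_trans; apply.
  by rewrite ltrDl.
have [C C0 vC] := cts_compact_bounded cK (fun x _ => cv x).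
exists C => // x /OM xM; apply: vC; apply: subset_closed_ball; apply: le_ball xM.
by rewrite /M ler_wpDr// ler_norm.
Qed.

Lemma bounded_Lp v (C : R) : measurable_fun Omega v -> (forall x, Omega x -> `|v x| <= C) -> Lp Omega p v.
Proof.
move=> mv vC; apply/(LpP _ _ p1').
have mO := measurable_rV_open oO.
split; first by apply/(measurable_restrictT _ _).1.
rewrite pint_patch//; apply: (@le_lt_trans _ _ (\int[leb]_(x in Omega) (`|C| `^ p)%:E)%E).
  apply: ge0_le_integral => //; first exact: measurable_normp.
  move=> x Ox; rewrite lee_fin; apply: ge0_ler_powR; rewrite ?nnegrE ?(ltW p0)//.
  by apply: le_trans (vC x Ox) _; exact: ler_norm.
rewrite integral_cst//; apply: lte_mul_pinfty; rewrite ?lee_fin ?powR_ge0//.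
apply: le_lt_trans (finite_leb_ball M0); apply: le_measure; rewrite ?inE//.
exact: measurable_ball.
Qed.

Lemma C1_Lp v : continuous v -> Lp Omega p v.
Proof.
move=> cv; have [C _ vC] := C1_bounded cv; apply: bounded_Lp vC.
by apply: measurable_funTS; exact: continuous_rV_measurable_fun.
Qed.

Definition Xcv v x : 'rV[R]_m := \row_j Xc v j x.

(** Works with an explicit representative [G] instead of the chosen [Xgrad], so that gradients of
    sums and multiples are given by formulas. *)
Definition hasX A u G := is_Xgrad c A u G /\
  forall A' j, open A' -> compactly_contained A' A -> Lp A' p (fun x => G x 0 j).

Lemma hasX_meas A u G j : hasX A u G -> measurable_fun A (fun x => G x 0 j).
Proof. by move=> [/(_ j)[[]]]. Qed.

Lemma measurable_density A G : open A -> A `<=` Omega ->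
  (forall j, measurable_fun A (fun x => G x 0 j)) ->
  measurable_fun A (fun x => a x + b * eucl_norm (G x) `^ p).
Proof.
move=> oA AO mG; have mA := measurable_rV_open oA; have mO := measurable_rV_open oO.
apply: measurable_funD; first exact: measurable_funS la.1.
apply: measurable_funM => //.
apply: (measurableT_comp (f := fun t : R => t `^ p)); first exact: measurable_powR.
exact: measurable_eucl.
Qed.

Lemma density_ge0 G x : Omega x -> 0 <= a x + b * eucl_norm (G x) `^ p.
Proof. by move=> Ox; rewrite addr_ge0 ?a0// mulr_ge0 ?powR_ge0// ltW. Qed.

Lemma En_ge0 U G : U `<=` Omega -> (0 <= En U G)%E.
Proof. by move=> UO; apply: integral_ge0 => x /UO Ux; rewrite lee_fin density_ge0. Qed.

Lemma ae_unique A u G G' : open A -> A `<=` Omega -> intg (u \_ Omega) -> is_Xgrad c A u G -> is_Xgrad c A u G' ->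
  {ae leb, forall x, A x -> G x = G' x}.
Proof.
move=> oA AO iu wG wG'.
have : {ae leb, forall x, forall j, A x -> G x 0 j = G' x 0 j}.
  apply: filter_forall => j; exact: (weak_X_unique oA AO iu (wG j) (wG' j)).
by apply: ae_mono => x H Ax; apply/rowP => j; exact: H.
Qed.

Lemma eq_En A G G' : open A -> A `<=` Omega -> (forall j, measurable_fun A (fun x => G x 0 j)) ->
  (forall j, measurable_fun A (fun x => G' x 0 j)) -> {ae leb, forall x, A x -> G x = G' x} ->
  En A G = En A G'.
Proof.
move=> oA AO mG mG' GG'; apply: ae_eq_integral.
- exact: measurable_rV_open.
- by apply/measurable_EFinP; exact: measurable_density.
- by apply/measurable_EFinP; exact: measurable_density.
- by move: GG'; apply: ae_mono => x H Ax; rewrite H.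
Qed.

(** The growth hypothesis speaks of the chosen representative [Xgrad]; uniqueness almost everywhere
    replaces it by the classical gradient. *)
Lemma upper_C1 v U : Ck 1 setT v -> open U -> U `<=` Omega -> (F v U <= En U (Xcv v))%E.
Proof.
move=> v1 oU UO; have cv : continuous v by move=> x; exact: Ck_cts v1 _.
have Lv := C1_Lp cv; have iv := Lp_intg p1' Lv.
have wv : is_Xgrad c U v (Xcv v).
  move=> j; have := C1_weak_X j oU UO v1.
  by rewrite (_ : (fun x => Xcv v x 0 j) = Xc v j)//; apply/funext => x; rewrite mxE.
have wX : is_Xgrad c U v (Xgrad c U v) := getPex (ex_intro _ _ wv).
apply: le_trans (Fub Lv (conj oU UO) (Ck_sub (subsetT U) v1)) _.
rewrite (eq_En oU UO _ _ (ae_unique oU UO iv wX wv))//.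
  by move=> j; have [[]] := wX j.
by move=> j; have [[]] := wv j.
Qed.

Lemma En_fin A U u G r : open A -> A `<=` Omega -> 0 < r -> hasX A u G -> open U -> U `<=` inset A r ->
  (\int[leb]_(x in U) (eucl_norm (G x) `^ p)%:E < +oo)%E /\ (En U G < +oo)%E.
Proof.
move=> oA AO r0 [wG LG] oU Ur; have mU := measurable_rV_open oU.
have rA : inset A r `<=` A by exact: inset_sub.
have UA := subset_trans Ur rA.
have mG j : measurable_fun U (fun x => G x 0 j).
  by apply: measurable_funS (wG j).1.1 => //; exact: measurable_rV_open.
have cI : compact (inset A r) by exact: (compact_insetO AO r0).
have I1 : (\int[leb]_(x in U) (eucl_norm (G x) `^ p)%:E < +oo)%E.
  have [k Ik] := compact_core oA cI rA.
  have mk : measurable (core A k) by apply: measurable_rV_open; exact: open_core.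
  have LU j := Lp_sub p1' mk mU (subset_trans Ur Ik) (LG _ j (@open_core A k) (core_contained k AO)).
  apply: (@le_lt_trans _ _ (\int[leb]_(x in U) ((m%:R `^ p)%:E * \sum_(j < m) (`|G x 0 j| `^ p)%:E))%E).
    apply: ge0_le_integral => //.
    - by move=> x _; rewrite lee_fin powR_ge0.
    - by apply/measurable_EFinP; apply: (measurableT_comp (f := fun t : R => t `^ p)); [exact: measurable_powR|exact: measurable_eucl].
    - apply: measurable_funeM; apply: emeasurable_sum => j; exact: measurable_normp.
    - by move=> x _; rewrite sumEFin -EFinM lee_fin eucl_powR_le.
  rewrite ge0_integralZl//; last 2 first.
  - by apply: emeasurable_sum => j; exact: measurable_normp.
  - by move=> x _; apply: sume_ge0 => j _; rewrite lee_fin powR_ge0.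
  apply: lte_mul_pinfty; rewrite ?lee_fin ?powR_ge0//.
  rewrite ge0_integral_sum//; last by move=> j; exact: measurable_normp.
  apply: lte_sum_pinfty => j _; rewrite -pint_patch//.
  by have [] := (LpP _ _ p1').1 (LU j).
split => //; under eq_integral do rewrite EFinD EFinM.
have ma : measurable_fun U (EFin \o a).
  by apply/measurable_EFinP; apply: measurable_funS la.1 => //; [exact: measurable_rV_open|exact: subset_trans AO].
have me : measurable_fun U (fun x => (eucl_norm (G x) `^ p)%:E).
  by apply/measurable_EFinP; apply: (measurableT_comp (f := fun t : R => t `^ p)); [exact: measurable_powR|exact: measurable_eucl].
rewrite ge0_integralD//.
- apply: lte_add_pinfty.
    apply: le_lt_trans (la.2 _ cI (subset_trans rA AO)).
    apply: (@le_trans _ _ (\int[leb]_(x in U) `|(a x)%:E|)%E).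
      apply: ge0_le_integral => //; [by move=> x /UA/AO; rewrite lee_fin; exact: a0| |].
        exact: measurableT_comp.
      by move=> x _; exact: lee_abs.
    apply: ge0_subset_integral => //; first exact: measurable_compact.
    apply: measurableT_comp => //; apply/measurable_EFinP; apply: measurable_funS la.1.
      exact: measurable_rV_open.
    exact: subset_trans AO.
  rewrite ge0_integralZl//; [|by move=> x _; rewrite lee_fin powR_ge0|by rewrite lee_fin ltW].
  by apply: lte_mul_pinfty => //; rewrite lee_fin ltW.
- by move=> x /UA/AO/a0; rewrite lee_fin.
- by move=> x _; rewrite -EFinM lee_fin mulr_ge0 ?powR_ge0// ltW.
- exact: measurable_funeM.
Qed.

Lemma measurable_eucl_powR U G : (forall j, measurable_fun U (fun x => G x 0 j)) ->
  measurable_fun U (fun x => (eucl_norm (G x) `^ p)%:E).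
Proof.
move=> mG; apply/measurable_EFinP; apply: (measurableT_comp (f := fun t : R => t `^ p)).
  exact: measurable_powR.
exact: measurable_eucl.
Qed.

(** Solves for the weight in [powRD_le] that puts the coefficient [1 + d] on the unperturbed
    term. *)
Lemma powR_split_ex (d : R) : 0 < d -> exists s : R, [/\ 0 < s, s < 1 & (1 - s) `^ (1 - p) = 1 + d].
Proof.
move=> d0; have d1 : 1 < 1 + d by rewrite ltrDl.
have q0 : 1 - p < 0 by rewrite subr_lt0.
exists (1 - (1 + d) `^ (1 - p)^-1).
have e1 : (1 + d) `^ (1 - p)^-1 < 1.
  have -> : (1 - p)^-1 = - (p - 1)^-1 by rewrite -invrN opprB.
  have q1 : 0 < (p - 1)^-1 by rewrite invr_gt0 subr_gt0.
  have d2 : 0 < 1 + d by rewrite addr_gt0.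
  rewrite powRN invf_lt1 ?powR_gt0//.
  have := gt0_ltr_powR q1 (ler01 : 1 \in Num.nneg) (ltW d2 : 1 + d \in Num.nneg) d1.
  by rewrite powR1.
split; first by rewrite subr_gt0.
  by rewrite ltrBlDr ltrDl powR_gt0// ltr_wpDl.
by rewrite opprB addrCA subrr addr0 -powRrM mulVf ?lt_eqF// powRr1// ltW// ltr_wpDl.
Qed.

(** By [powRD_le], [|G'|^p] is at most [(1 + d1) |G|^p] plus a constant times [|G' - G|^p]. The
    finite energy of [G] allows [d1] to be chosen so that the first excess costs at most [e / 2];
    the second is then controlled by the L^p distance. *)
Lemma En_cont U G : open U -> U `<=` Omega -> (forall j, measurable_fun U (fun x => G x 0 j)) ->
  (\int[leb]_(x in U) (eucl_norm (G x) `^ p)%:E < +oo)%E ->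
  forall e : R, 0 < e -> exists2 d : R, 0 < d & forall G',
    (forall j, measurable_fun U (fun x => G' x 0 j)) ->
    (forall j, (pint p ((fun x => G' x 0 j - G x 0 j)%R \_ U) <= d%:E)%E) ->
    (En U G' <= En U G + e%:E)%E.
Proof.
move=> oU UO mG IG e e0; have mU := measurable_rV_open oU.
set I := (\int[leb]_(x in U) _)%E in IG.
have I0 : (0 <= I)%E by apply: integral_ge0 => x _; rewrite lee_fin powR_ge0.
have IE : I = (fine I)%:E by rewrite fineK// ge0_fin_numE.
have fI0 : 0 <= fine I by rewrite fine_ge0.
pose d1 := e / 2 / (b * (fine I + 1)).
have d10 : 0 < d1 by rewrite !divr_gt0// mulr_gt0// ltr_wpDl.
have [s [s0 s1 sE]] := powR_split_ex d10.
pose K := b * (s `^ (1 - p) * m%:R `^ p).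
have K0 : 0 <= K by rewrite !mulr_ge0 ?powR_ge0// ltW.
exists (e / 2 / (K * m%:R + 1)) => [|G' mG' pG].
  by rewrite !divr_gt0// ltr_wpDl// mulr_ge0.
have Kd : K * (m%:R * (e / 2 / (K * m%:R + 1))) <= e / 2.
  have Km0 : 0 < K * m%:R + 1 by rewrite ltr_wpDl// mulr_ge0.
  have -> : K * (m%:R * (e / 2 / (K * m%:R + 1))) = e / 2 * (K * m%:R / (K * m%:R + 1)).
    by field; rewrite gt_eqF.
  by rewrite ler_piMr ?divr_ge0 ?(ltW e0)// ler_pdivrMr// mul1r lerDl.
move: (e / 2 / (K * m%:R + 1)) Kd pG => d Kd pG.
pose D x := \row_j (G' x 0 j - G x 0 j) : 'rV[R]_m.
have GD x : G' x = G x + D x by apply/rowP => j; rewrite !mxE addrC subrK.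
have DE j : (fun x => D x 0 j) = (fun x => G' x 0 j - G x 0 j).
  by apply/funext => x; rewrite mxE.
have mD j : measurable_fun U (fun x => D x 0 j) by rewrite DE; exact: measurable_funB.
clearbody D.
have mDp j : measurable_fun U (fun x => (`|D x 0 j| `^ p)%:E) by exact: measurable_normp.
have ma : measurable_fun U a by apply: measurable_funS la.1 => //; exact: measurable_rV_open.
have mdG : measurable_fun U (fun x => (a x + b * eucl_norm (G x) `^ p)%:E).
  by apply/measurable_EFinP; exact: measurable_density.
apply: (@le_trans _ _ (\int[leb]_(x in U) ((a x + b * eucl_norm (G x) `^ p)%:E +
    ((b * d1)%:E * (eucl_norm (G x) `^ p)%:E + K%:E * \sum_(j < m) (`|D x 0 j| `^ p)%:E)))%E).
  apply: ge0_le_integral.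
  - exact: mU.
  - by move=> x /UO Ox; rewrite lee_fin density_ge0.
  - by apply/measurable_EFinP; exact: measurable_density.
  - apply: (emeasurable_funD mdG); apply: emeasurable_funD.
      by apply: measurable_funeM; exact: measurable_eucl_powR.
    by apply: measurable_funeM; exact: emeasurable_sum.
  - move=> x Ux; rewrite sumEFin -!EFinM -!EFinD lee_fin -addrA lerD2l.
    have -> : b * eucl_norm (G x) `^ p + (b * d1 * eucl_norm (G x) `^ p + K * \sum_(j < m) `|D x 0 j| `^ p) =
      b * ((1 + d1) * eucl_norm (G x) `^ p + s `^ (1 - p) * (m%:R `^ p * \sum_(j < m) `|D x 0 j| `^ p)).
      by rewrite /K; ring.
    rewrite ler_wpM2l ?(ltW b0)// GD.
    apply: (@le_trans _ _ ((eucl_norm (G x) + eucl_norm (D x)) `^ p)).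
      apply: ge0_ler_powR; rewrite ?nnegrE ?(ltW p0) ?eucl_ge0//; last exact: eucl_triangle.
      by rewrite addr_ge0 ?eucl_ge0.
    apply: le_trans (powRD_le p1' s0 s1 (eucl_ge0 _) (eucl_ge0 _)) _.
    rewrite sE lerD2l ler_wpM2l ?powR_ge0//.
    exact: eucl_powR_le.
have mS : measurable_fun U (fun x => (\sum_(j < m) (`|D x 0 j| `^ p)%:E)%E) by exact: emeasurable_sum.
have S0 x : (0 <= \sum_(j < m) (`|D x 0 j| `^ p)%:E)%E.
  by apply: sume_ge0 => j _; rewrite lee_fin powR_ge0.
have m1 := measurable_funeM (b * d1)%:E (measurable_eucl_powR mG).
have m2 := measurable_funeM K%:E mS.
have bd0 : 0 <= b * d1 by rewrite mulr_ge0 ?(ltW d10) ?(ltW b0).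
have n1 x : (0 <= (b * d1)%:E * (eucl_norm (G x) `^ p)%:E)%E by rewrite mule_ge0// lee_fin ?powR_ge0.
have n2 x : (0 <= K%:E * \sum_(j < m) (`|D x 0 j| `^ p)%:E)%E by rewrite mule_ge0.
rewrite ge0_integralD//; [|by move=> x /UO Ox; rewrite lee_fin density_ge0
  |by move=> x _; exact: adde_ge0|exact: emeasurable_funD].
apply: leeD => //; rewrite ge0_integralD//.
rewrite ge0_integralZl//; [|exact: measurable_eucl_powR|by move=> x _; rewrite lee_fin powR_ge0].
rewrite ge0_integralZl// ge0_integral_sum//.
rewrite -/I IE -EFinM.
have SD : (\sum_(j < m) \int[leb]_(x in U) (`|D x 0 j| `^ p)%:E <= (m%:R * d)%:E)%E.
  apply: (@le_trans _ _ (\sum_(j < m) d%:E)%E); last by rewrite sumEFin sumr_const card_ord mulr_natl.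
  apply: lee_sum => j _; rewrite -pint_patch//; apply: le_trans (pG j).
  by rewrite DE.
have e2 : b * d1 * fine I <= e / 2.
  rewrite /d1; have -> : b * (e / 2 / (b * (fine I + 1))) * fine I = e / 2 * (fine I / (fine I + 1)).
    by field; rewrite !gt_eqF ?ltr_wpDl.
  by rewrite ler_piMr ?divr_ge0 ?(ltW e0)// ler_pdivrMr ?ltr_wpDl// mul1r lerDl.
apply: (@le_trans _ _ ((e / 2)%:E + (e / 2)%:E)%E); last by rewrite -EFinD -splitr.
apply: leeD; first by rewrite lee_fin.
apply: (@le_trans _ _ (K%:E * (m%:R * d)%:E)%E); last by rewrite -EFinM lee_fin.
by apply: lee_wpmul2l.
Qed.

Lemma approx A u G U r (e : R) : open A -> A `<=` Omega -> 0 < r -> Lp Omega p u -> hasX A u G ->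
  open U -> U `<=` inset A r -> 0 < e -> exists v, [/\ Ck 1 setT v,
    (pint p ((v \- u)%R \_ Omega) <= e%:E)%E &
    forall j, (pint p ((fun x => Xcv v x 0 j - G x 0 j)%R \_ U) <= e%:E)%E].
Proof.
move=> oA AO r0 Lu hG oU Ur e0; have mU := measurable_rV_open oU.
have mGA j : measurable_fun A (fun x => G x 0 j) by exact: hasX_meas hG.
have [v [v1 vu vG]] := friedrichs p1' oA AO Lu hG.1 hG.2 r0 e0.
have cv : continuous v by move=> x; exact: Ck_cts v1 _.
exists v; split => // [|j].
  have [mu _] := (LpP _ _ p1').1 Lu.
  have mv := continuous_rV_measurable_fun cv.
  apply: le_trans vu; apply: le_pint => //.
  + rewrite (_ : (v \- u) \_ Omega = (fun x => v x - (u \_ Omega) x) \_ Omega).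
      by apply/(measurable_restrictT _ _).1; [exact: measurable_rV_open|apply: measurable_funTS; exact: measurable_funB].
    by apply/funext => x; rewrite !patchE; case: ifP => //= ->.
  + exact: measurable_funB.
  + by move=> x; rewrite !patchE; case: ifP => //= _; rewrite normr0.
apply: le_trans (vG j).
have mI : measurable (inset A r) by apply: closed_rV_measurable; exact: closed_inset.
have mB B : measurable B -> B `<=` A -> measurable_fun B (fun x => Xc v j x - G x 0 j).
  move=> mB BA; apply: measurable_funB; last by apply: measurable_funS (mGA j) => //; exact: measurable_rV_open.
  by apply: measurable_funS (measurable_Xc j v1 oA AO) => //; exact: measurable_rV_open.
rewrite (pint_patch _ mU) (pint_patch _ mI).
apply: (@le_trans _ _ (\int[leb]_(x in U) (`|Xc v j x - G x 0 j| `^ p)%:E)%E).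
  by rewrite (eq_integral (fun x => (`|Xc v j x - G x 0 j| `^ p)%:E)); [exact: lexx|move=> x _; rewrite mxE].
apply: ge0_subset_integral => //; apply: measurable_normp; apply: mB => //; exact: inset_sub.
Qed.

Lemma measurable_Xcv U v j : Ck 1 setT v -> open U -> U `<=` Omega -> measurable_fun U (fun x => Xcv v x 0 j).
Proof.
move=> v1 oU UO; apply: (eq_measurable_fun (Xc v j)); first by move=> x _; rewrite mxE.
exact: measurable_Xc.
Qed.

Lemma upper A u G U r : open A -> A `<=` Omega -> 0 < r -> Lp Omega p u -> hasX A u G ->
  open U -> U `<=` inset A r -> (F u U <= En U G)%E.
Proof.
move=> oA AO r0 Lu hG oU Ur.
have UA : U `<=` A by apply: subset_trans Ur _; exact: inset_sub.
have UO := subset_trans UA AO.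
have mG j : measurable_fun U (fun x => G x 0 j).
  by apply: measurable_funS (hasX_meas j hG) => //; exact: measurable_rV_open.
have [IG _] := En_fin oA AO r0 hG oU Ur.
apply: lsc_le => // [|e e0]; first exact: En_ge0.
have [d d0 Hd] := En_cont oU UO mG IG e0.
have ed0 : 0 < Num.min e d by rewrite lt_min e0 d0.
have [v [v1 vu vG]] := approx oA AO r0 Lu hG oU Ur ed0.
exists v; split; first by apply: C1_Lp => x; exact: Ck_cts v1 _.
  by apply: le_trans vu _; rewrite lee_fin ge_min lexx.
apply: le_trans (upper_C1 v1 oU UO) _; apply: Hd => j; first exact: measurable_Xcv.
by apply: le_trans (vG j) _; rewrite lee_fin ge_min lexx orbT.
Qed.

(** * Convexity along smooth directions *)

Lemma Ck_comp v (h dh : R -> R) : Ck 1 setT v -> (forall t : R, is_derive t (1 : R) h (dh t)) -> continuous dh ->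
  Ck 1 setT (fun x => h (v x)) /\ forall i x, partial i (fun x => h (v x)) x = dh (v x) * partial i v x.
Proof.
move=> v1 hd cdh; have ch : continuous h.
  by move=> t; apply: differentiable_continuous; apply/derivable1_diffP; have [] := hd t.
have D i x : is_derive x (delta_mx 0 i) (fun x => h (v x)) (dh (v x) * partial i v x).
  apply: is_derive_lineP.
  have dv : is_derive (0 : R) (1 : R) (fun s : R => v (x + s *: delta_mx 0 i)) (partial i v x).
    split; first by rewrite derivable_line scale0r addr0; exact: Ck_derivable v1 _.
    by rewrite -derive1E derive_line scale0r addr0.
  have := @is_derive1_comp R h (fun s : R => v (x + s *: delta_mx 0 i)) 0 _ _ (hd _) dv.
  by rewrite scale0r addr0.
have E i x : partial i (fun x => h (v x)) x = dh (v x) * partial i v x.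
  by rewrite /partial; have [_ ->] := D i x.
split; last exact: E.
split.
  by move=> x _; apply: cts_comp; [exact: Ck_cts v1 _|exact: ch].
move=> i; split; first by move=> x _; have [] := D i x.
split; last by [].
move=> x _; apply: (@cts_ext _ _ (fun x => dh (v x) * partial i v x)).
  by move=> y; rewrite E.
apply: ctsM; last exact: Ck_cts (Ck_partial i v1) _.
by apply: cts_comp; [exact: Ck_cts v1 _|exact: cdh].
Qed.

Lemma hasX_lin A u w G H (k : R) : open A -> A `<=` Omega -> Lp Omega p u -> Lp Omega p w ->
  hasX A u G -> hasX A w H -> hasX A (fun x => u x + k * w x) (fun x => G x + k *: H x).
Proof.
move=> oA AO Lu Lw [wG LG] [wH LH].
have E j : (fun x => (G x + k *: H x) 0 j) = fun x => G x 0 j + k * H x 0 j.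
  by apply/funext => x; rewrite !mxE.
split=> [j|A' j oA' AA']; rewrite E.
  exact: (weak_X_lin k oA AO (Lp_intg p1' Lu) (Lp_intg p1' Lw) (wG j) (wH j)).
by apply: Lp_add; [exact: LG|exact: LH].
Qed.

Lemma hasX_C1 A v : open A -> A `<=` Omega -> Ck 1 setT v -> hasX A v (Xcv v).
Proof.
move=> oA AO v1; have E j : (fun x => Xcv v x 0 j) = Xc v j by apply/funext => x; rewrite mxE.
split=> [j|A' j oA' [cA' A'A]]; rewrite E; first exact: C1_weak_X.
have cX x : closure A' x -> {for x, continuous (Xc v j)} by move=> /A'A/AO; exact: Xc_continuous.
have [C C0 vC] := cts_compact_bounded cA' cX.
have A'O : A' `<=` Omega by apply: subset_trans AO; apply: subset_trans A'A; exact: subset_closure.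
have mA' := measurable_rV_open oA'.
have : Lp A' p ((Xc v j) \_ A').
  apply: (Lp_sub p1' (measurable_rV_open oO) mA' A'O); apply: (@bounded_Lp _ C).
    apply: measurable_funTS; apply/(measurable_restrictT _ _).1 => //; exact: measurable_Xc.
  move=> x _; rewrite patchE; case: ifPn => [|_]; last by rewrite normr0 ltW.
  rewrite inE => A'x; apply: vC; exact: subset_closure.
move=> /(LpP _ _ p1') H; apply/(LpP _ _ p1'); move: H.
rewrite (_ : ((Xc v j) \_ A') \_ A' = (Xc v j) \_ A')//.
apply/funext => x; rewrite patchE; case: ifPn => // xA'.
by rewrite patchE (negbTE xA').
Qed.

(** No point is counted more than [C] times. It serves with [f = 1] for the values of [F] on strips
    and with the energy density for the transitions. *)
Lemma overlap (mu : {measure set 'rV[R]_n -> \bar R}) U (M : nat) (S : nat -> set 'rV[R]_n)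
    (f : 'rV[R]_n -> \bar R) (C : R) : measurable U -> (forall k, measurable (S k)) -> (forall k, S k `<=` U) ->
  measurable_fun U f -> (forall x, U x -> (0 <= f x)%E) -> 0 <= C ->
  (forall x, \sum_(k < M) (\1_(S k) x : R) <= C) ->
  (\sum_(k < M) \int[mu]_(x in S k) f x <= C%:E * \int[mu]_(x in U) f x)%E.
Proof.
move=> mU mS SU mf f0 C0 SC.
have E (k : nat) : (\int[mu]_(x in S k) f x = \int[mu]_(x in U) (f x * (\1_(S k) x)%:E))%E.
  rewrite integral_mkcond [RHS]integral_mkcond; apply: eq_integral => x _.
  rewrite !patchE indicE; case: (boolP (x \in S k)) => [|_] /=.
    by rewrite inE => /SU Ux; rewrite ifT ?mule1// inE.
  by case: ifP; rewrite ?mule0.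
under eq_bigr do rewrite E.
have mfS (k : nat) : measurable_fun U (fun x => (f x * (\1_(S k) x)%:E)%E).
  apply: emeasurable_funM => //; apply/measurable_EFinP; apply: measurable_funTS.
  exact: measurable_indic.
rewrite -ge0_integral_sum//; last by move=> k x Ux; rewrite mule_ge0 ?f0// lee_fin.
rewrite -ge0_integralZl//.
apply: ge0_le_integral => //.
- by move=> x Ux; apply: sume_ge0 => k _; rewrite mule_ge0 ?f0// lee_fin.
- exact: emeasurable_sum.
- exact: measurable_funeM.
- move=> x Ux; rewrite -ge0_sume_distrr; last by move=> k _; rewrite lee_fin.
  rewrite sumEFin muleC; apply: lee_wpmul2r; first exact: f0.
  by rewrite lee_fin.
Qed.

(** Division with remainder by [N]: step [i] and phase [th] merge into the single index
    [i * N + th]. *)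
Lemma sum_divn (N J : nat) (s : nat -> \bar R) :
  (\sum_(th < N) \sum_(i < J) s (i * N + th)%N = \sum_(k < J * N) s k)%E.
Proof.
elim: J => [|J IH].
  by rewrite big1 ?mul0n ?big_ord0// => th _; rewrite big_ord0.
under eq_bigr do rewrite big_ord_recr/=.
rewrite big_split/= IH mulSn addnC -!(big_mkord xpredT (fun k => s k)).
have E : (\sum_(J * N <= k < J * N + N) s k = \sum_(th < N) s (J * N + th)%N)%E.
  rewrite -{1}(add0n (J * N)%N) big_addn addnC addnK big_mkord.
  by apply: eq_bigr => th _; rewrite addnC.
by rewrite -E; apply/esym; apply: big_cat_nat; rewrite ?leq_addr.
Qed.

(** The staircase construction at fixed resolution: [N] is the period in units of [1 / ka], and the
    phases are the integers below [N]. Raising [N] lowers the cost of the transitions, raising [ka]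
    lowers the uniform distance to [u + t v]; the two parameters are independent, so both errors can
    be made small. *)
Lemma conv_step A u G U r v (t : R) (N : nat) (ka : R) : open A -> A `<=` Omega -> 0 < r ->
  Lp Omega p u -> hasX A u G -> open U -> U `<=` inset A r -> Ck 1 setT v ->
  1 <= t * N%:R -> t * N%:R + 1 <= N%:R -> 0 < ka ->
  exists w, [/\ Lp Omega p w,
    (forall x, Omega x -> `|w x - (u x + t * v x)| <= 2 * N%:R / ka) &
    (F w U <= t%:E * F (fun x => u x + v x)%R U + (1 - t)%:E * F u U +
       (8 / N%:R)%:E * ((2^-1 `^ (1 - p))%:E * (En U G + En U (Xcv v))))%E].
Proof.
move=> oA AO r0 Lu hG oU Ur v1 tN tN1 ka0.
have UA : U `<=` A by apply: subset_trans Ur _; exact: inset_sub.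
have UO := subset_trans UA AO; have mU := measurable_rV_open oU.
have cv : continuous v by move=> x; exact: Ck_cts v1 _.
have Lv := C1_Lp cv.
have [V V0 vV] := C1_bounded cv.
pose l := t * N%:R; pose Nr : R := N%:R.
have Nr0 : 0 < Nr by rewrite /Nr; lra.
have lN : l / Nr = t by rewrite /l mulfK// gt_eqF.
have t0 : 0 < t by rewrite -lN divr_gt0// (lt_le_trans ltr01).
have t1 : t < 1 by rewrite -lN ltr_pdivrMr// mul1r /l /Nr; lra.
(* On [Omega] the variable [y] lies between [Nr] and [2 ka V + Nr], so after subtraction of any
   phase it stays nonnegative and within the [J] periods. *)
pose Y0 := ka * V + Nr.
pose y x := ka * v x + Y0.
pose J := (Num.truncn ((2 * (ka * V) + Nr) / Nr)).+1.
have JN : 2 * (ka * V) + Nr < J%:R * Nr by rewrite -ltr_pdivrMr// truncnS_gt.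
have kv x : Omega x -> `|ka * v x| <= ka * V.
  by move=> Ox; rewrite normrM gtr0_norm// ler_wpM2l ?(ltW ka0)// vV.
(* As a function of [y] the staircase has mean slope [t]; removing [t * Y0] and dividing by [ka]
   makes it close to [t v]. The staircase and the phase each contribute at most [N / ka] to the
   distance. *)
pose h (th : nat) (s : R) := (stair l Nr J (ka * s + (Y0 - th%:R)) - t * Y0) / ka.
pose dh (th : nat) (s : R) := dstair l Nr J (ka * s + (Y0 - th%:R)).
have aff (th : nat) (s : R) : is_derive s (1 : R) (fun s : R => ka * s + (Y0 - th%:R)) ka.
  have c1 : is_derive s (1 : R) (fun=> ka) 0 by exact: is_derive_cst.
  have c2 : is_derive s (1 : R) (fun=> Y0 - th%:R) 0 by exact: is_derive_cst.
  have c3 : is_derive s (1 : R) (fun s : R => s) 1 by exact: is_derive_id.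
  by apply: is_derive_eq (dR_D (dR_M c1 c3) c2) _; ring.
have hd (th : nat) (s : R) : is_derive s (1 : R) (h th) (dh th s).
  have d1 := @is_derive1_comp R (stair l Nr J) (fun s : R => ka * s + (Y0 - th%:R)) s _ _ (is_derive_stair _ _ _ _) (aff th s).
  have c1 : is_derive s (1 : R) (fun=> t * Y0) 0 by exact: is_derive_cst.
  have c2 : is_derive s (1 : R) (fun=> ka^-1) 0 by exact: is_derive_cst.
  apply: is_derive_eq (dR_M (dR_B d1 c1) c2) _.
  by rewrite subr0 mulr0 addr0 mulfK// gt_eqF.
have cdh (th : nat) : continuous (dh th).
  move=> s; apply: (@continuous_comp _ _ _ (fun s : R => ka * s + (Y0 - th%:R)) (dstair l Nr J)).
    by apply: differentiable_continuous; apply/derivable1_diffP; have [] := aff th s.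
  exact: dstair_continuous.
pose w (th : nat) x := u x + 1 * h th (v x).
have hv1 th := (Ck_comp v1 (hd th) (cdh th)).1.
have hvE th := (Ck_comp v1 (hd th) (cdh th)).2.
have Lw th : Lp Omega p (w th).
  by apply: Lp_add => //; apply: C1_Lp => x; exact: Ck_cts (hv1 th) _.
have hXw th : hasX A (w th) (fun x => G x + 1 *: Xcv (fun x => h th (v x)) x).
  by apply: hasX_lin => //; [apply: C1_Lp => x; exact: Ck_cts (hv1 th) _|exact: hasX_C1].
have yth x (th : 'I_N) : Omega x -> 0 <= y x - th%:R < J%:R * Nr.
  move=> Ox; have thN : (th%:R : R) <= Nr by rewrite /Nr ler_nat ltnW.
  have th0 : 0 <= th%:R :> R by [].
  by have := kv x Ox; rewrite ler_norml /y /Y0 => /andP[? ?]; lra.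
have hyE (th : nat) x : h th (v x) = (stair l Nr J (y x - th%:R) - t * Y0) / ka.
  by rewrite /h /y addrA.
have dhyE (th : nat) x : dh th (v x) = dstair l Nr J (y x - th%:R).
  by rewrite /dh /y addrA.
(* With [k = i * N + th], the number [y - k] is the position inside step [i] of the staircase with
   phase [th]. Strips are open because [F] is only given on open sets. *)
pose St (al be : R) (k : nat) := U `&` (fun x => y x - k%:R) @^-1` `]al, be[%classic.
have oSt al be k : open (St al be k).
  apply: openI => //; apply: open_comp; last exact: interval_open.
  move=> x _; apply: ctsB; last exact: cts_cst.
  by apply: ctsD; [apply: ctsM; [exact: cts_cst|exact: cv]|exact: cts_cst].
have StU al be k : St al be k `<=` U by move=> x [].
have StO al be k : open_subsets Omega (St al be k).
  by split; [exact: oSt|exact: subset_trans UO].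
have mSt al be k : measurable (St al be k) by exact: measurable_rV_open.
have Stk al be (i : nat) (th : nat) x : St al be (i * N + th)%N x -> al < y x - th%:R - i%:R * Nr < be.
  move=> [_]; rewrite /= in_itv/= natrD natrM => H.
  by rewrite -addrA -opprD [th%:R + _]addrC.
have good (i : 'I_J) (th : 'I_N) : F (w th) (St 1 l (i * N + th)%N) = F (fun x => u x + v x) (St 1 l (i * N + th)%N).
  pose k0 := (i%:R * l + (Y0 - th%:R - i%:R * Nr) - 2^-1 - t * Y0) / ka.
  have Luv : Lp Omega p (fun x => u x + v x).
    by have := Lp_add 1 Lu Lv; congr Lp; apply/funext => x; rewrite mul1r.
  have Luvk : Lp Omega p (fun x => u x + v x + k0).
    have := Lp_add 1 Luv (C1_Lp (@cts_cst _ _ k0)); congr Lp; apply/funext => x.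
    by rewrite mul1r.
  rewrite -(Ftr k0 Luv (StO _ _ _)); apply: Floc => //.
  apply: aeW => x Sx; have /andP[S1 S2] := Stk _ _ _ _ _ Sx.
  have i0 : i%:R * Nr <= y x - th%:R by lra.
  have i1 : y x - th%:R <= i.+1%:R * Nr by rewrite -addn1 natrD mulrDl mul1r; move: S2; rewrite /l /Nr; lra.
  rewrite /w hyE (stair_cell tN tN1 (ltn_ord i) i0 i1).1 (block_mid (ltW S1) (ltW S2)).1 mul1r -[u x + v x + k0]addrA; congr (_ + _).
  by rewrite /k0 /y /l /Nr; field; rewrite gt_eqF.
have bad (i : 'I_J) (th : 'I_N) : F (w th) (St (l + 1) Nr (i * N + th)%N) = F u (St (l + 1) Nr (i * N + th)%N).
  pose k0 := (i%:R * l + l - t * Y0) / ka.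
  have Luk : Lp Omega p (fun x => u x + k0).
    have := Lp_add 1 Lu (C1_Lp (@cts_cst _ _ k0)); congr Lp; apply/funext => x.
    by rewrite mul1r.
  rewrite -(Ftr k0 Lu (StO _ _ _)); apply: Floc => //.
  apply: aeW => x Sx; have /andP[S1 S2] := Stk _ _ _ _ _ Sx.
  have i0 : i%:R * Nr <= y x - th%:R by move: tN S1; rewrite /l; lra.
  have i1 : y x - th%:R <= i.+1%:R * Nr by rewrite -addn1 natrD mulrDl mul1r; lra.
  by rewrite /w hyE (stair_cell tN tN1 (ltn_ord i) i0 i1).1 (block_ge tN (ltW S1)).1 mul1r.
(* Since the slope of the staircase stays in [[0, 1]], this bounds the energy density of every
   [w th], whatever the phase; it is [powRD_le] with equal weights. *)
pose M x : \bar R := ((2^-1 `^ (1 - p))%:E * ((a x + b * eucl_norm (G x) `^ p)%:E + (a x + b * eucl_norm (Xcv v x) `^ p)%:E))%E.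
have mGA j : measurable_fun A (fun x => G x 0 j) by exact: hasX_meas hG.
have mvA j : measurable_fun A (fun x => Xcv v x 0 j) by exact: hasX_meas (hasX_C1 oA AO v1).
have mA := measurable_rV_open oA.
have md G0 : (forall j, measurable_fun A (fun x => G0 x 0 j)) ->
    measurable_fun U (fun x => (a x + b * eucl_norm (G0 x) `^ p)%:E).
  move=> mG0; apply/measurable_EFinP; apply: measurable_density => // j.
  exact: measurable_funS (mG0 j).
have h0 : 0 <= 2^-1 `^ (1 - p) :> R by rewrite powR_ge0.
have h1 : 1 <= 2^-1 `^ (1 - p) :> R.
  have := @ger_powR R 2^-1 _ (1 - p) 0; rewrite powRr0; apply; last by rewrite subr_le0 ltW.
  by rewrite invr_gt0 ltr0n/= invf_le1// ler1n.
have Mge0 x : U x -> (0 <= M x)%E.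
  by move=> /UO Ox; rewrite /M -EFinD -EFinM lee_fin mulr_ge0// addr_ge0 ?density_ge0.
have mM : measurable_fun U M by apply: measurable_funeM; apply: emeasurable_funD; exact: md.
have trans (S : set 'rV[R]_n) (th : 'I_N) : open S -> S `<=` U -> (F (w th) S <= \int[leb]_(x in S) M x)%E.
  move=> oS SU; apply: le_trans (upper oA AO r0 (Lw th) (hXw th) oS (subset_trans SU Ur)) _.
  have mS := measurable_rV_open oS.
  apply: ge0_le_integral.
  - exact: mS.
  - move=> x /SU/UO Ox; rewrite lee_fin.
    exact: (density_ge0 (fun x => G x + 1 *: Xcv (fun x => h th (v x)) x) Ox).
  - apply/measurable_EFinP; apply: (@measurable_density S (fun x => G x + 1 *: Xcv (fun x => h th (v x)) x)) => //; first exact: subset_trans UO.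
    move=> j; apply: measurable_funS (hasX_meas j (hXw th)) => //; exact: subset_trans UA.
  - exact: measurable_funS mM.
  - move=> x /SU Ux; have Ox := UO _ Ux; rewrite /M -EFinD -EFinM lee_fin.
    have E : Xcv (fun x => h th (v x)) x = dh th (v x) *: Xcv v x.
      apply/rowP => j; rewrite !mxE /Xc mulr_sumr; apply: eq_bigr => i _.
      by rewrite hvE mulrCA.
    have [_ /andP[D0 D1]] := stair_near tN tN1 (proj1 (andP (yth x th Ox))) (proj2 (andP (yth x th Ox))).
    rewrite scale1r E dhyE.
    apply: (@le_trans _ _ (a x + b * (eucl_norm (G x) + eucl_norm (Xcv v x)) `^ p)).
      rewrite lerD2l ler_wpM2l ?(ltW b0)//; apply: ge0_ler_powR; rewrite ?nnegrE ?(ltW p0) ?addr_ge0 ?eucl_ge0//.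
      apply: le_trans (eucl_triangle _ _) _; rewrite lerD2l eucl_normZ ger0_norm//.
      by rewrite ler_piMl ?eucl_ge0.
    have s0 : 0 < 2^-1 :> R by [].
    have s1 : 2^-1 < 1 :> R by rewrite invf_lt1// ltr1n.
    have := powRD_le p1' s0 s1 (eucl_ge0 (G x)) (eucl_ge0 (Xcv v x)).
    have -> : 1 - 2^-1 = 2^-1 :> R by field.
    move: h1 (a0 Ox) (b0); move: (2^-1 `^ (1 - p)) ((_ + _) `^ p) (eucl_norm (G x) `^ p) (eucl_norm (Xcv v x) `^ p) => K X P Q K1 ax bb XP.
    have : b * X <= b * (K * P + K * Q) by rewrite ler_wpM2l// ltW.
    have : a x <= K * (a x) by rewrite ler_peMl.
    have : 0 <= K * a x by rewrite mulr_ge0// (le_trans ler01).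
    lra.
have Luv : Lp Omega p (fun x => u x + v x).
  by have := Lp_add 1 Lu Lv; congr Lp; apply/funext => x; rewrite mul1r.
have [mu1 mu1E] := Fmeas Luv; have [mu0 mu0E] := Fmeas Lu.
(* Where the slope is one, where it is zero, and around the two transitions [[0, 1]] and
   [[l, l + 1]]. The last two are widened so that the four open families cover [U], endpoints
   included. *)
pose S1 := St 1 l; pose S2 := St (l + 1) Nr; pose S3 := St (-1) 2; pose S4 := St (l - 1) (l + 2).
have [I3 I3E] : exists I : nat -> \bar R, forall k, I k = (\int[leb]_(x in S3 k) M x)%E by eexists.
have [I4 I4E] : exists I : nat -> \bar R, forall k, I k = (\int[leb]_(x in S4 k) M x)%E by eexists.
pose T (k : nat) : \bar R := (mu1 (S1 k) + mu0 (S2 k) + (I3 k + I4 k))%E.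
have Fth (th : 'I_N) : (F (w th) U <= \sum_(i < J) T (i * N + th)%N)%E.
  have [mw mwE] := Fmeas (Lw th).
  pose C (i : nat) := (S1 (i * N + th)%N `|` S2 (i * N + th)%N) `|` (S3 (i * N + th)%N `|` S4 (i * N + th)%N).
  have mC (i : nat) : measurable (C i) by apply: measurableU; apply: measurableU; exact: mSt.
  rewrite (mwE _ (conj oU UO)).
  have UC : U `<=` \big[setU/set0]_(i < J) C i.
    move=> x Ux; have /andP[y0 yJ] := yth x th (UO _ Ux).
    have [i iJ /andP[i1 i2]] := cell_ex Nr0 y0 yJ.
    rewrite -bigcup_mkord; exists i => //.
    move: i2; rewrite -addn1 natrD mulrDl mul1r => i2.
    have Sx al be : al < y x - th%:R - i%:R * Nr < be -> St al be (i * N + th)%N x.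
      move=> H; split => //; rewrite /= in_itv/= natrD natrM.
      by move: H; rewrite -addrA -opprD [th%:R + _]addrC.
    rewrite /C /=; have [z1|z1] := leP (y x - th%:R - i%:R * Nr) 1.
      by right; left; apply: Sx; apply/andP; split; lra.
    have [z2|z2] := ltP (y x - th%:R - i%:R * Nr) l.
      by left; left; apply: Sx; rewrite z1 z2.
    have [z3|z3] := leP (y x - th%:R - i%:R * Nr) (l + 1).
      by right; right; apply: Sx; apply/andP; split; lra.
    by left; right; apply: Sx; rewrite z3/=; lra.
  apply: (@le_trans _ _ (mw (\big[setU/set0]_(i < J) C i))).
    by apply: le_measure; rewrite ?inE//; exact: bigsetU_measurable.
  have LB : (mw (\big[setU/set0]_(i < J) C i) <= \sum_(i < J) mw (C i))%E by apply: le_mu_bigsetU => i _; exact: mC.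
  have MU2 B D : measurable B -> measurable D -> (mw (B `|` D) <= mw B + mw D)%E by exact: measureU2.
  apply: le_trans LB _.
  apply: lee_sum => i _; rewrite /C /T.
  apply: le_trans (MU2 _ _ _ _) _; [by apply: measurableU; exact: mSt..|].
  apply: leeD.
    apply: le_trans (MU2 _ _ (mSt _ _ _) (mSt _ _ _)) _.
    have <- : mw (S1 (i * N + th)%N) = mu1 (S1 (i * N + th)%N).
      by rewrite -(mwE _ (StO _ _ _)) -(mu1E _ (StO _ _ _)); exact: good.
    have <- : mw (S2 (i * N + th)%N) = mu0 (S2 (i * N + th)%N).
      by rewrite -(mwE _ (StO _ _ _)) -(mu0E _ (StO _ _ _)); exact: bad.
    exact: lexx.
  apply: le_trans (MU2 _ _ (mSt _ _ _) (mSt _ _ _)) _.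
  by rewrite -!(mwE _ (StO _ _ _)) I3E I4E; apply: leeD; exact: trans.
(* For [S1] and [S2] the bound is exactly [l] and [Nr - l]: leaving out the transitions compensates
   the extra 1. For [S3] and [S4] it is 4 each, whence the constant 8. *)
have cnt al be x : al <= be -> \sum_(k < J * N) (\1_(St al be k) x : R) <= be - al + 1.
  move=> ab; apply: le_trans (count_itv (y x) (J * N) ab); apply: ler_sum => k _.
  rewrite indicE; case: (boolP (x \in _)) => [|_]; last by rewrite ler0n.
  by rewrite inE => -[_]; rewrite /= in_itv/= => ->.
have sumT : (\sum_(k < J * N) T k <= l%:E * F (fun x => u x + v x)%R U + (Nr - l)%:E * F u U +
    8%:E * ((2^-1 `^ (1 - p))%:E * (En U G + En U (Xcv v))))%E.
  have IM : (\int[leb]_(x in U) M x = (2^-1 `^ (1 - p))%:E * (En U G + En U (Xcv v)))%E.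
    rewrite ge0_integralZl//; last 2 first.
    - by apply: emeasurable_funD; exact: md.
    - by move=> x /UO Ox; rewrite -EFinD lee_fin addr_ge0 ?density_ge0.
    rewrite ge0_integralD//.
    - by move=> x /UO Ox; rewrite lee_fin density_ge0.
    - exact: md.
    - by move=> x /UO Ox; rewrite lee_fin density_ge0.
    - exact: md.
  have mu_le (mu : {measure set 'rV[R]_n -> \bar R}) al be (C : R) : al <= be -> be - al + 1 <= C ->
      (\sum_(k < J * N) mu (St al be k) <= C%:E * mu U)%E.
    move=> ab abC; have C0 : 0 <= C by lra.
    have := @overlap mu U (J * N) (St al be) (cst 1%E) C mU (mSt al be) (StU al be) (measurable_cst _) (fun _ _ => lee01) C0.
    rewrite integral_cst// mul1e; under eq_bigr do rewrite integral_cst// mul1e.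
    by apply=> x; apply: le_trans (cnt al be x ab) abC.
  have M_le al be (C : R) : al <= be -> be - al + 1 <= C ->
      (\sum_(k < J * N) \int[leb]_(x in St al be k) M x <= C%:E * \int[leb]_(x in U) M x)%E.
    move=> ab abC; have C0 : 0 <= C by lra.
    apply: overlap => // x; exact: le_trans (cnt al be x ab) abC.
  rewrite /T !big_split/= -IM (mu1E _ (conj oU UO)) (mu0E _ (conj oU UO)).
  apply: leeD; first apply: leeD.
  - by apply: mu_le; rewrite /l; lra.
  - by apply: mu_le; rewrite /l /Nr; lra.
  have IM0 : (0 <= \int[leb]_(x in U) M x)%E by exact: integral_ge0.
  apply: (@le_trans _ _ (4%:E * \int[leb]_(x in U) M x + 4%:E * \int[leb]_(x in U) M x)%E).
    apply: leeD.
      by under eq_bigr do rewrite I3E; apply: M_le; lra.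
    by under eq_bigr do rewrite I4E; apply: M_le; rewrite /l; lra.
  rewrite -ge0_muleDl ?lee_fin// -EFinD (_ : 4 + 4 = 8 :> R)//; ring.
have N0 : (0 < N)%N by rewrite -(ltr_nat R).
(* The phase with the least value of [F] does at most as badly as the mean over all phases; the
   estimate is proved after multiplication by [N]. *)
have [th0 _ th0P] := @arg_minP _ (\bar R) 'I_N (Ordinal N0) predT (fun th => F (w th) U) isT.
exists (w th0); split; first exact: Lw.
  move=> x Ox; rewrite /w hyE mul1r opprD addrACA subrr add0r.
  have /andP[y0 yJ] := yth x th0 Ox.
  have [sn _] := stair_near tN tN1 y0 yJ.
  have -> : (stair l Nr J (y x - th0%:R) - t * Y0) / ka - t * v x =
      ((stair l Nr J (y x - th0%:R) - l / Nr * (y x - th0%:R)) - t * th0%:R) / ka.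
    by rewrite lN /y; field; rewrite gt_eqF.
  rewrite normrM normfV (gtr0_norm ka0) ler_pM2r ?invr_gt0//.
  apply: le_trans (ler_normB _ _) _; rewrite mulrDl mul1r lerD//.
  rewrite ger0_norm; last by rewrite mulr_ge0 ?(ltW t0).
  by apply: (@le_trans _ _ (1 * th0%:R)); [rewrite ler_wpM2r ?(ltW t1)|rewrite mul1r ler_nat ltnW].
rewrite -(@lee_pmul2l _ Nr%:E)// ?lte_fin//.
have X1 : (0 <= F (fun x => u x + v x)%R U)%E by apply: F0.
have X0 : (0 <= F u U)%E by apply: F0.
have X2 : (0 <= (2^-1 `^ (1 - p))%:E * (En U G + En U (Xcv v)))%E.
  by rewrite mule_ge0 ?lee_fin// adde_ge0// En_ge0.
have tt0 : (0 <= (1 - t)%:E)%E by rewrite lee_fin subr_ge0 ltW.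
have N8 : (0 <= (8 / Nr)%:E)%E by rewrite lee_fin divr_ge0 ?(ltW Nr0).
rewrite ge0_muleDr; [|by rewrite adde_ge0// mule_ge0// lee_fin ltW|by rewrite mule_ge0].
rewrite ge0_muleDr; [|by rewrite mule_ge0// lee_fin ltW|by rewrite mule_ge0].
rewrite !muleA -!EFinM.
have -> : Nr * t = l by rewrite mulrC.
have -> : Nr * (1 - t) = Nr - l by rewrite /l /Nr; ring.
have -> : Nr * (8 / Nr) = 8 by field; rewrite gt_eqF.
rewrite EFinM -muleA; apply: le_trans sumT.
have sum_cst (X : \bar R) (K : nat) : (0 <= X)%E -> ((K%:R)%:E * X = \sum_(th < K) X)%E.
  move=> XX; elim: K => [|K IH]; first by rewrite big_ord0 mul0e.
  by rewrite big_ord_recr/= -IH -addn1 natrD EFinD ge0_muleDl ?lee_fin// mul1e.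
rewrite -sum_divn sum_cst; last by apply: F0.
apply: lee_sum => th _; apply: le_trans (Fth th).
exact: th0P.
Qed.

Lemma pint_Omega_le u (s : R) : measurable_fun Omega u -> 0 <= s -> (forall x, Omega x -> `|u x| <= s) ->
  (pint p (u \_ Omega) <= (s `^ p)%:E * leb Omega)%E.
Proof.
move=> mu s0 us; have mO := measurable_rV_open oO.
rewrite pint_patch// -integral_cst//; apply: ge0_le_integral.
- exact: mO.
- by move=> x _; rewrite lee_fin powR_ge0.
- exact: measurable_normp.
- exact: measurable_cst.
- by move=> x Ox; rewrite lee_fin ge0_ler_powR ?nnegrE ?(ltW p0)// us.
Qed.

Lemma leb_Omega_fin : (leb Omega < +oo)%E.
Proof.
apply: le_lt_trans (finite_leb_ball M0); apply: le_measure; rewrite ?inE//; first exact: measurable_rV_open.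
exact: measurable_ball.
Qed.

Lemma Lp_measurable u : Lp Omega p u -> measurable_fun Omega u.
Proof.
move=> /(LpP _ _ p1')[mu _]; have mO := measurable_rV_open oO.
by apply/(measurable_restrictT _ mO).
Qed.

(** Lower semicontinuity applied to the output of [conv_step], with [N] chosen first to make the
    transition cost small and [ka] afterwards to make the distance small. The energies of [u] and
    [v] are finite because [U] keeps a positive distance from the complement of [A]. *)
Lemma conv_ineq A u G U r v (t : R) : open A -> A `<=` Omega -> 0 < r ->
  Lp Omega p u -> hasX A u G -> open U -> U `<=` inset A r -> Ck 1 setT v -> 0 < t -> t < 1 ->
  (F (fun x => u x + t * v x)%R U <= t%:E * F (fun x => u x + v x)%R U + (1 - t)%:E * F u U)%E.
Proof.
move=> oA AO r0 Lu hG oU Ur v1 t0 t1.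
have UA : U `<=` A by apply: subset_trans Ur _; exact: inset_sub.
have UO := subset_trans UA AO.
have cv : continuous v by move=> x; exact: Ck_cts v1 _.
have Lv := C1_Lp cv.
have Luv : Lp Omega p (fun x => u x + v x).
  by have := Lp_add 1 Lu Lv; congr Lp; apply/funext => x; rewrite mul1r.
have Lutv : Lp Omega p (fun x => u x + t * v x) by exact: Lp_add.
have X1 : (0 <= F (fun x => u x + v x)%R U)%E by apply: F0.
have X0 : (0 <= F u U)%E by apply: F0.
have tt0 : 0 < 1 - t by rewrite subr_gt0.
apply: lsc_le => // [|e e0].
  by apply: adde_ge0; apply: mule_ge0 => //; rewrite lee_fin ltW.
have K0 : (0 : R) <= 2^-1 `^ (1 - p) by rewrite powR_ge0.
set Z := ((2^-1 `^ (1 - p))%:E * (En U G + En U (Xcv v)))%E.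
have Zoo : (Z < +oo)%E.
  apply: lte_mul_pinfty => //; apply: lte_add_pinfty.
    exact: (En_fin oA AO r0 hG oU Ur).2.
  exact: (En_fin oA AO r0 (hasX_C1 oA AO v1) oU Ur).2.
have Z0 : (0 <= Z)%E by rewrite mule_ge0 ?lee_fin// adde_ge0// En_ge0.
have ZE : Z = (fine Z)%:E by rewrite fineK// ge0_fin_numE.
have z0 : 0 <= fine Z by rewrite fine_ge0.
(* The three terms ensure respectively [1 <= t N], [t N + 1 <= N] and a transition cost of at most
   [e]. *)
pose N := (Num.truncn (t^-1 + (1 - t)^-1 + 8 * fine Z / e)).+1.
have NE : t^-1 + (1 - t)^-1 + 8 * fine Z / e < N%:R by exact: truncnS_gt.
have ti0 : 0 < t^-1 by rewrite invr_gt0.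
have ti1 : 0 < (1 - t)^-1 by rewrite invr_gt0.
have ze0 : 0 <= 8 * fine Z / e by rewrite divr_ge0 ?mulr_ge0 ?(ltW e0).
have N0 : 0 < N%:R :> R by rewrite ltr0n.
have tN : 1 <= t * N%:R.
  have h : t * t^-1 <= t * N%:R by rewrite ler_pM2l//; lra.
  by rewrite mulfV ?gt_eqF in h.
have tN1 : t * N%:R + 1 <= N%:R.
  have h : (1 - t) * (1 - t)^-1 <= (1 - t) * N%:R by rewrite ler_pM2l//; lra.
  rewrite mulfV ?gt_eqF// in h.
  by move: h; rewrite mulrBl mul1r; lra.
have NZ : 8 / N%:R * fine Z <= e.
  have : 8 * fine Z / e <= N%:R by lra.
  by rewrite ler_pdivrMr// mulrAC ler_pdivrMr// mulrC (mulrC e).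
have lO : leb Omega = (fine (leb Omega))%:E by rewrite fineK// ge0_fin_numE// leb_Omega_fin.
have lO0 : 0 <= fine (leb Omega) by rewrite fine_ge0.
have e1 : 0 < e / (fine (leb Omega) + 1) by rewrite divr_gt0// ltr_wpDl.
(* A uniform distance [s] on [Omega] has [p]-th power integral at most [s ^ p * leb Omega], hence at
   most [e]; [ka] is then [2 N / s]. *)
pose s := (e / (fine (leb Omega) + 1)) `^ p^-1.
have s0 : 0 < s by rewrite powR_gt0.
have sp : s `^ p = e / (fine (leb Omega) + 1) by rewrite -powRrM mulVf ?gt_eqF// powRr1// ltW.
have ka0 : 0 < 2 * N%:R / s by rewrite divr_gt0// mulr_gt0.
have [w [Lw wd Fw]] := conv_step oA AO r0 Lu hG oU Ur v1 tN tN1 ka0.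
have E : 2 * N%:R / (2 * N%:R / s) = s.
  by rewrite invf_div mulrA mulrC mulrA mulVf ?mul1r// gt_eqF// mulr_gt0.
rewrite E in wd.
exists w; split => //.
  apply: (@le_trans _ _ ((s `^ p)%:E * leb Omega)%E).
    apply: pint_Omega_le => //; last exact: ltW.
    by apply: measurable_funB; exact: Lp_measurable.
  rewrite lO sp -EFinM lee_fin -mulrA ler_piMr ?(ltW e0)// mulrC ler_pdivrMr ?ltr_wpDl//.
  by rewrite mul1r lerDl.
apply: le_trans Fw _; apply: leeD => //.
by rewrite -/Z ZE -EFinM lee_fin.
Qed.

Lemma hasX_scale A u G (k : R) : open A -> A `<=` Omega -> Lp Omega p u ->
  hasX A u G -> hasX A (fun x => k * u x) (fun x => k *: G x).
Proof.
move=> oA AO Lu hG; have := hasX_lin (k - 1) oA AO Lu Lu hG hG.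
congr hasX; apply/funext => x; first by ring.
by rewrite scalerBl scale1r addrCA subrr addr0.
Qed.

Lemma Lp_scale A u (k : R) : Lp A p u -> Lp A p (fun x => k * u x).
Proof.
by move=> Lu; have := Lp_add (k - 1) Lu Lu; congr Lp; apply/funext => x; ring.
Qed.

(** The direction [(w - u) / t] is not smooth, so [conv_ineq] is applied along a C^1 approximation
    [v] of it. Then [u + t v] approaches [w], and [F] at [u + v] is bounded by the energy of the
    extrapolated gradient; the factor [1 - t] on [F u U] is dropped. *)
Lemma lip_ineq A u w G H U r (t : R) : open A -> A `<=` Omega -> 0 < r ->
  Lp Omega p u -> Lp Omega p w -> hasX A u G -> hasX A w H -> open U -> U `<=` inset A r -> 0 < t -> t < 1 ->
  (F w U <= F u U + t%:E * En U (fun x => G x + t^-1 *: (H x - G x)))%E.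
Proof.
move=> oA AO r0 Lu Lw hG hH oU Ur t0 t1.
have UA : U `<=` A by apply: subset_trans Ur _; exact: inset_sub.
have UO := subset_trans UA AO.
have LD0 := Lp_add (-1) Lw Lu; have hD0 := hasX_lin (-1) oA AO Lw Lu hH hG.
have LD := Lp_scale t^-1 LD0; have hD := hasX_scale t^-1 oA AO LD0 hD0.
pose D x := t^-1 * (w x + -1 * u x); pose Q x := t^-1 *: (H x + -1 *: G x).
have hS := hasX_lin 1 oA AO Lu LD hG hD.
pose S x := G x + 1 *: Q x.
have SE : (fun x => G x + t^-1 *: (H x - G x)) = S.
  by apply/funext => x; rewrite /S /Q scale1r scaleN1r.
have -> : En U (fun x => G x + t^-1 *: (H x - G x)) = En U S by rewrite -SE.
have X0 : (0 <= F u U)%E by apply: F0.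
have E0 G' : (0 <= En U G')%E by exact: En_ge0.
apply: lsc_le => // [|e e0].
  by apply: adde_ge0 => //; apply: mule_ge0 => //; rewrite lee_fin ltW.
have mS j : measurable_fun U (fun x => S x 0 j).
  by apply: measurable_funS (hasX_meas j hS) => //; exact: measurable_rV_open.
have [IS _] := En_fin oA AO r0 hS oU Ur.
have [d d0 Hd] := En_cont oU UO mS IS e0.
have ed0 : 0 < Num.min e d by rewrite lt_min e0 d0.
have [v [v1 vD vQ]] := approx oA AO r0 LD hD oU Ur ed0.
have cv : continuous v by move=> x; exact: Ck_cts v1 _.
have Lv := C1_Lp cv.
exists (fun x => u x + t * v x); split; first exact: Lp_add.
  have -> : ((fun x => u x + t * v x) \- w) \_ Omega = fun x => t * ((v \- D) \_ Omega) x.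
    apply/funext => x; rewrite !patchE; case: ifP => _; rewrite ?mulr0// /= /D.
    by rewrite mulrBr mulrA mulfV ?gt_eqF// mul1r; ring.
  have mO := measurable_rV_open oO.
  have mvD : measurable_fun setT ((v \- D) \_ Omega).
    by apply/(measurable_restrictT _ _).1 => //; apply: measurable_funB; exact: Lp_measurable.
  rewrite pintZ// ger0_norm ?(ltW t0)//.
  apply: (@le_trans _ _ (1%:E * pint p ((v \- D)%R \_ Omega))%E).
    apply: lee_wpmul2r; first exact: pint_ge0.
    rewrite lee_fin (_ : 1 = 1 `^ p); last by rewrite powR1.
    apply: ge0_ler_powR; rewrite ?nnegrE ?(ltW p0) ?(ltW t0) ?(ltW t1)//.
  by rewrite mul1e; apply: le_trans vD _; rewrite lee_fin ge_min lexx.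
apply: le_trans (conv_ineq oA AO r0 Lu hG oU Ur v1 t0 t1) _.
rewrite addeC -addeA; apply: leeD.
  rewrite -[leRHS]mul1e; apply: lee_wpmul2r => //.
  by rewrite lee_fin lerBlDr lerDl ltW.
have huv := hasX_lin 1 oA AO Lu Lv hG (hasX_C1 oA AO v1).
have Luv := Lp_add 1 Lu Lv.
have uvE : (fun x => u x + v x) = (fun x => u x + 1 * v x) by apply/funext => x; rewrite mul1r.
have Fv : (F (fun x => u x + v x)%R U <= En U S + e%:E)%E.
  rewrite uvE; apply: le_trans (upper oA AO r0 Luv huv oU Ur) _.
  apply: Hd => j.
    by apply: measurable_funS (hasX_meas j huv) => //; exact: measurable_rV_open.
  have -> : (fun x => (G x + 1 *: Xcv v x) 0 j - S x 0 j) = (fun x => Xcv v x 0 j - Q x 0 j).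
    by apply/funext => x; rewrite /S !mxE; ring.
  by apply: le_trans (vQ j) _; rewrite lee_fin ge_min lexx orbT.
apply: (@le_trans _ _ (t%:E * (En U S + e%:E))%E).
  by apply: lee_wpmul2l => //; rewrite lee_fin ltW.
rewrite ge0_muleDr ?lee_fin ?(ltW e0)//; apply: leeD => //.
by rewrite -EFinM lee_fin ler_piMl ?(ltW e0)// ltW.
Qed.

(** * Densities and the integrand *)

(** Tested on open sets only, since [F] is given only there; [ae_le_open] recovers pointwise
    comparisons. *)
Definition is_density A u g := [/\ measurable_fun setT g, (forall x, 0 <= g x) &
  forall E, open E -> E `<=` A -> F u E = (\int[leb]_(x in E) (g x)%:E)%E].

Lemma core_En A u G (k : nat) : open A -> A `<=` Omega -> hasX A u G ->
  [/\ measurable_fun (core A k) (fun x => a x + b * eucl_norm (G x) `^ p),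
   (forall x, core A k x -> 0 <= a x + b * eucl_norm (G x) `^ p) & (En (core A k) G < +oo)%E].
Proof.
move=> oA AO hG; have k0 : 0 < k.+1%:R^-1 :> R by rewrite invr_gt0.
have kA := @core_sub A k; have oc := @open_core A k.
split.
- apply: measurable_density; [exact: oc|exact: subset_trans AO|move=> j].
  by apply: measurable_funS (hasX_meas j hG) => //; exact: measurable_rV_open.
- by move=> x /kA/AO Ox; exact: density_ge0.
- exact: (En_fin oA AO k0 hG oc (@core_inset A k)).2.
Qed.

(** [F u A] may be infinite, the growth bound being finite only away from the boundary of [A].
    Densities are therefore found on each core and glued along the layers, countable additivity of
    the measure giving the identity on every open subset. *)
Lemma densityP A u G : open A -> A `<=` Omega -> Lp Omega p u -> hasX A u G ->
  exists g, is_density A u g.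
Proof.
move=> oA AO Lu hG; have [mu muE] := Fmeas Lu.
have H (k : nat) : exists g, [/\ measurable_fun setT g, forall x, 0 <= g x &
    forall E, measurable E -> E `<=` core A k -> mu E = (\int[leb]_(x in E) (g x)%:E)%E].
  have [mh h0 hoo] := core_En k oA AO hG.
  apply: (density_exists (@open_core A k) mh h0 hoo) => U oU Uk.
  have UA : U `<=` A by apply: subset_trans (@core_sub A k).
  rewrite -muE; last by split => //; exact: subset_trans AO.
  by apply: (upper oA AO _ Lu hG oU (subset_trans Uk (@core_inset A k))); rewrite invr_gt0.
have {H} [g Hg] := choice H.
pose kk x : nat := xget 0%N [set k | seqDU (core A) k x].
have mA := measurable_rV_open oA.
have mcore k : measurable (core A k) by apply: measurable_rV_open; exact: open_core.
have mD k : measurable (seqDU (core A) k).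
  by apply: measurableD => //; exact: bigsetU_measurable.
have kkE k x : seqDU (core A) k x -> kk x = k.
  move=> Dx; rewrite /kk; case: xgetP => [l _ Dl|/(_ k)//].
  by have /trivIsetP/(_ k l Logic.I Logic.I) := @trivIset_seqDU _ (core A); case: (eqVneq k l) => // _ /(_ isT) /seteqP[+ _]; move=> /(_ x (conj Dx Dl)).
pose h x := g (kk x) x.
have mh : measurable_fun A h.
  rewrite -(core_bigcup oA) seqDU_bigcup_eq; apply/measurable_fun_bigcup => // k.
  apply: (@eq_measurable_fun _ _ _ _ _ (g k)) => [x|]; first by rewrite inE /h => /kkE ->.
  by apply: measurable_funTS; have [] := Hg k.
have [mh' h0' hE] := patch_density oA mh (fun x _ => let: And3 _ H _ := Hg (kk x) in H x).
exists (h \_ A); split => // E oE EA; have mE := measurable_rV_open oE.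
rewrite hE// muE; last by split => //; exact: subset_trans AO.
have EE : E = \bigcup_k (E `&` seqDU (core A) k).
  by rewrite -setI_bigcupr -seqDU_bigcup_eq core_bigcup// setIidl.
have mED k : measurable (E `&` seqDU (core A) k) by exact: measurableI.
have tED : trivIset setT (fun k => E `&` seqDU (core A) k).
  exact/trivIset_setIl/trivIset_seqDU.
rewrite [LHS](congr1 mu EE) measure_semi_bigcup//; last exact: bigcupT_measurable.
rewrite [in RHS]EE ge0_integral_bigcup//; last first.
- by move=> x _; rewrite lee_fin; have [_ /(_ x)] := Hg (kk x).
- by rewrite -EE; apply/measurable_EFinP; exact: measurable_funS mh.
apply: eq_eseriesr => k _; have [_ _ gE] := Hg k.
rewrite gE//; last by move=> x [_ []].
by apply: eq_integral => x /set_mem[_ /kkE kx]; rewrite /h kx.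
Qed.

Lemma ae_core A (P : 'rV[R]_n -> Prop) : open A ->
  (forall k : nat, {ae leb, forall x, core A k x -> P x}) -> {ae leb, forall x, A x -> P x}.
Proof.
move=> oA H; have : {ae leb, forall x, forall k, core A k x -> P x} by exact: ae_foralln.
by apply: ae_mono => x Hx; rewrite -{1}(core_bigcup oA) => -[k _ /Hx].
Qed.

Lemma density_bound A u G g : open A -> A `<=` Omega -> Lp Omega p u -> hasX A u G -> is_density A u g ->
  {ae leb, forall x, A x -> g x <= a x + b * eucl_norm (G x) `^ p}.
Proof.
move=> oA AO Lu hG [mg g0 gE]; apply: ae_core => // k.
have [mh h0 hoo] := core_En k oA AO hG.
apply: ae_le_open => //; first exact: (@open_core A k).
  exact: measurable_funTS.
move=> U oU Uk; rewrite -gE//; last by apply: subset_trans (@core_sub A k).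
by apply: (upper oA AO _ Lu hG oU (subset_trans Uk (@core_inset A k))); rewrite invr_gt0.
Qed.

Lemma density_fin A u G g (k : nat) : open A -> A `<=` Omega -> Lp Omega p u -> hasX A u G -> is_density A u g ->
  (\int[leb]_(x in core A k) (g x)%:E < +oo)%E.
Proof.
move=> oA AO Lu hG [mg g0 gE]; rewrite -gE; [|exact: (@open_core A k)|exact: core_sub].
have [mh h0 hoo] := core_En k oA AO hG; apply: le_lt_trans hoo.
have k0 : 0 < k.+1%:R^-1 :> R by rewrite invr_gt0.
exact: (upper oA AO k0 Lu hG (@open_core A k) (@core_inset A k)).
Qed.

Lemma density_lip A u w G H g h (t : R) : open A -> A `<=` Omega -> Lp Omega p u -> Lp Omega p w ->
  hasX A u G -> hasX A w H -> is_density A u g -> is_density A w h -> 0 < t -> t < 1 ->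
  {ae leb, forall x, A x -> h x <= g x + t * (a x + b * eucl_norm (G x + t^-1 *: (H x - G x)) `^ p)}.
Proof.
move=> oA AO Lu Lw hG hH dg dh t0 t1; have [mg g0 gE] := dg; have [mh h0 hE] := dh.
have hD0 := hasX_lin (-1) oA AO Lw Lu hH hG.
have hD := hasX_scale t^-1 oA AO (Lp_add (-1) Lw Lu) hD0.
have := hasX_lin 1 oA AO Lu (Lp_scale t^-1 (Lp_add (-1) Lw Lu)) hG hD.
rewrite (_ : (fun x => G x + _) = fun x => G x + t^-1 *: (H x - G x)); last first.
  by apply/funext => x; rewrite scale1r scaleN1r.
move=> hS; apply: ae_core => // k.
have [mS S0 Soo] := core_En k oA AO hS; have oc := @open_core A k; have mc := measurable_rV_open oc.
have mg' U : measurable_fun U g by exact: measurable_funTS.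
have mtS U : measurable U -> U `<=` core A k -> measurable_fun U (fun x => t * (a x + b * eucl_norm (G x + t^-1 *: (H x - G x)) `^ p)).
  by move=> mU Uk; apply: measurable_funM => //; exact: measurable_funS mS.
have SE U : open U -> U `<=` core A k -> (\int[leb]_(x in U) (g x + t * (a x + b * eucl_norm (G x + t^-1 *: (H x - G x)) `^ p))%:E =
    \int[leb]_(x in U) (g x)%:E + t%:E * En U (fun x => G x + t^-1 *: (H x - G x)))%E.
  move=> oU Uk; have mU := measurable_rV_open oU.
  under eq_integral do rewrite EFinD.
  rewrite ge0_integralD//; last first.
  - by apply/measurable_EFinP; exact: mtS.
  - by move=> x Ux; rewrite lee_fin mulr_ge0 ?(ltW t0)//; apply: S0; exact: Uk.
  - exact/measurable_EFinP.
  - by move=> x _; rewrite lee_fin.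
  congr (_ + _)%E; under eq_integral do rewrite EFinM.
  rewrite ge0_integralZl//; last by rewrite lee_fin ltW.
  - by apply/measurable_EFinP; exact: measurable_funS mS.
  - by move=> x Ux; rewrite lee_fin; apply: S0; exact: Uk.
apply: ae_le_open => //.
- exact: measurable_funTS.
- by apply: measurable_funD => //; exact: mtS.
- by move=> x xk; apply: addr_ge0 => //; rewrite mulr_ge0 ?(ltW t0)//; exact: S0.
- rewrite SE//; apply: lte_add_pinfty; first exact: density_fin hG dg.
  by apply: lte_mul_pinfty => //; rewrite lee_fin ltW.
- move=> U oU Uk; have UA : U `<=` A by apply: subset_trans (@core_sub A k).
  rewrite SE// -gE// -hE//.
  by apply: (lip_ineq oA AO _ Lu Lw hG hH oU (subset_trans Uk (@core_inset A k))); rewrite ?invr_gt0.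
Qed.

Lemma density_conv A u G v (t : R) g0 g1 gt : open A -> A `<=` Omega -> Lp Omega p u -> hasX A u G ->
  Ck 1 setT v -> 0 < t -> t < 1 -> is_density A u g0 -> is_density A (fun x => u x + v x) g1 ->
  is_density A (fun x => u x + t * v x) gt ->
  {ae leb, forall x, A x -> gt x <= t * g1 x + (1 - t) * g0 x}.
Proof.
move=> oA AO Lu hG v1 t0 t1 d0 d1 [mgt gt0 gtE]; have [mg0 g00 g0E] := d0; have [mg1 g10 g1E] := d1.
have Lv : Lp Omega p v by apply: C1_Lp => x; exact: Ck_cts v1 _.
have hv := hasX_C1 oA AO v1.
have E1 : (fun x => u x + v x) = (fun x => u x + 1 * v x) by apply/funext => x; rewrite mul1r.
have Luv : Lp Omega p (fun x => u x + v x) by rewrite E1; exact: Lp_add.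
have huv := hasX_lin 1 oA AO Lu Lv hG hv; rewrite -E1 in huv.
have s0 : 0 <= 1 - t by rewrite subr_ge0 ltW.
apply: ae_core => // k; have oc := @open_core A k.
have SE U : open U -> (\int[leb]_(x in U) (t * g1 x + (1 - t) * g0 x)%:E =
    t%:E * \int[leb]_(x in U) (g1 x)%:E + (1 - t)%:E * \int[leb]_(x in U) (g0 x)%:E)%E.
  move=> oU; have mU := measurable_rV_open oU.
  under eq_integral do rewrite EFinD !EFinM.
  rewrite ge0_integralD//; last first.
  - by apply/measurable_EFinP; apply: measurable_funM => //; exact: measurable_funTS.
  - by move=> x Ux; rewrite lee_fin mulr_ge0.
  - by apply/measurable_EFinP; apply: measurable_funM => //; exact: measurable_funTS.
  - by move=> x Ux; rewrite lee_fin mulr_ge0 ?(ltW t0).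
  congr (_ + _)%E; rewrite ge0_integralZl ?lee_fin ?(ltW t0)//.
  - by apply/measurable_EFinP; exact: measurable_funTS.
  - by move=> x _; rewrite lee_fin.
  - by apply/measurable_EFinP; exact: measurable_funTS.
  - by move=> x _; rewrite lee_fin.
apply: ae_le_open => //.
- exact: measurable_funTS.
- by apply: measurable_funTS; apply: measurable_funD; exact: measurable_funM.
- by move=> x xk; apply: addr_ge0; rewrite mulr_ge0 ?(ltW t0).
- rewrite SE//; apply: lte_add_pinfty; (apply: lte_mul_pinfty; [by rewrite lee_fin// ltW|by []|]).
    exact: density_fin huv d1.
  exact: density_fin hG d0.
- move=> U oU Uk; have UA : U `<=` A by apply: subset_trans (@core_sub A k).
  rewrite SE// -g0E// -g1E// -gtE//.
  by apply: (conv_ineq oA AO _ Lu hG oU (subset_trans Uk (@core_inset A k)) v1); rewrite ?invr_gt0.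
Qed.

(** * Rational slopes and the integrand *)

Lemma Xcv_lin (xi : 'rV[R]_n) x : Xcv (lin xi) x = \row_j \sum_i c j i x * xi 0 i.
Proof.
apply/rowP => j; rewrite !mxE; apply: eq_bigr => i _; by rewrite partial_lin.
Qed.

Lemma Xcv_linD (xi nu : 'rV[R]_n) (s : R) x : Xcv (lin (xi + s *: nu)) x = Xcv (lin xi) x + s *: Xcv (lin nu) x.
Proof.
rewrite !Xcv_lin; apply/rowP => j; rewrite !mxE mulr_sumr -big_split/=; apply: eq_bigr => i _.
by rewrite !mxE; ring.
Qed.

(** Linear independence of the vectors [X_j(x)] means that the matrix with these rows has full row
    rank, hence a right inverse [B]. *)
Lemma free_surj x (eta : 'rV[R]_m) : free [seq vfield c j x | j <- enum 'I_m] ->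
  exists xi, Xcv (lin xi) x = eta.
Proof.
move=> fX; pose M := \matrix_(j < m, i < n) c j i x.
have /row_freeP[B MB] : row_free M.
  apply: inj_row_free => xi vM; apply/rowP => j; rewrite [RHS]mxE.
  have tE : (map_tuple (fun j => vfield c j x) (ord_tuple m)) = [seq vfield c j x | j <- enum 'I_m] :> seq _ by [].
  rewrite -tE in fX; have /freeP/(_ (xi 0)) := fX; apply.
  rewrite -[RHS]vM mulmx_sum_row; apply: eq_bigr => i _; congr (_ *: _).
  rewrite -tnth_nth tnth_map tnth_ord_tuple.
  by apply/rowP => k; rewrite !mxE.
have E : M *m (B *m eta^T) = eta^T by rewrite mulmxA MB mul1mx.
exists (B *m eta^T)^T; rewrite Xcv_lin; apply/rowP => j.
transitivity ((M *m (B *m eta^T)) j 0); last by rewrite E mxE.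
by rewrite mxE [RHS]mxE; apply: eq_bigr => i _; rewrite [M _ _]mxE [_^T _ _]mxE.
Qed.

Lemma slopes_dense x (eta : 'rV[R]_m) (e : R) : Omega x -> free [seq vfield c j x | j <- enum 'I_m] ->
  0 < e -> exists q, `|Xcv (lin (ratv q)) x - eta| < e.
Proof.
move=> Ox fX e0; have [xi <-] := free_surj eta fX.
have d0 : 0 < e / (n%:R * Mc + 1) by rewrite divr_gt0// ltr_wpDl// mulr_ge0.
have [q qv] := ratv_near xi d0.
exists q; apply: norm_row_lt => // j; rewrite !Xcv_lin !mxE -sumrB.
apply: le_lt_trans (ler_norm_sum _ _ _) _.
apply: (@le_lt_trans _ _ (\sum_(i < n) Mc * (e / (n%:R * Mc + 1)))).
  apply: ler_sum => i _; rewrite -mulrBr normrM; apply: ler_pM => //; first exact: cM.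
  exact/ltW/qv.
have -> : \sum_(i < n) Mc * (e / (n%:R * Mc + 1)) = n%:R * Mc * e / (n%:R * Mc + 1).
  by rewrite sumr_const card_ord -[LHS]mulr_natl !mulrA.
rewrite ltr_pdivrMr ?ltr_wpDl ?mulr_ge0//.
by rewrite [ltRHS]mulrC ltr_pM2r// ltrDl.
Qed.

Lemma slope_densities : exists gq : 'rV[rat]_n -> 'rV[R]_n -> R, forall q,
  is_density Omega (lin (ratv q)) (gq q).
Proof.
have H q : exists g, is_density Omega (lin (ratv q)) g; last by have [gq] := choice H; exists gq.
apply: densityP (hasX_C1 oO _ (Ck_lin _)) => //.
by apply: C1_Lp => x; exact: Ck_cts (Ck_lin _) _.
Qed.

(** The X-gradient of a rational linear function, set to 0 outside [Omega] so that it is Borel on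
    the whole space although the coefficients are controlled on [Omega] only. *)
Definition slope q x : 'rV[R]_m := \row_j ((fun y => Xcv (lin (ratv q)) y 0 j) \_ Omega) x.

Lemma slopeE q x : Omega x -> slope q x = Xcv (lin (ratv q)) x.
Proof. by move=> Ox; apply/rowP => j; rewrite mxE patchE mem_set. Qed.

Implicit Types gq : 'rV[rat]_n -> 'rV[R]_n -> R.

Definition integrand gq x (eta : 'rV[R]_m) : \bar R :=
  envelope (slope^~ x) (gq^~ x) ((a \_ Omega) x) b p eta.

Lemma a_patch_ge0 x : 0 <= (a \_ Omega) x.
Proof. by rewrite patchE; case: ifPn => // /set_mem/a0. Qed.

Lemma measurable_slope q j : measurable_fun setT (fun x => slope q x 0 j).
Proof.
have mO := measurable_rV_open oO.
under eq_fun do rewrite mxE.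
apply/(measurable_restrictT _ _).1 => //.
by have := hasX_meas j (hasX_C1 oO (@subset_refl _ _) (Ck_lin (ratv q))).
Qed.

Lemma measurable_integrand gq : (forall q, measurable_fun setT (gq q)) ->
  measurable_fun setT (fun w : 'rV[R]_n * 'rV[R]_m => integrand gq w.1 w.2).
Proof.
move=> mg; have mO := measurable_rV_open oO.
apply: (measurable_ereal_inf_count (0, 0%N)) => -[q k] /=.
apply/measurable_EFinP; apply: measurable_funD.
  exact: measurableT_comp measurable_fst.
apply: measurable_funM => //; apply: measurable_funD.
  apply: (measurableT_comp (f := a \_ Omega)) measurable_fst.
  by apply/(measurable_restrictT _ _).1 => //; exact: la.1.
apply: measurable_funM => //; apply: (measurableT_comp (f := fun t : R => t `^ p)); first exact: measurable_powR.
apply: measurable_eucl => j.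
have ms : measurable_fun setT (fun w : 'rV[R]_n * 'rV[R]_m => slope q w.1 0 j).
  exact: (measurableT_comp (measurable_slope _ j) measurable_fst).
have mw : measurable_fun setT (fun w : 'rV[R]_n * 'rV[R]_m => w.2 0 j).
  exact: (measurableT_comp (measurable_rV_coord j) measurable_snd).
rewrite (_ : (fun w : 'rV[R]_n * 'rV[R]_m => _) = fun w : 'rV[R]_n * 'rV[R]_m => slope q w.1 0 j +
  k.+2%:R * (w.2 0 j - slope q w.1 0 j)); last by apply/funext => y; rewrite !mxE.
by apply: measurable_funD => //; apply: measurable_funM => //; exact: measurable_funB.
Qed.

Lemma lip_all A u G h gq : open A -> A `<=` Omega -> Lp Omega p u -> hasX A u G -> is_density A u h ->
  (forall q, is_density Omega (lin (ratv q)) (gq q)) ->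
  {ae leb, forall x, A x -> forall q (k : nat), h x <= gq q x + penalty (a x) b p (slope q x) k (G x) /\
    gq q x <= h x + penalty (a x) b p (G x) k (slope q x)}.
Proof.
move=> oA AO Lu hG dh dg.
have : {ae leb, forall x, forall qk : 'rV[rat]_n * nat, A x ->
    h x <= gq qk.1 x + penalty (a x) b p (slope qk.1 x) qk.2 (G x) /\
    gq qk.1 x <= h x + penalty (a x) b p (G x) qk.2 (slope qk.1 x)}.
  apply: ae_forall_count => -[q k] /=.
  have t0 : 0 < k.+2%:R^-1 :> R by rewrite invr_gt0.
  have t1 : k.+2%:R^-1 < 1 :> R by rewrite invf_lt1// ltr1n.
  have hq := hasX_C1 oA AO (Ck_lin (ratv q)).
  have Lq : Lp Omega p (lin (ratv q)) by apply: C1_Lp => x; exact: Ck_cts (Ck_lin _) _.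
  have dq : is_density A (lin (ratv q)) (gq q).
    by have [mg g0 gE] := dg q; split => // E oE EA; apply: gE => //; exact: subset_trans AO.
  have H1 := density_lip oA AO Lu Lq hG hq dh dq t0 t1.
  have H2 := density_lip oA AO Lq Lu hq hG dq dh t0 t1.
  have : {ae leb, forall x, (A x -> _) /\ (A x -> _)} := ae_and H1 H2.
  apply: ae_mono => x [{}H1 {}H2] Ax; have Ox := AO _ Ax.
  move: (H1 Ax) (H2 Ax); rewrite invrK -(slopeE q Ox) => {}H1 {}H2; split.
  - exact: H2.
  - exact: H1.
by apply: ae_mono => x H Ax q k; exact: (H (q, k) Ax).
Qed.

Lemma ratv_segment (q0 q1 : 'rV[rat]_n) (s : rat) :
  ratv (q0 + s *: (q1 - q0)) = ratv q0 + ratr s *: ratv (q1 - q0) :> 'rV[R]_n.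
Proof. by apply/rowP => i; rewrite !mxE rmorphD rmorphM. Qed.

(** Rational weights keep the intermediate slopes rational, so countably many exceptional null sets
    are involved; real weights are recovered by continuity in [envelope_segment]. *)
Lemma conv_all gq : (forall q, is_density Omega (lin (ratv q)) (gq q)) ->
  {ae leb, forall x, Omega x -> forall q0 q1 (s : rat), 0 < s -> s < 1 ->
    gq (q0 + s *: (q1 - q0)) x <= ratr s * gq q1 x + (1 - ratr s) * gq q0 x}.
Proof.
move=> dg.
have : {ae leb, forall x, forall w : 'rV[rat]_n * 'rV[rat]_n * rat, Omega x -> 0 < w.2 -> w.2 < 1 ->
    gq (w.1.1 + w.2 *: (w.1.2 - w.1.1)) x <= ratr w.2 * gq w.1.2 x + (1 - ratr w.2) * gq w.1.1 x}.
  apply: ae_forall_count => -[[q0 q1] s] /=.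
  have [s0|s0] := boolP (0 < s); last by apply: aeW.
  have [s1|s1] := boolP (s < 1); last by apply: aeW.
  have Lq : Lp Omega p (lin (ratv q0)) by apply: C1_Lp => x; exact: Ck_cts (Ck_lin _) _.
  have r0 : 0 < ratr s :> R by rewrite ltr0q.
  have r1 : ratr s < 1 :> R by rewrite -(rmorph1 (@ratr R)) ltr_rat.
  have hq := hasX_C1 oO (@subset_refl _ _) (Ck_lin (ratv q0)).
  have := @density_conv Omega (lin (ratv q0)) _ (lin (ratv (q1 - q0))) (ratr s) (gq q0) (gq q1)
    (gq (q0 + s *: (q1 - q0))) oO (@subset_refl _ _) Lq hq (Ck_lin _) r0 r1 (dg q0).
  rewrite linD -ratv_segment.
  have -> : (fun x => lin (ratv q0) x + lin (ratv (q1 - q0)) x) = lin (ratv q1) :> ('rV[R]_n -> R).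
    rewrite (_ : (fun x => _) = fun x => lin (ratv q0) x + 1 * lin (ratv (q1 - q0)) x); last first.
      by apply/funext => x; rewrite mul1r.
    by rewrite linD; congr lin; apply/rowP => i; rewrite !mxE rmorphB mul1r addrC subrK.
  by move=> /(_ (dg q1) (dg _)); apply: ae_mono => x H Ox _ _; exact: H.
by apply: ae_mono => x H Ox q0 q1 s s0 s1; exact: (H (q0, q1, s) Ox s0 s1).
Qed.

Lemma LIC_ae : LIC c Omega -> {ae leb, forall x, Omega x -> free [seq vfield c j x | j <- enum 'I_m]}.
Proof.
move=> [N [NO [C cC NE] N0 H]]; exists N; split => //.
  by rewrite NE; apply: measurableI; [exact: measurable_rV_open|exact: closed_rV_measurable].
by move=> x /= /not_implyP[Ox nf]; apply: contrapT => Nx; apply: nf; exact: H.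
Qed.

Lemma bound_all gq : (forall q, is_density Omega (lin (ratv q)) (gq q)) ->
  {ae leb, forall x, Omega x -> forall q, gq q x <= a x + b * eucl_norm (slope q x) `^ p}.
Proof.
move=> dg; have : {ae leb, forall x, forall q, Omega x -> gq q x <= a x + b * eucl_norm (slope q x) `^ p}.
  apply: ae_forall_count => q.
  have Lq : Lp Omega p (lin (ratv q)) by apply: C1_Lp => x; exact: Ck_cts (Ck_lin _) _.
  have := density_bound oO (@subset_refl _ _) Lq (hasX_C1 oO (@subset_refl _ _) (Ck_lin _)) (dg q).
  by apply: ae_mono => x H Ox; rewrite slopeE//; exact: H.
by apply: ae_mono => x H Ox q; exact: H.
Qed.

Lemma lip_slopes gq : (forall q, is_density Omega (lin (ratv q)) (gq q)) ->
  {ae leb, forall x, Omega x -> forall q q' (k : nat), gq q' x <= gq q x + penalty (a x) b p (slope q x) k (slope q' x)}.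
Proof.
move=> dg; have : {ae leb, forall x, forall q', Omega x -> forall q (k : nat),
    gq q' x <= gq q x + penalty (a x) b p (slope q x) k (slope q' x)}.
  apply: ae_forall_count => q'.
  have Lq : Lp Omega p (lin (ratv q')) by apply: C1_Lp => x; exact: Ck_cts (Ck_lin _) _.
  have := lip_all oO (@subset_refl _ _) Lq (hasX_C1 oO (@subset_refl _ _) (Ck_lin _)) (dg q') dg.
  by apply: ae_mono => x H Ox q k; rewrite (slopeE q' Ox); exact: (H Ox q k).1.
by apply: ae_mono => x H Ox q q' k; exact: H.
Qed.

Lemma integrandE gq x eta : Omega x -> integrand gq x eta = envelope (slope^~ x) (gq^~ x) (a x) b p eta.
Proof. by move=> Ox; rewrite /integrand patchE mem_set. Qed.

Lemma slope_dense_ae : LIC c Omega -> {ae leb, forall x, Omega x ->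
  forall (eta : 'rV[R]_m) (e : R), 0 < e -> exists q, `|slope q x - eta| < e}.
Proof.
move=> /LIC_ae; apply: ae_mono => x H Ox eta e e0.
by have [q qe] := slopes_dense eta Ox (H Ox) e0; exists q; rewrite slopeE.
Qed.

(** At almost every [x] the two-sided inequalities between [u] and the rational linear functions are
    those required by [envelope_unique], with slope [G x] and value [h x]; (LIC) supplies the
    density of slopes. *)
Lemma integrand_Xgrad A u G h gq : LIC c Omega -> open A -> A `<=` Omega -> Lp Omega p u -> hasX A u G ->
  is_density A u h -> (forall q, is_density Omega (lin (ratv q)) (gq q)) ->
  {ae leb, forall x, A x -> integrand gq x (G x) = (h x)%:E}.
Proof.
move=> lic oA AO Lu hG dh dg.
have : {ae leb, forall x, _ /\ (A x -> _)} := ae_and (slope_dense_ae lic) (lip_all oA AO Lu hG dh dg).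
apply: ae_mono => x [den lip] Ax; have Ox := AO _ Ax.
rewrite integrandE//; apply: (@envelope_unique R m _ (slope^~ x) (gq^~ x)) => //.
- exact: ltW.
- exact: a0.
- exact: den.
- by move=> q k; have [] := lip Ax q k.
- by move=> q k; have [] := lip Ax q k.
Qed.

Lemma integral_representation : LIC c Omega -> exists f : 'rV[R]_n -> 'rV[R]_m -> \bar R,
    [/\ (forall x eta, Omega x -> (0 <= f x eta)%E),
        measurable_fun (Omega `*` [set: 'rV[R]_m])
          (fun z : 'rV[R]_n * 'rV[R]_m => f z.1 z.2),
        (forall u A, Lp Omega p u -> open_subsets Omega A ->
          W1pX_loc c A p u ->
          F u A = (\int[@lebesgue_rV R n]_(x in A) f x (Xgrad c A u x))%E),
        {ae @lebesgue_rV R n, forall x, Omega x ->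
          (forall eta, f x eta \is a fin_num) /\
          convex_function [set: 'rV[R]_m] (fun eta => fine (f x eta))} &
        {ae @lebesgue_rV R n, forall x, Omega x -> forall eta,
          (0 <= f x eta <= (a x + b * eucl_norm eta `^ p)%:E)%E}].
Proof.
move=> lic; have [gq dg] := slope_densities; exists (integrand gq).
have g0 q x : 0 <= gq q x by have [_ ? _] := dg q.
have i0 x eta : (0 <= integrand gq x eta)%E.
  by apply: envelope_ge0 => //; [exact: ltW|exact: a_patch_ge0].
have mi := measurable_integrand (fun q => let: And3 mg _ _ := dg q in mg).
have good : {ae leb, forall x, Omega x -> (forall eta, integrand gq x eta \is a fin_num) /\
    (forall eta, fine (integrand gq x eta) <= a x + b * eucl_norm eta `^ p) /\
    convex_function [set: 'rV[R]_m] (fun eta => fine (integrand gq x eta))}.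
  have : {ae leb, forall x, (Omega x -> _) /\ (Omega x -> _) /\ (Omega x -> _) /\ (Omega x -> _)} :=
    ae_and (slope_dense_ae lic) (ae_and (lip_slopes dg) (ae_and (bound_all dg) (conv_all dg))).
  apply: ae_mono => x [den [lip [bnd con]]] Ox.
  have {}den := den Ox; have {}lip := lip Ox; have {}bnd := bnd Ox; have {}con := con Ox.
  have -> : (integrand gq x) = envelope (slope^~ x) (gq^~ x) (a x) b p.
    by apply/funext => eta; rewrite integrandE.
  split => [eta|]; first by apply: envelope_fin => //; [exact: ltW|exact: a0].
  split => [eta|]; first by apply: envelope_bound => //; [exact: ltW|exact: a0].
  apply: envelope_convex => //; [exact: ltW|exact: a0|].
  move=> q0 q1 s s0 s1; exists (q0 + s *: (q1 - q0)); last exact: con.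
  rewrite !slopeE// ratv_segment Xcv_linD.
  have -> : ratv q1 = ratv q0 + 1 *: ratv (q1 - q0) :> 'rV[R]_n.
    by apply/rowP => i; rewrite !mxE rmorphB mul1r addrC subrK.
  rewrite Xcv_linD.
  by apply/rowP => i; rewrite !mxE; ring.
split => //.
- by apply: measurable_funS mi.
- move=> u A Lu [oA AO] wu.
  have iu := Lp_intg p1' Lu.
  have [G hG] := glue p1' oA AO iu wu.
  have [h dh] := densityP oA AO Lu hG; have [mh h0 hE] := dh.
  have gG : is_Xgrad c A u (Xgrad c A u) := getPex (ex_intro _ G hG.1).
  have mA := measurable_rV_open oA.
  rewrite hE//; apply: ae_eq_integral => //.
  + by apply/measurable_EFinP; exact: measurable_funTS.
  (* The chosen gradient is measurable on [A] only; setting it to 0 elsewhere allows composition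
     with the Borel integrand. *)
  + pose H x : 'rV[R]_m := \row_j ((fun y => Xgrad c A u y 0 j) \_ A) x.
    apply: (@eq_measurable_fun _ _ _ _ _ (fun x => integrand gq x (H x))) => [x /set_mem Ax|].
      by congr integrand; apply/rowP => j; rewrite mxE patchE mem_set.
    apply: measurable_funTS; apply: (measurableT_comp mi) (measurable_fun_pair _ _) => //.
    apply: measurable_fun_rV => j; under eq_fun do rewrite mxE.
    by apply/(measurable_restrictT _ _).1 => //; exact: (gG j).1.1.
  + have : {ae leb, forall x, (A x -> _) /\ (A x -> _)} :=
      ae_and (integrand_Xgrad lic oA AO Lu hG dh dg) (ae_unique oA AO iu hG.1 gG).
    by apply: ae_mono => x [H1 H2] Ax; rewrite -H2// H1.
- by apply: ae_mono good => x H Ox; have [? []] := H Ox.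
- apply: ae_mono good => x H Ox eta; have [fin [bnd _]] := H Ox.
  by rewrite i0 /= -(fineK (fin eta)) lee_fin.
Qed.

End X_calculus.

(** * Uniform constants for the coefficients, and conclusion *)

Lemma bounded_set_ball (R : realType) n (A : set 'rV[R]_n) : bounded_set A ->
  exists M : R, 0 <= M /\ A `<=` ball 0 M.
Proof.
move=> [M [Mr H]]; exists (`|M| + 2); split=> [|x Ax]; first by rewrite addr_ge0.
have M1 : M < `|M| + 1 by rewrite ltr_pwDr// ler_norm.
have /= := H _ M1 x Ax.
by rewrite -ball_normE /= sub0r normrN => /le_lt_trans; apply; rewrite ltrD2l ltr1n.
Qed.

Lemma lipschitz_family (R : realType) n (I J : finType) (A : set 'rV[R]_n) (f : I -> J -> 'rV[R]_n -> R) :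
  (forall i j, [lipschitz f i j x | x in A]) -> exists2 L : R, 0 <= L &
    forall i j x y, A x -> A y -> `|f i j y - f i j x| <= L * `|y - x|.
Proof.
move=> lf; have H (ij : I * J) : exists L : R, 0 < L /\
    forall x y, A x -> A y -> `|f ij.1 ij.2 y - f ij.1 ij.2 x| <= L * `|y - x|.
  by have [L L0 fL] := lipschitzP (lf ij.1 ij.2); exists L.
have {H} [L LP] := choice H.
have L0 ij : 0 <= L ij by rewrite ltW// (LP ij).1.
exists (\sum_ij L ij) => [|i j x y Ax Ay]; first exact: sumr_ge0.
apply: le_trans ((LP (i, j)).2 x y Ax Ay) _; rewrite ler_wpM2r//.
by rewrite (bigD1 (i, j))//= lerDl sumr_ge0.
Qed.

Lemma bounded_family (R : realType) n (I J : finType) (A : set 'rV[R]_n) (f : I -> J -> 'rV[R]_n -> R) (L M : R) :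
  0 <= L -> 0 <= M -> A `<=` ball 0 M ->
  (forall i j x y, A x -> A y -> `|f i j y - f i j x| <= L * `|y - x|) ->
  exists2 C : R, 0 <= C & forall i j x, A x -> `|f i j x| <= C.
Proof.
move=> L0 M0 AM fL; have [[x0 Ax0]|A0] := pselect (A !=set0); last first.
  by exists 0 => // i j x Ax; case: A0; exists x.
exists (\sum_i \sum_j `|f i j x0| + L * (M + M)) => [|i j x Ax].
  by rewrite addr_ge0 ?mulr_ge0 ?addr_ge0// sumr_ge0// => i _; exact: sumr_ge0.
rewrite -[f i j x](subrK (f i j x0)) addrC; apply: le_trans (ler_normD _ _) _; apply: lerD.
  rewrite (bigD1 i)//= (bigD1 j)//= -addrA lerDl addr_ge0 ?sumr_ge0// => k _; exact: sumr_ge0.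
apply: le_trans (fL i j x0 x Ax0 Ax) _; rewrite ler_wpM2l//.
move: (AM x Ax) (AM x0 Ax0); rewrite -ball_normE /= !sub0r !normrN => /ltW xM /ltW x0M.
by apply: le_trans (ler_normB _ _) _; exact: lerD.
Qed.

Theorem theorem3p12 (R : realType) (n m : nat) (n_gt0 : (0 < n)%N)
    (m_gt0 : (0 < m)%N) (Omega : set 'rV[R]_n)
    (c : 'I_m -> 'I_n -> 'rV[R]_n -> R) (p : R)
    (F : ('rV[R]_n -> R) -> set 'rV[R]_n -> \bar R)
    (a : 'rV[R]_n -> R) (b : R) :
  open Omega -> bounded_set Omega ->
  (forall j i, [lipschitz c j i x | x in Omega]) ->
  LIC c Omega ->
  1 < p ->
  nonneg_functional Omega p F ->
  increasing_functional Omega p F ->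
  local_functional Omega p F ->
  measure_functional Omega p F ->
  lsc_functional Omega p F ->
  (forall u A (k : R), Lp Omega p u -> open_subsets Omega A ->
    F (fun x => u x + k) A = F u A) ->
  L1loc Omega a -> (forall x, Omega x -> 0 <= a x) -> 0 < b ->
  (forall u A, Lp Omega p u -> open_subsets Omega A -> Ck 1 A u ->
    (F u A <= \int[@lebesgue_rV R n]_(x in A)
      (a x + b * eucl_norm (Xgrad c A u x) `^ p)%:E)%E) ->
  exists f : 'rV[R]_n -> 'rV[R]_m -> \bar R,
    [/\ (forall x eta, Omega x -> (0 <= f x eta)%E),
        measurable_fun (Omega `*` [set: 'rV[R]_m])
          (fun z : 'rV[R]_n * 'rV[R]_m => f z.1 z.2),
        (forall u A, Lp Omega p u -> open_subsets Omega A ->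
          W1pX_loc c A p u ->
          F u A = (\int[@lebesgue_rV R n]_(x in A) f x (Xgrad c A u x))%E),
        {ae @lebesgue_rV R n, forall x, Omega x ->
          (forall eta, f x eta \is a fin_num) /\
          convex_function [set: 'rV[R]_m] (fun eta => fine (f x eta))} &
        {ae @lebesgue_rV R n, forall x, Omega x -> forall eta,
          (0 <= f x eta <= (a x + b * eucl_norm eta `^ p)%:E)%E}].
Proof.
move=> oO /bounded_set_ball[M [M0 OM]] /lipschitz_family[L L0 cL] lic.
have [C C0 cC] := bounded_family L0 M0 OM cL.
move=> p1 F0 Finc Floc Fmeas Flsc Ftr la a0 b0 Fub.
exact: (integral_representation oO OM L0 C0 cL cC p1 m_gt0 F0 Floc Fmeas Flsc Ftr la a0 b0 Fub lic).
Qed.
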